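(* Let $N\ge 3$, $p\in(1,N)$ and $q\in(p,p^* )$, where $p^*:=\frac{Np}{N-p}$. Then the embedding $W^{1,p}_{rad}(\mathbb{R}^N)\subset L^q(\mathbb{R}^N)$ is compact.
   Context: $W^{1,p}_{rad}(\mathbb{R}^N)$ denotes the subspace of radial functions in $W^{1,p}(\mathbb{R}^N)$, with the $W^{1,p}$-norm. *)

(* Defs.v *)
From HB Require Import structures.
From mathcomp Require Import all_boot all_order all_algebra.
From mathcomp Require Import all_classical all_reals all_analysis.

Set Implicit Arguments.
Unset Strict Implicit.
Unset Printing Implicit Defensive.

Import Order.TTheory GRing.Theory Num.Theory.
Import numFieldTopology.Exports numFieldNormedType.Exports.

Local Open Scope classical_set_scope.
Local Open Scope ring_scope.

Definition rV_display : measure_display.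
Proof. exact: (measure_tuple_display default_measure_display). Qed.

Section rV_measurable.
Context {R : realType} {n : nat}.

Definition rV_coord (i : 'I_n) (v : 'rV[R]_n) : measurableTypeR R := v ord0 i.

Let rV_set0 : g_sigma_preimage rV_coord set0.
Proof. exact: sigma_algebra0. Qed.

Let rV_setC A : g_sigma_preimage rV_coord A -> g_sigma_preimage rV_coord (~` A).
Proof. exact: sigma_algebraC. Qed.

Let rV_bigcup (F : _^nat) : (forall i, g_sigma_preimage rV_coord (F i)) ->
  g_sigma_preimage rV_coord (\bigcup_i (F i)).
Proof. exact: sigma_algebra_bigcup. Qed.

(* The sigma-algebra on row vectors is the product of the Borel sigma-algebras
   of the coordinates, i.e., the Borel sigma-algebra of R^n. *)
HB.instance Definition _ := @isMeasurable.Build rV_display 'rV[R]_n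
  (g_sigma_preimage rV_coord) rV_set0 rV_setC rV_bigcup.

Lemma measurable_rV_coord (i : 'I_n) : measurable_fun [set: 'rV[R]_n] (rV_coord i).
Proof.
move=> _ Y mY; rewrite setTI; apply: sub_sigma_algebra => /=.
rewrite -bigcup_seq/=; exists i => /=; first by rewrite mem_index_enum.
by exists Y => //; rewrite setTI.
Qed.

Lemma measurable_fun_rVP d (T : measurableType d) (f : T -> 'rV[R]_n) :
  (forall i, measurable_fun [set: T] (rV_coord i \o f)) ->
  measurable_fun [set: T] f.
Proof.
move=> mf _ A mA; rewrite setTI.
have sub : g_sigma_preimage (fun i => rV_coord i \o f) `<=` measurable.
  apply: smallest_sub; first exact: sigma_algebra_measurable.
  rewrite -bigcup_seq => B [i _] [C mC <-]; exact: mf.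
apply: sub; rewrite g_sigma_preimage_comp.
by exists A => //; rewrite setTI.
Qed.

End rV_measurable.

Section rV_cons.
Context {R : realType} {n : nat}.
Implicit Type x : measurableTypeR R * 'rV[R]_n.

Definition rV_cons x : 'rV[R]_n.+1 := row_mx x.1%:M x.2.

Lemma rV_cons_ord0 x : rV_cons x ord0 ord0 = x.1.
Proof.
by rewrite mxE; case: splitP => // j _; rewrite [j]ord1 mxE /=.
Qed.

Lemma rV_cons_lift x (j : 'I_n) : rV_cons x ord0 (lift ord0 j) = x.2 ord0 j.
Proof.
rewrite mxE; case: splitP => [k|k /eqP].
  by rewrite ord1.
by rewrite eqSS => /eqP jk; congr (x.2 _ _); exact/val_inj.
Qed.

Lemma measurable_rV_cons : measurable_fun setT rV_cons.
Proof.
apply: measurable_fun_rVP => i.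
have [j ->|->] := unliftP ord0 i.
  rewrite (_ : _ \o _ = rV_coord j \o snd).
    by apply: measurableT_comp => //; exact: measurable_rV_coord.
  by apply/funext => x /=; rewrite /rV_coord rV_cons_lift.
rewrite (_ : _ \o _ = fst) //.
by apply/funext => x /=; rewrite /rV_coord rV_cons_ord0.
Qed.

Lemma measurable_rV_uncons : measurable_fun setT
  (fun v : 'rV[R]_n.+1 =>
    (v ord0 ord0, \row_j v ord0 (lift ord0 j)) : measurableTypeR R * 'rV[R]_n).
Proof.
apply/measurable_fun_pair; first exact: (measurable_rV_coord ord0).
apply: measurable_fun_rVP => i.
rewrite (_ : _ \o _ = rV_coord (lift ord0 i)); first exact: measurable_rV_coord.
by apply/funext => v; rewrite /rV_coord /= mxE.
Qed.

End rV_cons.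

Section rV_cons_measure.
Context {R : realType} {n : nat}.
Variable mu : {sigma_finite_measure set 'rV[R]_n -> \bar R}.
Local Open Scope ereal_scope.

Definition rV_cons_measure : set 'rV[R]_n.+1 -> \bar R :=
  pushforward (@lebesgue_measure R \x mu) rV_cons.

Let rV_cons_measure0 : rV_cons_measure set0 = 0.
Proof. by rewrite /rV_cons_measure /pushforward preimage_set0 measure0. Qed.

Let rV_cons_measure_ge0 A : 0 <= rV_cons_measure A.
Proof. exact: (measure_ge0 (@lebesgue_measure R \x mu)). Qed.

Let rV_cons_measure_sigma_additive : semi_sigma_additive rV_cons_measure.
Proof.
move=> F mF tF mUF; rewrite /rV_cons_measure /pushforward preimage_bigcup.
apply: measure_semi_sigma_additive.
- by move=> n'; rewrite -[X in measurable X]setTI; exact: measurable_rV_cons.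
- apply/trivIsetP => /= i j _ _ ij; rewrite -preimage_setI.
  by move/trivIsetP : tF => /(_ _ _ _ _ ij) ->//; rewrite preimage_set0.
- rewrite -preimage_bigcup -[X in measurable X]setTI.
  exact: measurable_rV_cons.
Qed.

HB.instance Definition _ := isMeasure.Build _ _ _ rV_cons_measure
  rV_cons_measure0 rV_cons_measure_ge0 rV_cons_measure_sigma_additive.

Let rV_cons_measure_sigma_finite : sigma_finite setT rV_cons_measure.
Proof.
have /sigma_finiteP[F [TF ndF Foo]] := @sigma_finiteT _ _ _ (@lebesgue_measure R).
have /sigma_finiteP[G [TG ndG Goo]] := sigma_finiteT mu.
pose h (v : 'rV[R]_n.+1) : measurableTypeR R * 'rV[R]_n :=
  (v ord0 ord0, \row_j v ord0 (lift ord0 j)).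
have hK x : h (rV_cons x) = x.
  case: x => t v; rewrite /h rV_cons_ord0; congr (_, _).
  by apply/rowP => j; rewrite mxE rV_cons_lift.
exists (fun k => h @^-1` (F k `*` G k)).
  apply/seteqP; split => // v _.
  have [k _ Fk] : (\bigcup_k F k) (h v).1 by rewrite -TF.
  have [l _ Gl] : (\bigcup_k G k) (h v).2 by rewrite -TG.
  exists (maxn k l) => //; split.
    by move: Fk; exact/subsetPset/ndF/leq_maxl.
  by move: Gl; exact/subsetPset/ndG/leq_maxr.
move=> k; have [mF Fk] := Foo k; have [mG Gk] := Goo k; split.
  rewrite -[X in measurable X]setTI; apply: measurable_rV_uncons => //.
  exact: measurableX.
rewrite /rV_cons_measure /pushforward (_ : rV_cons @^-1` (h @^-1` _) = F k `*` G k).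
  by rewrite product_measure1E// lte_mul_pinfty// ge0_fin_numE.
by rewrite -comp_preimage (_ : h \o rV_cons = id) ?preimage_id//; exact/funext.
Qed.

HB.instance Definition _ := Measure_isSigmaFinite.Build _ _ _ rV_cons_measure
  rV_cons_measure_sigma_finite.

End rV_cons_measure.

Section rV_lebesgue.
Context {R : realType}.
Local Open Scope ereal_scope.

(* n-dimensional Lebesgue measure on Borel sets: the n-fold product of the
   one-dimensional one (see rV_lebesgue_box). *)
Fixpoint rV_lebesgue n : {sigma_finite_measure set 'rV[R]_n -> \bar R} :=
  match n with
  | 0 => [the {sigma_finite_measure set 'rV[R]_0 -> \bar R} of \d_(0%R : 'rV[R]_0)]
  | m.+1 => [the {sigma_finite_measure set 'rV[R]_m.+1 -> \bar R} of
      rV_cons_measure (rV_lebesgue m)]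
  end.

Lemma measurable_rV_box n (a b : 'I_n -> R) :
  measurable [set v : 'rV[R]_n | forall i, a i < v ord0 i <= b i]%R.
Proof.
rewrite (_ : [set _ | _] =
    \bigcap_(i in [set: 'I_n]) (rV_coord i @^-1` `]a i, b i]%classic)).
  apply: fin_bigcap_measurable => // i _.
  by rewrite -[X in measurable X]setTI; exact: measurable_rV_coord.
apply/seteqP; split => v /= vab i; last by have := vab i Logic.I; rewrite /= in_itv.
by move=> _; rewrite /= in_itv; exact: vab.
Qed.

Lemma rV_lebesgue_box n (a b : 'I_n -> R) : (forall i, a i <= b i)%R ->
  rV_lebesgue n [set v : 'rV[R]_n | forall i, a i < v ord0 i <= b i]%R
  = (\prod_(i < n) (b i - a i))%:E.
Proof.
elim: n a b => [|n IHn] a b ab.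
  by rewrite big_ord0 /= diracE mem_set //; case.
transitivity ((@lebesgue_measure R \x rV_lebesgue n) (`]a ord0, b ord0]%classic `*`
  [set v : 'rV[R]_n | forall i, a (lift ord0 i) < v ord0 i <= b (lift ord0 i)]%R)).
  rewrite /= /rV_cons_measure /pushforward; congr product_measure1.
  apply/seteqP; split => [[t v] /= H|[t v] /= [tab H] i].
    split; first by have := H ord0; rewrite rV_cons_ord0 in_itv.
    by move=> i; have := H (lift ord0 i); rewrite rV_cons_lift.
  have [j ->|->] := unliftP ord0 i; first by rewrite rV_cons_lift.
  by rewrite rV_cons_ord0; move: tab; rewrite in_itv.
rewrite product_measure1E//; last exact: measurable_rV_box.
rewrite IHn// big_ord_recl EFinM.
rewrite [X in X * _](@lebesgue_measure_itv R `]a ord0, b ord0]) /= lte_fin.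
have := ab ord0; rewrite le_eqVlt => /predU1P[->|->//].
by rewrite ltxx subrr !mul0e.
Qed.

End rV_lebesgue.

Section sobolev.
Context {R : realType} {N : nat}.
Implicit Types (u phi : 'rV[R]_N -> R) (g : 'rV[R]_N -> 'rV[R]_N) (p : R).

Local Notation mu := (@rV_lebesgue R N).

(* The library norm `|x| on row vectors is the max norm. *)
Definition enorm (x : 'rV[R]_N) : R := Num.sqrt (\sum_i x ord0 i ^+ 2).

Definition partial (i : 'I_N) phi : 'rV[R]_N -> R :=
  fun x => 'D_(delta_mx ord0 i) phi x.

Definition partials (s : seq 'I_N) phi : 'rV[R]_N -> R := foldr partial phi s.

(* C^oo: all iterated partial derivatives exist and are continuous. *)
Definition smooth phi := forall s : seq 'I_N,
  continuous (partials s phi) /\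
  forall i x, derivable (partials s phi) x (delta_mx ord0 i).

Definition test_function phi :=
  smooth phi /\ compact (closure [set x | phi x != 0]).

Definition weak_gradient u g := forall i phi, test_function phi ->
  \int[mu]_x (u x * partial i phi x) = - \int[mu]_x (g x ord0 i * phi x).

Definition Lp p : set ('rV[R]_N -> R) := [set u | u \in Lfun mu p%:E].

Definition Lp_norm p u : \bar R := 'N[mu]_p%:E[EFin \o u].

Definition Lp_gradient p u g :=
  (forall i, Lp p (fun x => g x ord0 i)) /\ weak_gradient u g.

(* As for Lfun, the elements of W^{1,p} are represented by functions, equality
   being understood almost everywhere. *)
Definition W1p p : set ('rV[R]_N -> R) :=
  [set u | Lp p u /\ exists g, Lp_gradient p u g].

(* The choice is irrelevant: the weak gradient is unique a.e. *)
Definition grad p u : 'rV[R]_N -> 'rV[R]_N := xget (fun=> 0) (Lp_gradient p u).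

Definition W1p_norm p u : \bar R :=
  ((\int[mu]_x (enorm (grad p u x) `^ p + `|u x| `^ p)%:E) `^ p^-1)%E.

Definition radial u :=
  exists U : R -> R, {ae mu, forall x, u x = U (enorm x)}.

Definition W1p_rad p : set ('rV[R]_N -> R) := [set u | W1p p u /\ radial u].

End sobolev.

(* nX and nY are the norms of X and Y; compactness is sequential. *)
Definition compact_embedding (R : realType) (V : zmodType)
    (X : set V) (nX : V -> \bar R) (Y : set V) (nY : V -> \bar R) :=
  [/\ X `<=` Y,
      exists C : R, forall u, X u -> (nY u <= C%:E * nX u)%E
    & forall u_ : nat -> V, (forall n, X (u_ n)) ->
      (exists M : R, forall n, (nX (u_ n) <= M%:E)%E) ->
      exists s : nat -> nat, {homo s : m n / (m < n)%N} /\
      exists2 v, Y v & (fun n => nY (u_ (s n) - v)) @ \oo --> 0%E].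

Definition sobolev_exponent (R : realType) (N : nat) (p : R) : R :=
  N%:R * p / (N%:R - p).

(* Main.v *)
Require Import Defs.
From HB Require Import structures.
From mathcomp Require Import all_boot all_order all_algebra.
From mathcomp Require Import all_classical all_reals all_analysis.
From mathcomp Require Import measurable_realfun ring lra.

(** Let u be a radial function in W^{1,p}(R^N), with 1 < p < N, and write the
    points of R^N as x = (t, y), with t real and y in R^(N-1).

    Restricted to almost every line parallel to the first axis, u agrees a.e.
    with a primitive of its weak derivative d_1 u ([ac_slices]). As u depends
    on |x| only, these primitives are compatible with each other: there is one
    continuous profile W on ]0, +oo[ such that u x = W |x| almost everywhere
    ([profileP]). No change to polar coordinates is involved.

    For s <= r <= 2 s, average W r - W s over the lines that meet a small cube
    of side proportional to s around the origin of R^(N-1). The increment is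
    then bounded by the integral of |d_1 u| over the part of the shell
    s <= |x| < r above the cube, hence, by Hoelder's inequality, by a multiple
    of ||d_1 u||_p (r - s)^(1-1/p) s^(-(N-1)/p) ([profile_holder]). Summing over
    dyadic radii bounds W r - W s for all r >= s, and since u is in L^p the
    profile has to tend to 0 at infinity. This gives Strauss's estimate
    |W s| <= C ||d_1 u||_p s^(-alpha), with alpha = (N - p) / p
    ([radial_profile_exists]).

    The two bounds on q enter as follows. As q < p^*, alpha q is less than N
    and |x|^(-alpha q) is integrable near 0 ([powR_ball_integrable]), so that
    the decay estimate controls |u|^q on balls. As q > p, one has
    |u|^q <= (sup |u|)^(q-p) |u|^p outside a ball, where the supremum is small
    if the radius is large ([integral_decays_split]). Together they give the
    continuity of the embedding.

    Given a bounded sequence, its profiles are bounded and equicontinuous on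
    compact subsets of ]0, +oo[, so a subsequence converges pointwise
    ([radial_profiles_subsequence]). It converges in L^q: by dominated
    convergence on balls, and uniformly well outside large balls
    ([radial_Lq_cvg0]). *)

Set Implicit Arguments.
Unset Strict Implicit.
Unset Printing Implicit Defensive.

Import Order.TTheory GRing.Theory Num.Theory.
Import numFieldTopology.Exports numFieldNormedType.Exports.

Local Open Scope classical_set_scope.
Local Open Scope ring_scope.

(** * Smooth functions of one real variable *)

Section flat_functions.
Context {R : realType}.
Implicit Types (P Q : {poly R}) (x : R).

(** The functions P(1/x) e^(-1/x), P a polynomial, extended by 0 to x <= 0: a
    family closed under derivation, which contains the classical flat
    function. *)
Definition flat P x : R := if 0 < x then P.[x^-1] * expR (- x^-1) else 0.

Lemma flat0 P x : x <= 0 -> flat P x = 0.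
Proof. by rewrite /flat leNgt => /negbTE->. Qed.

Lemma flatN P x : flat (- P) x = - flat P x.
Proof. by rewrite /flat hornerN mulNr; case: ifP; rewrite ?oppr0. Qed.

Lemma normr_horner_le P (y : R) : 1 <= y ->
  `|P.[y]| <= (\sum_(i < size P) `|P`_i|) * y ^+ size P.
Proof.
move=> y1; have y0 : 0 <= y by rewrite (le_trans ler01).
rewrite horner_coef mulr_suml (le_trans (ler_norm_sum _ _ _))// ler_sum// => i _.
rewrite normrM ler_wpM2l// normrX ger0_norm// ler_weXn2l//.
by rewrite ltnW.
Qed.

(** As e^(1/x) dominates the term of degree size P + 1 of its series, flat P
    is O(|x|) at 0; this gives continuity at 0 and, for 'X * P, the derivative
    at 0 of flat P. *)
Lemma flat_le P : exists2 C : R, 0 <= C & forall x, x < 1 -> `|flat P x| <= C * `|x|.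
Proof.
set d := size P; set A := \sum_(i < d) `|P`_i|.
have A0 : 0 <= A by rewrite sumr_ge0.
exists (A * (d.+1)`!%:R); first by rewrite mulr_ge0.
move=> x x1; rewrite /flat; case: ifPn => x0; last first.
  by rewrite normr0 !mulr_ge0.
rewrite (gtr0_norm x0) normrM (gtr0_norm (expR_gt0 _)).
set y := x^-1; have y1 : 1 <= y by rewrite invf_ge1// ltW.
have y0 : 0 < y by rewrite invr_gt0.
have H : y ^+ d.+1 / (d.+1)`!%:R <= expR y.
  by apply: le_trans (expR_ge1Dxn d (ltW y0)); rewrite lerDr.
have F0 : (0 : R) < (d.+1)`!%:R by rewrite ltr0n fact_gt0.
rewrite (le_trans (ler_wpM2r (expR_ge0 _) (normr_horner_le P y1)))// -/d -/A.
rewrite -!mulrA ler_wpM2l// expRN ler_pdivrMr ?expR_gt0//.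
move: H; rewrite ler_pdivrMr// exprS => H.
have -> : y ^+ d = x * (y * y ^+ d) by rewrite mulrA /y divff ?mul1r// gt_eqF.
by rewrite [(d.+1)`!%:R * x]mulrC -mulrA [_%:R * _]mulrC ler_wpM2l// ltW.
Qed.

Lemma flat_cvg0 P : {for 0, continuous (flat P)}.
Proof.
have [C C0 H] := flat_le P.
rewrite /prop_for /continuous_at (flat0 _ (lexx _)).
apply/cvgrPdist_le => e e0; apply/nbhs_ballP.
have e1 : 0 < e / (C + 1) by rewrite divr_gt0// ltr_wpDl.
exists (Num.min (e / (C + 1)) 1) => /=; first by rewrite lt_min e1 ltr01.
move=> x; rewrite /ball/= sub0r normrN lt_min => /andP[xe x1].
rewrite sub0r normrN (le_trans (H _ _))//; first by rewrite (le_lt_trans (ler_norm _)).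
rewrite (le_trans (ler_wpM2l C0 (ltW xe)))// mulrCA ler_piMr ?(ltW e0)//.
by rewrite ler_pdivrMr ?mul1r ?lerDl// ltr_wpDl.
Qed.

(** From d/dx (P(1/x) e^(-1/x)) = x^-2 (P - P')(1/x) e^(-1/x). *)
Definition flat_deriv P : {poly R} := 'X ^+ 2 * (P - P^`()).

Lemma is_derive_horner P x : is_derive x 1 (horner P) P^`().[x].
Proof.
apply: DeriveDef; first exact: derivable_horner.
by rewrite -derive1E derivE.
Qed.

Lemma is_derive_flat P x : is_derive x 1 (flat P) (flat (flat_deriv P) x).
Proof.
have [x0|x0|->] := ltrgtP x 0.
- rewrite flat0 ?(ltW x0)//.
  apply: (@near_eq_is_derive _ _ _ (cst 0 : R -> R)).
  near=> y; rewrite flat0//; apply: ltW; near: y; exact: lt_nbhsl.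
- rewrite {2}/flat x0.
  pose g y := P.[y^-1] * expR (- y^-1).
  apply: (@near_eq_is_derive _ _ _ g).
    near=> y; rewrite /flat ifT//; near: y; exact: lt_nbhsr.
  have xn : x != 0 by rewrite gt_eqF.
  have dV : is_derive x 1 (fun y : R => y^-1) (- x ^- 2).
    have := @is_deriveV _ (@id R) x 1 1 xn (is_derive_id _ _).
    by move=> /is_derive_eq; apply; rewrite /GRing.scale/= mulr1.
  have dP := is_derive1_comp (is_derive_horner P x^-1) dV.
  have dE : is_derive x 1 (expR \o (fun y : R => - y^-1)) (expR (- x^-1) * x ^- 2).
    have dN := is_deriveN dV; rewrite opprK in dN.
    exact: (@is_derive1_comp _ _ (fun y : R => - y^-1) x _ _ (is_derive_expR _) dN).
  have := is_deriveM dP dE.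
  move=> /is_derive_eq; apply.
  rewrite /flat_deriv /GRing.scale/= !hornerE/=.
  rewrite -exprVn; ring.
- rewrite flat0//; apply/is_derive1_caratheodory; exists (flat ('X * P)); split.
  + move=> z; rewrite (flat0 P (lexx _)) !subr0 /flat; case: ifP => [z0|_]; last by rewrite mul0r.
    by rewrite hornerM hornerX; field; rewrite gt_eqF.
  + exact: flat_cvg0.
  + exact: flat0.
Unshelve. all: by end_near. Qed.

End flat_functions.

Section smooth1.
Context {R : realType}.
Implicit Types f g : R -> R.

Definition smooth1 f := forall k x, derivable (derive1n k f) x 1.

(** All iterated derivatives stay in S, by induction; smoothness is thus
    obtained without a formula for the k-th derivative. *)
Lemma smooth1_closed (S : set (R -> R)) :
  (forall f, S f -> exists2 f', S f' & forall x, is_derive (x : R) 1 f (f' x)) ->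
  forall f, S f -> smooth1 f.
Proof.
move=> HS f Sf k.
suff : S (derive1n k f) by move/HS => [f' _ H] x; exact: ex_derive.
elim: k => [//|k IH]; rewrite derive1nS.
have [f' Sf' df] := HS _ IH.
rewrite (_ : derive1 _ = f')//; apply/funext => x.
by rewrite derive1E; exact: derive_val.
Qed.

Lemma smooth1_primitive f g : (forall x : R, is_derive x 1 f (g x)) -> smooth1 g -> smooth1 f.
Proof.
move=> fg sg [|k] x; first exact: ex_derive.
have -> : derive1n k.+1 f = derive1n k g.
  elim: k => [|k IH]; last by rewrite derive1nS IH -derive1nS.
  rewrite derive1n1 derive1n0; apply/funext => y.
  by rewrite derive1E; exact: derive_val.
exact: sg.
Qed.

Lemma smooth1_comb f g c d a b : smooth1 f -> smooth1 g ->
  smooth1 (fun x => c * f (a * x + b) + d * g x).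
Proof.
move=> sf sg.
pose S : set (R -> R) := [set h | exists k c' , h = fun x => c' * derive1n k f (a * x + b) + d * derive1n k g x].
apply: (smooth1_closed (S := S)); last by exists 0%N, c.
move=> h [k [c' ->]].
exists (fun x => c' * a * derive1n k.+1 f (a * x + b) + d * derive1n k.+1 g x).
  by exists k.+1, (c' * a).
move=> x.
have df (y : R) : is_derive y 1 (derive1n k f) (derive1n k.+1 f y).
  by rewrite derive1nS derive1E; apply/derivableP; exact: sf.
have dg (y : R) : is_derive y 1 (derive1n k g) (derive1n k.+1 g y).
  by rewrite derive1nS derive1E; apply/derivableP; exact: sg.
have da : is_derive x 1 (fun x => a * x + b) a.
  have := is_deriveD (is_deriveZ a (is_derive_id x 1)) (is_derive_cst b x 1).
  by move=> /is_derive_eq; apply; rewrite /GRing.scale/= addr0 mulr1.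
have d1 := is_deriveZ c' (@is_derive1_comp _ _ (fun y => a * y + b) x _ _ (df (a * x + b)) da).
have d2 := is_deriveZ d (dg x).
have := is_deriveD d1 d2.
move=> /is_derive_eq; apply; rewrite /GRing.scale/=; ring.
Qed.

End smooth1.

Section step.
Context {R : realType}.
Local Notation mu := (@lebesgue_measure R).

Lemma primitive_exists (h : R -> R) : continuous h -> (forall t, t <= 0 -> h t = 0) ->
  exists F : R -> R, (forall t : R, is_derive t 1 F (h t)) /\ forall t, t <= 0 -> F t = 0.
Proof.
move=> ch h0.
pose F t := (\int[mu]_(s in [set` `[(-1)%R, t]]) h s)%R.
have F0 t : t <= 0 -> F t = 0.
  move=> t0; rewrite /F /Rintegral; rewrite (eq_integral (cst 0%E)) ?integral0//.
  move=> s; rewrite inE /= in_itv/= => /andP[_ st].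
  by rewrite h0// (le_trans st).
exists F; split => // t; have [t0|t0] := ltP t 0.
  rewrite h0 ?(ltW t0)//; apply: (@near_eq_is_derive _ _ _ (cst 0 : R -> R)).
  near=> y; rewrite F0//; apply: ltW; near: y; exact: lt_nbhsl.
have tt : t < t + 1 by rewrite ltrDl.
have I : mu.-integrable [set` `[(-1)%R, t + 1]] (EFin \o h).
  apply: continuous_compact_integrable; first exact: segment_compact.
  by apply: continuous_subspaceT => ?; exact: ch.
have [||dF FE] := @continuous_FTC1 R h (BLeft (-1)) t _ tt I.
- by rewrite lte_fin; lra.
- exact: ch.
- by rewrite -FE derive1E; apply/derivableP.
Unshelve. all: by end_near. Qed.

Definition bump (x : R) := flat 1 x * flat 1 (1 - x).

(** Sums of products flat P x * flat Q (1 - x) are stable under derivation. *)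
Lemma bump_smooth : smooth1 bump.
Proof.
pose S : set (R -> R) := [set f | exists l : seq ({poly R} * {poly R}),
  f = fun x => \sum_(pq <- l) flat pq.1 x * flat pq.2 (1 - x)].
apply: (@smooth1_closed _ S); last first.
  by exists [:: (1, 1)]; apply/funext => x; rewrite big_seq1.
move=> f [l ->].
pose l' := [seq (flat_deriv pq.1, pq.2) | pq <- l] ++ [seq (- pq.1, flat_deriv pq.2) | pq <- l].
exists (fun x => \sum_(pq <- l') flat pq.1 x * flat pq.2 (1 - x)); first by exists l'.
move=> x; rewrite /l' big_cat !big_map/= -big_split/=.
have -> : (fun x => \sum_(pq <- l) flat pq.1 x * flat pq.2 (1 - x)) =
   \sum_(pq <- l) (fun x : R => flat pq.1 x * flat pq.2 (1 - x)).
  by apply/funext => y; rewrite fct_sumE.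
elim: l {l'} => [|[P Q] l IH]; first by rewrite !big_nil; exact: is_derive_cst.
rewrite !big_cons; apply: is_deriveD => //=.
have d1 : is_derive x 1 (fun x : R => 1 - x) (-1).
  have := is_deriveB (is_derive_cst (1 : R) x 1) (is_derive_id x 1).
  by rewrite sub0r.
have dQ := @is_derive1_comp _ _ (fun x : R => 1 - x) x _ _ (is_derive_flat Q (1 - x)) d1.
have := is_deriveM (is_derive_flat P x) dQ.
move=> /is_derive_eq; apply; rewrite flatN /GRing.scale/=; ring.
Qed.

Lemma smooth1_continuous (f : R -> R) : smooth1 f -> continuous f.
Proof.
by move=> sf x; apply: differentiable_continuous; apply/derivable1_diffP; exact: (sf 0%N).
Qed.

Lemma MVT_is_derive (F f : R -> R) (a b : R) : (forall x : R, is_derive x 1 F (f x)) -> a < b ->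
  exists2 c, c \in `]a, b[ & F b - F a = f c * (b - a).
Proof.
move=> dF ab; apply: MVT => //.
apply: derivable_within_continuous => x _; exact: ex_derive.
Qed.

(** The normalized primitive of a bump supported in [0, 1]. *)
Lemma smooth_step : exists S : R -> R, [/\ smooth1 S, (forall t, t <= 0 -> S t = 0),
  (forall t, 1 <= t -> S t = 1) & forall t, 0 <= S t <= 1].
Proof.
have [//||F [dF F0]] := @primitive_exists bump.
- exact/smooth1_continuous/bump_smooth.
- by move=> t t0; rewrite /bump flat0// mul0r.
have fl0 (x : R) : 0 <= flat 1 x by rewrite /flat; case: ifP => // _; rewrite hornerC mul1r expR_ge0.
have b0 x : 0 <= bump x by rewrite mulr_ge0.
have Fmono a b : a <= b -> F a <= F b.
  rewrite le_eqVlt => /predU1P[->//|ab].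
  have [c _ E] := MVT_is_derive dF ab.
  by rewrite -subr_ge0 E mulr_ge0// subr_ge0 ltW.
have F1 : 0 < F 1.
  have [c cI] := MVT_is_derive dF (@ltr01 R).
  rewrite (F0 0)// !subr0 mulr1 => ->; move: cI; rewrite in_itv/= => /andP[c0 c1].
  by rewrite /bump /flat c0 subr_gt0 c1 !hornerC !mul1r mulr_gt0 ?expR_gt0.
have Fc t : 1 <= t -> F t = F 1.
  rewrite le_eqVlt => /predU1P[<-//|t1].
  have [c] := MVT_is_derive dF t1.
  rewrite in_itv/= => /andP[c1 _] E; apply/eqP; rewrite -subr_eq0 E /bump.
  by rewrite (flat0 _ (x := 1 - c)) ?mulr0 ?mul0r// subr_le0 ltW.
exists (fun t => (F 1)^-1 * F (1 * t + 0) + 0 * F t); split.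
- by apply: smooth1_comb; apply: smooth1_primitive dF bump_smooth.
- by move=> t t0; rewrite mul1r addr0 (F0 t)// mulr0 mul0r addr0.
- by move=> t t1; rewrite mul1r addr0 Fc// mul0r addr0 mulVf// gt_eqF.
- move=> t; rewrite mul1r addr0 mul0r addr0.
  have Ft0 : 0 <= F t.
    by have [t0|/ltW/Fmono] := leP t 0; [rewrite F0|rewrite F0].
  rewrite mulr_ge0 ?invr_ge0 ?(ltW F1)//= mulrC ler_pdivrMr// mul1r.
  by have [/Fmono//|/ltW/Fc->] := leP t 1.
Qed.

(** T is the primitive of a smooth step S. Since T stays within 1 of t |-> max
    t 0, the rescaled ramp T (k t) / k stays within 1 / k of it, while its
    derivative S (k t) steepens to the jump at 0. *)
Lemma smooth_ramp : exists S T : R -> R, [/\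
  [/\ smooth1 S, smooth1 T & forall t : R, is_derive t 1 T (S t)],
  (forall t, t <= 0 -> S t = 0 /\ T t = 0),
  (forall t, 1 <= t -> S t = 1 /\ T t = T 1 + (t - 1)),
  (forall t, 0 <= S t <= 1) & (forall t, `|T t - Num.max t 0| <= 1)].
Proof.
have [S [sS S0 S1 S01]] := smooth_step.
have [|//|T [dT T0]] := @primitive_exists S; first exact: smooth1_continuous.
have TT a b : a <= b -> 0 <= T b - T a <= b - a.
  rewrite le_eqVlt => /predU1P[->//|ab]; first by rewrite !subrr lexx.
  have [c _ ->] := MVT_is_derive dT ab; have /andP[c0 c1] := S01 c.
  by rewrite mulr_ge0 ?subr_ge0 ?(ltW ab)//= ler_piMl// subr_ge0 ltW.
have T1 t : 1 <= t -> T t = T 1 + (t - 1).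
  rewrite le_eqVlt => /predU1P[<-|t1]; first by rewrite subrr addr0.
  have [c] := MVT_is_derive dT t1; rewrite in_itv/= => /andP[c1 _] E.
  by apply/eqP; rewrite addrC -subr_eq E S1 ?mul1r// ltW.
exists S, T; split => [|t t0|t t1||].
- by split; [exact: sS|exact: (smooth1_primitive dT sS)|exact: dT].
- by rewrite (S0 _ t0) (T0 _ t0).
- by rewrite (S1 _ t1) (T1 _ t1).
- exact: S01.
- have T10 : 0 <= T 1 <= 1.
    by have := TT _ _ (@ler01 R); rewrite (T0 0)// !subr0.
  move=> t; have [t0|t0] := leP t 0; first by rewrite T0// subrr normr0.
  have := TT 0 t (ltW t0); rewrite (T0 0)// !subr0.
  have [t1|/ltW t1] := leP t 1; last first.
    by rewrite T1// => _; rewrite ler_norml; move: T10 => /andP[]; lra.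
  by move=> /andP[? ?]; rewrite ler_norml; apply/andP; split; lra.
Qed.

End step.

(** * Tensor products as test functions *)

Section tensor.
Context {R : realType} {N : nat}.
Implicit Types (f : 'I_N -> R -> R) (x : 'rV[R]_N).

Definition tens f x : R := \prod_i f i (x ord0 i).

Lemma is_deriveP_cvg (V W : normedModType R) (g : V -> W) (a v : V) (d : W) :
  is_derive a v g d <-> h^-1 *: ((g \o shift a) (h *: v) - g a) @[h --> 0^'] --> d.
Proof.
split=> [[dg <-]|H]; first exact: dg.
have dg : derivable g a v by apply/cvg_ex; exists d.
by apply: DeriveDef => //; apply/cvg_lim.
Qed.

(** Moving x along the i-th axis changes only the i-th factor. *)
Lemma is_derive_tens f x i d : is_derive (x ord0 i) 1 (f i) d ->
  is_derive x (delta_mx ord0 i) (tens f) ((\prod_(j | j != i) f j (x ord0 j)) * d).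
Proof.
move=> /is_deriveP_cvg H; apply/is_deriveP_cvg.
set c := \prod_(j | _) _.
have := @cvgMl_tmp R _ _ (dnbhs_filter _) _ c _ H.
apply: cvg_trans; apply: near_eq_cvg; near=> h => /=.
rewrite /GRing.scale/= mulrCA; congr (_ * _); rewrite /tens/= (bigD1 i)//= [X in _ = _ - X](bigD1 i)//=.
rewrite !mxE !eqxx mulr1n /GRing.scale/= mulr1.
rewrite (eq_bigr (fun j => f j (x ord0 j))); last first.
  by move=> j ji; rewrite !mxE eqxx/= (negbTE ji) mulr0n mulr0 add0r.
by rewrite -/c mulrBr ![c * _]mulrC.
Unshelve. all: by end_near. Qed.

Lemma partials_tens f (s : seq 'I_N) : (forall i, smooth1 (f i)) ->
  partials s (tens f) = tens (fun i => derive1n (count_mem i s) (f i)).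
Proof.
move=> sf; elim: s => [//|k s IH] /=.
rewrite /partials /= -/(partials s _) IH; apply/funext => x.
rewrite /partial; set g := fun i => _.
have dk : is_derive (x ord0 k) 1 (g k) (derive1n (count_mem k s).+1 (f k) (x ord0 k)).
  by rewrite derive1nS derive1E; apply/derivableP; exact: sf.
have := is_derive_tens dk => H; rewrite (derive_val (is_derive := H)).
rewrite [RHS](bigD1 k)//= eqxx add1n mulrC; congr (_ * _).
by apply: eq_bigr => j jk; rewrite eq_sym (negbTE jk) add0n.
Qed.

Lemma continuous_tens f : (forall i, continuous (f i)) -> continuous (tens f).
Proof.
move=> cf.
apply: (@continuous_big R _ *%R 1 xpredT (@mul_continuous R) _ (index_enum 'I_N)
  (fun i (x : 'rV[R]_N) => f i (x ord0 i))) => i _ x.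
apply: (@continuous_comp _ _ _ (fun v : 'rV[R]_N => v ord0 i) (f i)).
  exact: coord_continuous.
exact: cf.
Qed.

(** The partial derivatives are again tensor products, of derivatives of the
    factors, and the support lies in a compact box. *)
Lemma tens_test_function f (a b : 'I_N -> R) : (forall i, smooth1 (f i)) ->
  (forall i t, t \notin `[a i, b i] -> f i t = 0) -> test_function (tens f).
Proof.
move=> sf f0; split.
  move=> s; rewrite partials_tens//.
  have sd i k : smooth1 (derive1n k (f i)).
    by move=> l y; rewrite /derive1n -iterD; exact: sf.
  split.
    by apply: continuous_tens => i; apply: smooth1_continuous.
  move=> i x; apply: ex_derive; apply: is_derive_tens.
  by apply/derivableP; exact: (sd i _ 0%N).
set B := [set v : 'rV[R]_N | forall i, `[a i, b i]%classic (v ord0 i)].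
have cB : compact B by exact: (@rV_compact R N (fun i => `[a i, b i]%classic) (fun i => @segment_compact _ _ _)).
apply: (@subclosed_compact _ _ B) => //; first exact: closed_closure.
have clB : closed B by apply: compact_closed => //; exact: norm_hausdorff.
rewrite [X in _ `<=` X](closure_id B).1//; apply: closure_subset => x /=.
apply: contra_neqP => /existsNP[i xi].
rewrite /tens (bigD1 i)//= f0 ?mul0r//; exact/negP.
Qed.
End tensor.

(** * Functions whose integrals over boxes vanish *)

Section dynkin_integral.
Context d (T : measurableType d) (R : realType) (mu : {measure set T -> \bar R}).
Local Open Scope ereal_scope.

(** The measurable sets on which k has integral 0 form a Dynkin system; if it
    contains a generating pi-system, it consists of all measurable sets. *)
Lemma ae_eq0_generator (G : set (set T)) (k : T -> \bar R) :
  @measurable d T = <<s G >> -> setI_closed G -> mu.-integrable setT k ->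
  \int[mu]_x k x = 0 -> (forall A, G A -> \int[mu]_(x in A) k x = 0) ->
  ae_eq mu setT k (cst 0).
Proof.
move=> mG GI ik kT kG.
pose H := [set E : set T | measurable E /\ \int[mu]_(x in E) k x = 0].
suff HE E : measurable E -> \int[mu]_(x in E) k x = 0.
  apply: integral_ae_eq => //.
  by move=> E _ mE; rewrite HE// integral0.
rewrite mG -setI_closed_g_dynkin_g_sigma_algebra// => dE.
suff : <<d G >> `<=` H by move=> /(_ _ dE)[].
apply: smallest_sub; last first.
  by move=> A GA; split; [rewrite mG; exact: sub_gen_smallest|exact: kG].
have ikE F : measurable F -> mu.-integrable F k by move=> mF; apply: integrableS ik.
split.
- by split.
- move=> A [mA A0]; split; first exact: measurableC.
  have := kT; rewrite -(setUv A) integral_setU//; last 3 first.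
  + exact: measurableC.
  + by rewrite setUv; case/integrableP : ik.
  + by apply/disj_setPS; rewrite setICr.
  by rewrite A0 add0e.
- move=> F tF HF; have mF i := (HF i).1; split; first exact: bigcup_measurable.
  rewrite integral_bigcup//; last by apply: ikE; exact: bigcup_measurable.
  by rewrite eseries0// => i _ _; exact: (HF i).2.
Qed.

End dynkin_integral.

Section boxes.
Context {R : realType} {n : nat}.

Definition box (a b : 'I_n -> R) : set 'rV[R]_n :=
  [set v | forall i, a i < v ord0 i <= b i].

Lemma boxI a b a' b' : box a b `&` box a' b' =
  box (fun i => Num.max (a i) (a' i)) (fun i => Num.min (b i) (b' i)).
Proof.
apply/seteqP; split => [v [H H'] i|v H].
  have /andP[? ?] := H i; have /andP[? ?] := H' i.
  by rewrite gt_max le_min; apply/andP; split; apply/andP.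
split=> i; have := H i; rewrite gt_max le_min => /andP[/andP[? ?] /andP[? ?]];
  exact/andP.
Qed.

(** A slab l < x_i <= r is the increasing union of the boxes with side ]l, r]
    along i and sides ]-k, k] along the other axes. *)
Lemma measurable_box_gen : @measurable _ 'rV[R]_n =
  <<s [set B | exists a b, B = box a b] >>.
Proof.
apply/seteqP; split; last first.
  apply: smallest_sub; first exact: sigma_algebra_measurable.
  by move=> _ [a [b ->]]; exact: measurable_rV_box.
set G := [set B | _].
apply: smallest_sub; first exact: smallest_sigma_algebra.
rewrite -bigcup_seq => B [i _] [Y mY <-].
rewrite setTI.
have : measurable_fun (setT : set (g_sigma_algebraType G))
   (rV_coord i : g_sigma_algebraType G -> measurableTypeR R).
  apply: (@measurability _ _ _ _ _ _ (@ocitv R)) => //.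
  move=> _ [_ [[l r] _ <-] <-]; rewrite setTI.
  rewrite (_ : _ @^-1` _ = \bigcup_k box (fun j => if j == i then l else - k%:R)
      (fun j => if j == i then r else k%:R)).
    apply: bigcup_measurable => k _; apply: sub_sigma_algebra.
    by eexists; eexists.
  apply/seteqP; split => [v /=|v [k _ /(_ i)]]; last by rewrite eqxx /= in_itv.
  rewrite in_itv/= => vi.
  pose M := \sum_j `|v ord0 j|.
  exists (Num.truncn M).+1 => // j; case: eqP => [->//|_].
  have vM : `|v ord0 j| <= M by rewrite /M (bigD1 j)//= lerDl sumr_ge0.
  have := truncnS_gt M => M1; move: (le_lt_trans vM M1); rewrite ltr_norml => /andP[-> /ltW].
  by [].
by move=> /(_ measurableT Y mY); rewrite setTI.
Qed.

End boxes.

Section box_lemma.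
Context {R : realType} {n : nat}.
Local Notation mu := (@rV_lebesgue R n).

(** An instance of [ae_eq0_generator] for k cut off outside box c d: the
    intersection of a box with box c d is empty or a box inside box c d. *)
Lemma ae_eq0_boxes (c d : 'I_n -> R) (k : 'rV[R]_n -> R) :
  mu.-integrable (box c d) (EFin \o k) ->
  (forall a b, (forall i, c i <= a i) -> (forall i, a i <= b i) ->
     (forall i, b i <= d i) -> \int[mu]_(x in box a b) k x = 0) ->
  {ae mu, forall x, box c d x -> k x = 0}.
Proof.
move=> ik k0.
have mB : measurable (box c d) by exact: measurable_rV_box.
have k0' a b : (\int[mu]_(x in box a b `&` box c d) (k x)%:E = 0)%E.
  rewrite boxI; set a1 := fun i => _; set b1 := fun i => _.
  have [ab|] := pselect (forall i, a1 i <= b1 i).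
    rewrite -[LHS]fineK.
      have := k0 a1 b1 _ ab _; rewrite /Rintegral => -> // i.
        by rewrite le_max lexx orbT.
      by rewrite ge_min lexx orbT.
    apply: integrable_fin_num; first exact: measurable_rV_box.
    apply: integrableS ik => //; first exact: measurable_rV_box.
    by rewrite -boxI; exact: subIsetr.
  move=> /existsNP[i /negP]; rewrite -ltNge => bai.
  rewrite (_ : box _ _ = set0) ?integral_set0//.
  apply/seteqP; split => // v /(_ i)/andP[av vb].
  by have := lt_le_trans av (le_trans vb (ltW bai)); rewrite ltxx.
have := @ae_eq0_generator _ _ _ mu _ ((EFin \o k) \_ (box c d)) measurable_box_gen.
have H1 : setI_closed [set B | exists a b : 'I_n -> R, B = box a b].
  move=> _ _ [a [b ->]] [a' [b' ->]]; rewrite boxI; by eexists; eexists.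
move=> /(_ H1){H1}.
have H2 : mu.-integrable setT ((EFin \o k) \_ (box c d)) by apply/(integrable_mkcond _ mB).
move=> /(_ H2){H2}.
have H3 : (\int[mu]_x ((EFin \o k) \_ (box c d)) x = 0)%E.
  by rewrite -integral_mkcond -[X in integral _ X]setIid; exact: k0'.
move=> /(_ H3){H3}.
case.
- move=> _ [a [b ->]]; rewrite -integral_mkcondr; exact: k0'.
- move=> Z [mZ Z0 HZ]; exists Z; split => // x /= /not_implyP[Bx kx]; apply: HZ => /= H.
  by apply: kx; have := H I; rewrite patchE mem_set// => -[].
Qed.

End box_lemma.

(** * Smooth approximation of pulses and tents *)

Section smooth_pulses.
Context {R : realType}.

Definition pulse (a b t : R) : R := ((a < t) && (t <= b))%:R.

(** For c <= a <= b <= d, a primitive of pulse a b - (b - a) / (d - c) * pulse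
    c d; it vanishes outside [c, d] because that function has integral 0. *)
Definition tent (a b c d t : R) : R :=
  Num.max (t - a) 0 - Num.max (t - b) 0
  - (b - a) / (d - c) * (Num.max (t - c) 0 - Num.max (t - d) 0).

Lemma cvg_nearE (u : nat -> R) (l : R) n0 : (forall k, (n0 <= k)%N -> u k = l) -> u @ \oo --> l.
Proof. by move=> H; apply: cvg_near_cst; exists n0. Qed.

Lemma smooth_pulse_cvg (S : R -> R) (a b t : R) :
  (forall t, t <= 0 -> S t = 0) -> (forall t, 1 <= t -> S t = 1) -> a <= b ->
  S (k.+1%:R * (t - a)) - S (k.+1%:R * (t - b)) @[k --> \oo] --> pulse a b t.
Proof.
move=> S0 S1 ab; rewrite /pulse.
have big (s : R) : 0 < s -> forall k, (Num.truncn s^-1 <= k)%N -> 1 <= k.+1%:R * s.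
  move=> s0 k ks; rewrite -ler_pdivrMr// mul1r.
  by rewrite (le_trans (ltW (truncnS_gt _)))// ler_nat ltnS.
have neg s k : s <= 0 -> k.+1%:R * s <= 0 by move=> s0; rewrite mulr_ge0_le0.
have [ta|at_] := leP t a.
  apply: (cvg_nearE (n0 := 0)) => k _.
  by rewrite !S0 ?subrr// neg// subr_le0// (le_trans ta).
have [tb|bt] /= := leP t b.
  apply: (cvg_nearE (n0 := Num.truncn (t - a)^-1)) => k kt.
  by rewrite S1 ?big ?subr_gt0// S0 ?subr0// neg// subr_le0.
apply: (cvg_nearE (n0 := maxn (Num.truncn (t - a)^-1) (Num.truncn (t - b)^-1))) => k.
by rewrite geq_max => /andP[ka kb]; rewrite !S1 ?subrr// big// subr_gt0.
Qed.

(** P k is the difference of two smooth steps steepened by the factor k + 1. *)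
Lemma smooth_pulse (a b : R) : a <= b -> exists P : nat -> R -> R,
  [/\ forall k, smooth1 (P k), forall k t, t \notin `[a, b + 1] -> P k t = 0,
    forall k t, `|P k t| <= 1 & forall t, P ^~ t @ \oo --> pulse a b t].
Proof.
move=> ab; have [S [T [[sS sT dT] H0 H1 S01 _]]] := @smooth_ramp R.
exists (fun k t => S (k.+1%:R * (t - a)) - S (k.+1%:R * (t - b))); split.
- move=> k.
  have := @smooth1_comb R S _ 1 (-1) k.+1%:R (- (k.+1%:R * a)) sS
    (@smooth1_comb R S S 1 0 k.+1%:R (- (k.+1%:R * b)) sS sS).
  congr smooth1; apply/funext => t; rewrite !mul1r mul0r addr0 mulN1r.
  by rewrite !mulrBr.
- move=> k t; rewrite in_itv/= negb_and -!ltNge => /orP[ta|bt].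
    have neg s : s <= 0 -> k.+1%:R * s <= 0 by move=> s0; rewrite mulr_ge0_le0.
    by rewrite (H0 _ _).1 ?(H0 _ _).1 ?subrr// neg// subr_le0 ltW// (lt_le_trans ta).
  have big s : 1 <= s -> 1 <= k.+1%:R * s.
    by move=> s1; rewrite (le_trans s1)// ler_peMl ?ler1n// (le_trans ler01).
  by rewrite (H1 _ _).1 ?(H1 _ _).1 ?subrr// big//; lra.
- move=> k t; have /andP[? ?] := S01 (k.+1%:R * (t - a)).
  have /andP[? ?] := S01 (k.+1%:R * (t - b)); rewrite ler_norml; lra.
- move=> t; apply: smooth_pulse_cvg => // s ?; [exact: (H0 _ _).1|exact: (H1 _ _).1].
Qed.

(** The tent is a combination of four ramps max (t - z) 0; F k replaces each
    of them by the smooth ramp T (k.+1 (t - z)) / k.+1, whose derivative is a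
    smooth step. *)
Lemma smooth_tent (a b c d : R) : c <= a -> a <= b -> b <= d -> c < d ->
  exists (C : R) (F dF : nat -> R -> R), 0 <= C /\
  [/\ (forall k, smooth1 (F k)) /\ (forall k (t : R), is_derive t 1 (F k) (dF k t)),
    forall k t, t \notin `[c, d + 1] -> F k t = 0 /\ dF k t = 0,
    forall k t, `|F k t| <= C /\ `|dF k t| <= C,
    forall t, F ^~ t @ \oo --> tent a b c d t
   & forall t, dF ^~ t @ \oo --> pulse a b t - (b - a) / (d - c) * pulse c d t].
Proof.
move=> ca ab bd cd; have [S [T [[sS sT dT] H0 H1 S01 TM]]] := @smooth_ramp R.
set K := (b - a) / (d - c).
have dc0 : 0 < d - c by rewrite subr_gt0.
have K0 : 0 <= K by rewrite divr_ge0 ?subr_ge0// ltW.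
have K1 : K <= 1 by rewrite ler_pdivrMr// mul1r; lra.
have KE : K * (d - c) = b - a by rewrite /K divfK// gt_eqF.
pose G x y k (t : R) := k.+1%:R^-1 * (T (k.+1%:R * (t - x)) - T (k.+1%:R * (t - y))).
pose g x y k (t : R) := S (k.+1%:R * (t - x)) - S (k.+1%:R * (t - y)).
have m0 k : 0 < k.+1%:R :> R by rewrite ltr0n.
have sG x y k : smooth1 (G x y k).
  have := @smooth1_comb R T _ k.+1%:R^-1 1 k.+1%:R (- (k.+1%:R * x)) sT
    (@smooth1_comb R T T (- k.+1%:R^-1) 0 k.+1%:R (- (k.+1%:R * y)) sT sT).
  congr smooth1; apply/funext => t; rewrite mul1r mul0r addr0 /G !mulrBr; ring.
have dG x y k (t : R) : is_derive t 1 (G x y k) (g x y k t).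
  have da z : is_derive t 1 (fun t => k.+1%:R * (t - z)) k.+1%:R.
    have := is_deriveZ k.+1%:R (is_deriveB (is_derive_id t 1) (is_derive_cst z t 1)).
    by move=> /is_derive_eq; apply; rewrite /GRing.scale/= subr0 mulr1.
  have dx := @is_derive1_comp _ _ (fun t => k.+1%:R * (t - x)) t _ _ (dT _) (da x).
  have dy := @is_derive1_comp _ _ (fun t => k.+1%:R * (t - y)) t _ _ (dT _) (da y).
  have := is_deriveZ k.+1%:R^-1 (is_deriveB dx dy).
  by move=> /is_derive_eq; apply; rewrite /GRing.scale/= -mulrBl mulrC mulfK// gt_eqF.
have GM x y k t : `|G x y k t - (Num.max (t - x) 0 - Num.max (t - y) 0)| <= 2 * k.+1%:R^-1.
  have mx z : Num.max (t - z) 0 = k.+1%:R^-1 * Num.max (k.+1%:R * (t - z)) 0.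
    by rewrite maxr_pMr ?invr_ge0 ?ltW// mulr0 mulKf// gt_eqF.
  rewrite !mx /G -!mulrBr normrM gtr0_norm ?invr_gt0// mulrC ler_wpM2r ?invr_ge0 ?(ltW (m0 k))//.
  have := TM (k.+1%:R * (t - x)); have := TM (k.+1%:R * (t - y)).
  by rewrite !ler_norml => /andP[? ?] /andP[? ?]; apply/andP; split; lra.
have m1 k : k.+1%:R^-1 <= 1 :> R by rewrite invf_le1// ler1n.
have GC x y k t : x <= y -> `|G x y k t| <= y - x + 2.
  move=> xy; have := GM x y k t; have := m1 k.
  rewrite !ler_norml => Hm /andP[Hl Hr].
  have [? ?] : 0 <= Num.max (t - x) 0 - Num.max (t - y) 0 /\
     Num.max (t - x) 0 - Num.max (t - y) 0 <= y - x.
    by rewrite /Num.max; case: ifPn; case: ifPn; rewrite -?leNgt => *; split; lra.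
  by move: (k.+1%:R^-1) Hm Hl Hr => z *; apply/andP; split; lra.
have gC x y k t : `|g x y k t| <= 1.
  have /andP[? ?] := S01 (k.+1%:R * (t - x)).
  have /andP[? ?] := S01 (k.+1%:R * (t - y)); rewrite ler_norml /g; lra.
have Gl x y k t : t <= x -> x <= y -> G x y k t = 0.
  move=> tx xy; have neg s : s <= 0 -> k.+1%:R * s <= 0 by move=> s0; rewrite mulr_ge0_le0.
  by rewrite /G (H0 _ _).2 ?(H0 _ _).2 ?subrr ?mulr0// neg//; lra.
have Gr x y k t : y + 1 <= t -> x <= y -> G x y k t = y - x.
  move=> tx xy.
  have big s : 1 <= s -> 1 <= k.+1%:R * s.
    by move=> s1; rewrite (le_trans s1)// ler_peMl ?ler1n// (le_trans ler01).
  rewrite /G (H1 _ _).2; last by rewrite big//; lra.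
  rewrite (H1 (_ * (t - y)) _).2; last by rewrite big//; lra.
  rewrite [X in _ * X](_ : _ = k.+1%:R * (y - x)); last by ring.
  by rewrite mulKf// gt_eqF.
have gl x y k t : t <= x -> x <= y -> g x y k t = 0.
  move=> tx xy; have neg (s : R) : s <= 0 -> k.+1%:R * s <= 0.
    by move=> s0; rewrite mulr_ge0_le0.
  by rewrite /g (H0 _ _).1 ?(H0 _ _).1 ?subrr// neg//; lra.
have gr x y k t : y + 1 <= t -> x <= y -> g x y k t = 0.
  move=> tx xy.
  have big (s : R) : 1 <= s -> 1 <= k.+1%:R * s.
    by move=> s1; rewrite (le_trans s1)// ler_peMl ?ler1n// (le_trans ler01).
  by rewrite /g (H1 _ _).1 ?(H1 _ _).1 ?subrr// big//; lra.
exists ((b - a + 2) + (d - c + 2)), (fun k t => G a b k t - K * G c d k t), (fun k t => g a b k t - K * g c d k t).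
split; first by lra.
split.
- split.
    move=> k; have := @smooth1_comb R _ _ 1 (- K) 1 0 (sG a b k) (sG c d k).
    by congr smooth1; apply/funext => t; rewrite !mul1r addr0 mulNr.
  by move=> k t; have := is_deriveB (dG a b k t) (is_deriveZ K (dG c d k t)).
- move=> k t; rewrite in_itv/= negb_and -!ltNge => /orP[tc|dt].
    by rewrite !Gl ?gl ?mulr0 ?subr0//; lra.
  by rewrite !Gr ?gr ?KE ?mulr0 ?subrr//; lra.
- move=> k t; split; rewrite (le_trans (ler_normB _ _))// lerD//.
  + exact: GC.
  + by rewrite normrM ger0_norm// (le_trans (ler_piMl _ K1))// GC// ltW.
  + by rewrite (le_trans (gC _ _ _ _))//; lra.
  + by rewrite normrM ger0_norm// (le_trans (ler_piMl _ K1))// (le_trans (gC _ _ _ _))//; lra.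
- have Gcvg x y t : G x y ^~ t @ \oo --> Num.max (t - x) 0 - Num.max (t - y) 0.
    apply/cvgrPdistC_le => e e0.
    have : 2 * n.+1%:R^-1 @[n --> \oo] --> (2 * 0 : R) by apply: cvgMl_tmp; exact: cvg_harmonic.
    rewrite mulr0 => /cvgrPdistC_le /(_ e e0); apply: filterS => n.
    by rewrite subr0 ger0_norm ?mulr_ge0 ?invr_ge0 ?ler0n//; exact: le_trans.
  by move=> t; apply: cvgB => //; exact: cvgMl_tmp.
- have gcvg x y t : x <= y -> g x y ^~ t @ \oo --> pulse x y t.
    by move=> xy; apply: smooth_pulse_cvg => // s ?; [exact: (H0 _ _).1|exact: (H1 _ _).1].
  move=> t; apply: cvgB; first exact: gcvg.
  by apply: cvgMl_tmp; apply: gcvg; exact: ltW.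
Qed.

End smooth_pulses.

(** * The weak derivative tested against boxes *)

Section tools.
Context d (T : measurableType d) (R : realType) (mu : {measure set T -> \bar R}).
Local Open Scope ereal_scope.

Lemma Rintegral_dct (h_ : nat -> T -> R) (h G : T -> R) :
  (forall k, measurable_fun setT (h_ k)) ->
  (forall x, h_ ^~ x @ \oo --> h x) ->
  mu.-integrable setT (EFin \o G) ->
  (forall k x, (`|h_ k x| <= G x)%R) ->
  mu.-integrable setT (EFin \o h) /\
  (\int[mu]_x h_ k x)%R @[k --> \oo] --> (\int[mu]_x h x)%R.
Proof.
move=> mh hh iG hG.
have mh' : measurable_fun setT h by apply: (measurable_fun_cvg mh) => x _; exact: hh.
have [||||ih _ H] := @dominated_convergence _ _ _ mu setT measurableT
  (fun k => EFin \o h_ k) (EFin \o h) (EFin \o G) _ _ _ iG.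
- by move=> k; exact/measurable_EFinP.
- exact/measurable_EFinP.
- by apply: aeW => x _; apply/cvg_EFin; [exact: nearW|exact: hh].
- by apply: aeW => x k _ /=; rewrite lee_fin.
- split => //; rewrite /Rintegral; apply: fine_cvg.
  by rewrite fineK//; exact: integrable_fin_num.
Qed.

Lemma Lp_integrable_on (p : R) (u : T -> R) (A : set T) : (1 <= p)%R ->
  u \in Lfun mu p%:E -> measurable A -> mu A < +oo -> mu.-integrable A (EFin \o u).
Proof.
move=> p1 up mA Aoo.
have mu_ : measurable_fun setT u by move/sub_Lfun_mfun : up; rewrite inE.
apply: (@le_integrable _ _ _ _ _ mA _ (fun x => (1 + `|u x| `^ p)%:E)).
- by apply/measurable_EFinP; exact: measurable_funTS.
- move=> x _; rewrite /= lee_fin [leRHS]ger0_norm ?addr_ge0 ?powR_ge0//.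
  have [u1|/ltW u1] := leP `|u x|%R 1%R; first by rewrite (le_trans u1)// lerDl powR_ge0.
  by rewrite (@le_trans _ _ (`|u x| `^ p)%R)// ?lerDr// -[leLHS]powRr1// ler_powR.
- rewrite (_ : (fun _ => _) = cst 1 \+ (fun x => (`|u x| `^ p)%:E))//.
  apply: integrableD => //.
    apply/integrableP; split => //.
    by rewrite (eq_integral (cst 1)) ?integral_cst ?mul1e// => x _; rewrite /= normr1.
  by apply: integrableS (Lfun_integrable p1 up).
Qed.

Lemma Lp_mul_integrable (p C : R) (v chi : T -> R) (A : set T) : (1 <= p)%R ->
  v \in Lfun mu p%:E -> measurable A -> mu A < +oo -> measurable_fun setT chi ->
  (forall x, `|chi x| <= C * \1_A x)%R ->
  mu.-integrable setT (EFin \o (fun x => v x * chi x)%R).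
Proof.
move=> p1 vp mA Aoo mchi chiC.
have mv : measurable_fun setT v by move/sub_Lfun_mfun : (vp); rewrite inE.
have := Lp_integrable_on p1 vp mA Aoo.
move=> /(integrable_mkcond _ mA).1 H.
apply: (le_integrable measurableT _ _ (integrableZl measurableT C H)).
  by apply/measurable_EFinP; exact: measurable_funM.
move=> x _ /=; have := chiC x; rewrite patchE indicE; case: ifPn => xA /=.
  rewrite mulr1 lee_fin !normrM => h; rewrite mulrC ler_wpM2r//.
  by rewrite (le_trans h)// ler_norm.
by rewrite mulr0 normr_le0 => /eqP ->; rewrite !mulr0 normr0.
Qed.
End tools.

Section slicing.
Context {R : realType} {n : nat}.
Local Notation la := (@lebesgue_measure R).
Local Notation nu := (@rV_lebesgue R n).
Local Notation mu := (@rV_lebesgue R n.+1).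
Local Open Scope ereal_scope.

Lemma ge0_integral_rV_cons (f : 'rV[R]_n.+1 -> \bar R) : measurable_fun setT f ->
  (forall x, 0 <= f x) -> \int[mu]_x f x = \int[la \x nu]_z f (rV_cons z).
Proof.
move=> mf f0; rewrite /= /rV_cons_measure.
by rewrite (ge0_integral_pushforward measurable_rV_cons)//.
Qed.

Lemma integrable_rV_cons (f : 'rV[R]_n.+1 -> \bar R) : measurable_fun setT f ->
  mu.-integrable setT f <-> (la \x nu).-integrable setT (f \o rV_cons).
Proof.
move=> mf; split => /integrableP[_ H]; apply/integrableP; split => //.
- by apply: measurableT_comp => //; exact: measurable_rV_cons.
- by move: H; rewrite ge0_integral_rV_cons//; exact: measurableT_comp.
- by rewrite ge0_integral_rV_cons//; exact: measurableT_comp.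
Qed.

Lemma integral_rV_cons (f : 'rV[R]_n.+1 -> \bar R) : mu.-integrable setT f ->
  \int[mu]_x f x = \int[la \x nu]_z f (rV_cons z).
Proof.
move=> intf; have mf := measurable_int _ intf.
rewrite /= /rV_cons_measure (integral_pushforward measurable_rV_cons)//.
by apply/integrable_rV_cons.
Qed.

(** By Tonelli, almost every slice of a null set is null. *)
Lemma ae_rV_cons (P : 'rV[R]_n.+1 -> Prop) : {ae mu, forall x, P x} ->
  {ae nu, forall y, {ae la, forall t, P (rV_cons (t, y))}}.
Proof.
move=> [Z [mZ Z0 PZ]].
have mcZ : measurable (rV_cons @^-1` Z).
  by rewrite -[X in measurable X]setTI; exact: measurable_rV_cons.
pose f : measurableTypeR R * 'rV[R]_n -> \bar R := EFin \o \1_(rV_cons @^-1` Z).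
have mf : measurable_fun setT f by exact/measurable_EFinP/measurable_indic.
have f0 x : 0 <= f x by rewrite /f /= lee_fin.
have : \int[la \x nu]_z f z = 0 by rewrite /f integral_indic// setIT.
rewrite fubini_tonelli2// => If.
have mG := measurable_fun_fubini_tonelli_G (m1 := la) f mf f0.
have G0 y : 0 <= fubini_G la f y by apply: integral_ge0.
have : \int[nu]_y `|fubini_G la f y| = 0.
  by rewrite -[RHS]If; apply: eq_integral => y _; rewrite gee0_abs.
move=> /(ae_eq_integral_abs nu measurableT mG).
apply: filterS => y /(_ I) /= Gy.
exists (ysection (rV_cons @^-1` Z) y); split.
- exact: measurable_ysection.
- rewrite -[RHS]Gy /fubini_G /f /= -[RHS]/(\int[la]_x (\1_(rV_cons @^-1` Z) (x, y))%:E).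
  transitivity (\int[la]_x (\1_(ysection (rV_cons @^-1` Z) y) x)%:E).
    by rewrite integral_indic ?setIT//; exact: measurable_ysection.
  by apply: eq_integral => x _; rewrite !indicE mem_ysection.
- by move=> t /= Pt; rewrite /ysection/= inE; exact: PZ.
Qed.

End slicing.

Section weak_box.
Context {R : realType} {n : nat}.
Local Notation mu := (@rV_lebesgue R n.+1).

(** The indicator function of the cylinder above box a' b'. *)
Definition tail_pulse (a' b' : 'I_n -> R) (x : 'rV[R]_n.+1) : R :=
  \prod_j pulse (a' j) (b' j) (x ord0 (lift ord0 j)).

(** The factors of a tensor product on R^(n+1), the first one set apart. *)
Definition consf (f : R -> R) (h : 'I_n -> R -> R) (i : 'I_n.+1) : R -> R :=
  if unlift ord0 i is Some j then h j else f.

Lemma consf0 f h : consf f h ord0 = f.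
Proof. by rewrite /consf unlift_none. Qed.

Lemma consfS f h j : consf f h (lift ord0 j) = h j.
Proof. by rewrite /consf liftK. Qed.

Lemma tens_consf f h x : tens (consf f h) x =
  f (x ord0 ord0) * \prod_j h j (x ord0 (lift ord0 j)).
Proof.
rewrite /tens big_ord_recl consf0; congr (_ * _).
by apply: eq_bigr => j _; rewrite consfS.
Qed.

Lemma measurable_tens m (f : 'I_m -> R -> R) : (forall i, measurable_fun setT (f i)) ->
  measurable_fun setT (tens f).
Proof.
move=> mf; apply: measurable_prod => i _.
apply: (measurableT_comp (mf i)); exact: measurable_rV_coord.
Qed.

(** The weak identity for smooth approximations of a tent along the first axis
    times the indicator of a box along the others passes to the limit by
    dominated convergence: the approximations and their derivatives are
    uniformly bounded and live in one bounded box, on which u and g are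
    integrable. A tent is used along the first axis because its derivative
    stays bounded. *)
Lemma weak_box (p : R) (u : 'rV[R]_n.+1 -> R) g (a b c d : R) (a' b' : 'I_n -> R) :
  1 <= p -> Lp p u -> Lp_gradient p u g ->
  c <= a -> a <= b -> b <= d -> c < d -> (forall j, a' j <= b' j) ->
  \int[mu]_x (u x * ((pulse a b (x ord0 ord0) - (b - a) / (d - c) * pulse c d (x ord0 ord0))
      * tail_pulse a' b' x)) =
  - \int[mu]_x (g x ord0 ord0 * (tent a b c d (x ord0 ord0) * tail_pulse a' b' x)).
Proof.
move=> p1 up [gp wg] ca ab bd cd ab'.
have [C [F [dF [C0 [[sF deF] F0 FC Fcvg dFcvg]]]]] := smooth_tent ca ab bd cd.
have /choice[P HP] : forall j : 'I_n, exists P : nat -> R -> R,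
  [/\ forall k, smooth1 (P k), forall k t, t \notin `[a' j, b' j + 1] -> P k t = 0,
    forall k t, `|P k t| <= 1 & forall t, P ^~ t @ \oo --> pulse (a' j) (b' j) t].
  by move=> j; exact: smooth_pulse.
pose phi k := tens (consf (F k) (fun j => P j k)).
pose dphi k := tens (consf (dF k) (fun j => P j k)).
have smphi k i : smooth1 (consf (F k) (fun j => P j k) i).
  by rewrite /consf; case: unlift => [j|]; [have [] := HP j|exact: sF].
pose lo i : R := if unlift ord0 i is Some j then a' j else c.
pose hi i : R := if unlift ord0 i is Some j then b' j + 1 else d + 1.
have phi0 k i t : t \notin `[lo i, hi i] -> consf (F k) (fun j => P j k) i t = 0.
  rewrite /lo /hi /consf; case: unlift => [j|]; last by move=> tt; exact: (F0 k t tt).1.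
  by have [_ + _ _] := HP j; exact.
have tphi k : test_function (phi k) by exact: (@tens_test_function R n.+1 _ lo hi (smphi k) (phi0 k)).
have pphi k : partial ord0 (phi k) = dphi k.
  apply/funext => x; rewrite /partial /phi.
  have dk : is_derive (x ord0 ord0) 1 (consf (F k) (fun j => P j k) ord0) (dF k (x ord0 ord0)).
    by rewrite consf0; exact: deF.
  have H := is_derive_tens dk; rewrite (derive_val (is_derive := H)).
  rewrite /dphi tens_consf mulrC; congr (_ * _).
  by rewrite big_mkcond big_ord_recl/= mul1r; apply: eq_bigr => j _; rewrite consfS.
(* B is half-open, so lo i - 1 makes room for the endpoint lo i *)
pose B := box (fun i => lo i - 1) hi.
have mB : measurable B by exact: measurable_rV_box.
have lohi i : lo i <= hi i.
  by rewrite /lo /hi; case: unlift => [j|]; [have := ab' j; lra|lra].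
have Boo : (mu B < +oo)%E.
  rewrite /B rV_lebesgue_box ?ltry// => i; have := lohi i; lra.
have outB k x : ~ B x -> phi k x = 0 /\ dphi k x = 0.
  move=> /existsNP[i Bi].
  have xi : x ord0 i \notin `[lo i, hi i].
    apply/negP; rewrite in_itv/= => /andP[l h]; apply: Bi; rewrite h andbT; lra.
  split; first by rewrite /phi /tens (bigD1 i)//= phi0// mul0r.
  rewrite /dphi /tens (bigD1 i)//=.
  have [j ij|i0] := unliftP ord0 i.
    by move: xi (phi0 k i (x ord0 i)); rewrite ij !consfS => xi /(_ xi) ->; rewrite mul0r.
  by move: xi; rewrite i0 consf0 /lo /hi unlift_none => xi; rewrite (F0 _ _ xi).2 mul0r.
have prodP1 k (x : 'rV[R]_n.+1) : `|\prod_j P j k (x ord0 (lift ord0 j))| <= 1.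
  by rewrite normr_prod prodr_ile1// => j _; rewrite normr_ge0/=; have [_ _ + _] := HP j; exact.
have bnd k x : `|phi k x| <= C * \1_B x /\ `|dphi k x| <= C * \1_B x.
  have [Bx|Bx] := pselect (B x); last first.
    by have [-> ->] := outB k x Bx; rewrite normr0 mulr_ge0.
  rewrite indicE mem_set// mulr1 /phi /dphi !tens_consf !normrM.
  have [H1 H2] := FC k (x ord0 ord0).
  by split; rewrite -[C]mulr1 ler_pM.
have key (v : 'rV[R]_n.+1 -> R) (h_ : nat -> 'rV[R]_n.+1 -> R) h : Lp p v ->
    (forall k, measurable_fun setT (h_ k)) -> (forall k x, `|h_ k x| <= C * \1_B x) ->
    (forall x, h_ ^~ x @ \oo --> h x) ->
    \int[mu]_x (v x * h_ k x) @[k --> \oo] --> \int[mu]_x (v x * h x).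
  move=> vp mh hC hh.
  have mv : measurable_fun setT v by move/sub_Lfun_mfun : (vp); rewrite inE.
  have D := @Rintegral_dct _ _ R mu (fun k x => v x * h_ k x) (fun x => v x * h x)
    (fun x => `|v x| * (C * \1_B x)).
  apply: (D _ _ _ _).2 => {D}.
  - by move=> k; exact: measurable_funM.
  - by move=> x; apply: cvgMl_tmp; exact: hh.
  - have mB1 : measurable_fun setT (fun x => C * \1_B x).
      by apply: measurable_funM => //; exact: measurable_indic.
    have i1 := Lp_mul_integrable p1 vp mB Boo mB1 (C := C).
    have /i1/integrable_abse : forall x, `|C * \1_B x| <= C * \1_B x.
      by move=> x; rewrite ger0_norm// mulr_ge0.
    apply: eq_integrable => // x _ /=; congr EFin.
    by rewrite normrM [`|C * _|]ger0_norm// mulr_ge0.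
  - by move=> k x; rewrite normrM ler_wpM2l.
have mP j k : measurable_fun setT (P j k).
  by apply: continuous_measurable_fun; apply: smooth1_continuous; have [] := HP j.
have mF k : measurable_fun setT (F k).
  by apply: continuous_measurable_fun; exact: smooth1_continuous.
have mdF k : measurable_fun setT (dF k).
  apply: continuous_measurable_fun; apply: smooth1_continuous => l y.
  have -> : dF k = derive1 (F k).
    by apply/funext => t; rewrite derive1E (derive_val (is_derive := deF k t)).
  by have := sF k l.+1 y; rewrite /derive1n iterSr.
have mcons f h : measurable_fun setT f -> (forall j, measurable_fun setT (h j)) ->
    measurable_fun setT (tens (consf f h)).
  by move=> mf mh; apply: measurable_tens => i; rewrite /consf; case: unlift.
have cvgP (k_ : 'I_n -> nat -> R) (x : 'rV[R]_n.+1) : (forall j, k_ j @ \oo --> pulse (a' j) (b' j) (x ord0 (lift ord0 j))) ->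
    \prod_j k_ j k @[k --> \oo] --> tail_pulse a' b' x.
  by move=> H; apply: cvg_big => [|j _]; [exact: mul_continuous|exact: H].
have L1 := key u dphi _ up (fun k => mcons _ _ (mdF k) (mP^~ k)) (fun k x => (bnd k x).2).
have L2 := key _ phi _ (gp ord0) (fun k => mcons _ _ (mF k) (mP^~ k)) (fun k x => (bnd k x).1).
have {}L1 := L1 (fun x => (pulse a b (x ord0 ord0) - (b - a) / (d - c) * pulse c d (x ord0 ord0))
      * tail_pulse a' b' x).
have {}L2 := L2 (fun x => tent a b c d (x ord0 ord0) * tail_pulse a' b' x).
apply: cvg_unique (L1 _) _ => [|x|].
- exact: norm_hausdorff.
- rewrite /dphi; under eq_fun do rewrite tens_consf.
  apply: cvgM; first exact: dFcvg.
  by apply: (cvgP (fun j k => P j k (x ord0 (lift ord0 j)))) => j; have [_ _ _] := HP j; exact.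
have -> : (fun k => \int[mu]_x (u x * dphi k x)) = (fun k => - \int[mu]_x (g x ord0 ord0 * phi k x)).
  by apply/funext => k; rewrite -pphi; exact: wg.
apply: cvgN; apply: L2 => x.
rewrite /phi; under eq_fun do rewrite tens_consf.
apply: cvgM; first exact: Fcvg.
by apply: (cvgP (fun j k => P j k (x ord0 (lift ord0 j)))) => j; have [_ _ _] := HP j; exact.
Qed.
End weak_box.

(** * Fubini for real-valued integrals *)

Section ae_eq_integrable.
Context d (T : measurableType d) (R : realType) (mu : {measure set T -> \bar R}).
Local Open Scope ereal_scope.

Lemma ae_eq_integrable (D : set T) (f g : T -> \bar R) : measurable D ->
  measurable_fun D g -> ae_eq mu D f g -> mu.-integrable D f -> mu.-integrable D g.
Proof.
move=> mD mg fg /integrableP[mf foo]; apply/integrableP; split => //.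
rewrite -(ge0_ae_eq_integral (f := abse \o f) (g := abse \o g) mD)//.
- exact: measurableT_comp.
- exact: measurableT_comp.
- by move=> x _ /=.
- by move=> x _ /=.
- by apply: filterS fg => x H /H /= ->.
Qed.
End ae_eq_integrable.

Section real_fubini.
Context d1 d2 (T1 : measurableType d1) (T2 : measurableType d2) (R : realType).
Variables (m1 : {sigma_finite_measure set T1 -> \bar R})
  (m2 : {sigma_finite_measure set T2 -> \bar R}).
Local Open Scope ereal_scope.

Lemma Rfubini1 (F : T1 * T2 -> R) : (m1 \x m2).-integrable setT (EFin \o F) ->
  m1.-integrable setT (EFin \o (fun x => \int[m2]_y F (x, y))%R) /\
  (\int[m1]_x (\int[m2]_y F (x, y)) = \int[m1 \x m2]_z F z)%R.
Proof.
move=> iF; have iG := integrable_fubini_F iF.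
have mF := measurable_int _ iG.
have E : ae_eq m1 setT (fubini_F m2 (EFin \o F)) (EFin \o (fun x => \int[m2]_y F (x, y))%R).
  have := ae_integrable1 iF; apply: filterS => x ix _.
  by rewrite /fubini_F /= /Rintegral fineK//; exact: integrable_fin_num.
have mQ : measurable_fun setT (EFin \o (fun x => \int[m2]_y F (x, y))%R).
  apply/measurable_EFinP.
  by apply: (measurableT_comp _ mF); exact: fine_measurable.
have I : m1.-integrable setT (EFin \o (fun x => \int[m2]_y F (x, y))%R).
  exact: (ae_eq_integrable measurableT mQ E iG).
split => //; rewrite {1 3}/Rintegral; congr fine.
rewrite -(integral12_prod_meas1 iF); apply: ae_eq_integral => //.
by apply: filterS E => x H /H ->.
Qed.

End real_fubini.

Section real_fubini2.
Context d1 d2 (T1 : measurableType d1) (T2 : measurableType d2) (R : realType).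
Variables (m1 : {sigma_finite_measure set T1 -> \bar R})
  (m2 : {sigma_finite_measure set T2 -> \bar R}).
Local Open Scope ereal_scope.

Lemma Rfubini2 (F : T1 * T2 -> R) : (m1 \x m2).-integrable setT (EFin \o F) ->
  m2.-integrable setT (EFin \o (fun y => \int[m1]_x F (x, y))%R) /\
  (\int[m2]_y (\int[m1]_x F (x, y)) = \int[m1 \x m2]_z F z)%R.
Proof.
move=> iF; have mF := measurable_fubini_G iF.
have iG : m2.-integrable setT (fubini_G m1 (EFin \o F)).
  apply/integrableP; split => //.
  have [mf _] := integrableP _ _ _ iF.
  have := (integrable21ltyP m1 m2 mf).1 iF; apply: le_lt_trans.
  apply: ge0_le_integral => //.
  - exact: measurableT_comp.
  - apply: (measurable_fun_fubini_tonelli_G (m1 := m1) (abse \o (EFin \o F))) => //.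
    exact: measurableT_comp.
  - by move=> x /=.
  - move=> y _; apply: le_abse_integral => //.
    exact: (measurable_fun_pair1 y mf).
have E : ae_eq m2 setT (fubini_G m1 (EFin \o F)) (EFin \o (fun y => \int[m1]_x F (x, y))%R).
  have := ae_integrable2 iF; apply: filterS => x ix _.
  by rewrite /fubini_G /= /Rintegral fineK//; exact: integrable_fin_num.
have mQ : measurable_fun setT (EFin \o (fun y => \int[m1]_x F (x, y))%R).
  apply/measurable_EFinP.
  by apply: (measurableT_comp _ mF); exact: fine_measurable.
have I : m2.-integrable setT (EFin \o (fun y => \int[m1]_x F (x, y))%R).
  exact: (ae_eq_integrable measurableT mQ E iG).
split => //; rewrite {1 3}/Rintegral; congr fine.
rewrite -(integral21_prod_meas1 iF); apply: ae_eq_integral => //.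
by apply: filterS E => x H /H ->.
Qed.

End real_fubini2.

Section shear.
Context {R : realType} {n : nat}.
Local Notation la := (@lebesgue_measure R).
Local Notation nu := (@rV_lebesgue R n).
Local Notation mu := (@rV_lebesgue R n.+1).
Local Open Scope ereal_scope.

Definition rV_tail (x : 'rV[R]_n.+1) : 'rV[R]_n := \row_j x ord0 (lift ord0 j).

Lemma rV_tail_cons z : rV_tail (rV_cons z) = z.2.
Proof. by apply/rowP => j; rewrite mxE rV_cons_lift. Qed.

Lemma measurable_rV_tail : measurable_fun setT rV_tail.
Proof. exact: (measurableT_comp measurable_snd measurable_rV_uncons). Qed.

(** By Tonelli the integral of the absolute value is the product of those of w
    and H. *)
Lemma integrable_shear (w : measurableTypeR R -> R) (H : measurableTypeR R * 'rV[R]_n -> R) :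
  la.-integrable setT (EFin \o w) -> (la \x nu).-integrable setT (EFin \o H) ->
  (la \x mu).-integrable setT
    (EFin \o (fun z : measurableTypeR R * 'rV[R]_n.+1 => (w (z.2 ord0 ord0) * H (z.1, rV_tail z.2))%R)).
Proof.
move=> iw iH.
have mw : measurable_fun setT w by apply/measurable_EFinP; exact: measurable_int iw.
have mH : measurable_fun setT H by apply/measurable_EFinP; exact: measurable_int iH.
have mHz : measurable_fun setT (fun z : measurableTypeR R * 'rV[R]_n.+1 => H (z.1, rV_tail z.2)).
  apply: (measurableT_comp mH); apply/measurable_fun_pair => //.
  exact: (measurableT_comp measurable_rV_tail).
have mwz : measurable_fun setT (fun z : measurableTypeR R * 'rV[R]_n.+1 => w (z.2 ord0 ord0)).
  apply: (measurableT_comp mw); exact: (measurableT_comp (measurable_rV_coord ord0)).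
have mr : measurable_fun setT (fun z : measurableTypeR R * 'rV[R]_n.+1 => (w (z.2 ord0 ord0) * H (z.1, rV_tail z.2))%R).
  exact: measurable_funM.
have mf := (measurable_EFinP _ _).2 mr.
apply/(integrable12ltyP la mu mf).
pose I (x : measurableTypeR R) := \int[nu]_y `|H (x, y)|%:E.
pose C := \int[la]_s `|w s|%:E.
have aH : measurable_fun setT (fun z => `|H z|%:E) by apply/measurable_EFinP; exact: measurableT_comp.
have aw : measurable_fun setT (fun z => `|w z|%:E) by apply/measurable_EFinP; exact: measurableT_comp.
rewrite (eq_integral (fun x => C * I x)); last first.
  move=> x _; rewrite ge0_integral_rV_cons//=; last first.
    by apply/measurable_EFinP; apply: measurableT_comp => //; exact: (measurable_fun_pair2 x mr).
  rewrite (eq_integral (fun z => `|w z.1|%:E * `|H (x, z.2)|%:E)); last first.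
    by move=> z _; rewrite rV_cons_ord0 rV_tail_cons -EFinM normrM.
  rewrite fubini_tonelli1//=; last first.
    apply: emeasurable_funM; first exact: (measurableT_comp aw).
    exact: (measurableT_comp (measurable_fun_pair2 x aH)).
  rewrite /fubini_F/=.
  rewrite (eq_integral (fun s => I x * `|w s|%:E)).
    rewrite ge0_integralZl//; first by rewrite muleC.
    by apply: integral_ge0.
  move=> s _; rewrite muleC -ge0_integralZl//.
  exact: (measurable_fun_pair2 x aH).
have mI : measurable_fun setT I by apply: (measurable_fun_fubini_tonelli_F (m2 := nu) _ aH).
have I0 x : 0 <= I x by exact: integral_ge0.
have C0 : 0 <= C by exact: integral_ge0.
rewrite ge0_integralZl//.
have -> : \int[la]_x I x = \int[la \x nu]_z `|H z|%:E by rewrite fubini_tonelli1.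
apply: lte_mul_pinfty => //.
  by move/integrableP : iw => [_ h]; rewrite ge0_fin_numE.
by move/integrableP : iH => [_ h].
Qed.

End shear.

(** * A representative built from the gradient *)

Section pulse_integrals.
Context {R : realType}.
Local Notation la := (@lebesgue_measure R).

Lemma pulseE (a b : R) : pulse a b = \1_(`]a, b]%classic) :> (R -> R).
Proof. by apply/funext => t; rewrite /pulse indicE mem_setE in_itv. Qed.

Lemma measurable_pulse (a b : R) : measurable_fun setT (pulse a b : measurableTypeR R -> R).
Proof. by rewrite pulseE; exact: measurable_indic. Qed.

Lemma lebesgue_measure_ocitv (a b : R) : la `]a, b]%classic = (Num.max (b - a) 0)%:E.
Proof.
rewrite (@lebesgue_measure_itv R `]a, b]) /= lte_fin; case: ltP => ab.
  by rewrite -EFinD max_l// subr_ge0 ltW.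
by rewrite max_r// subr_le0.
Qed.

Lemma integrable_pulse (a b : R) : la.-integrable setT (EFin \o pulse a b).
Proof.
apply/integrableP; split; first by apply/measurable_EFinP; exact: measurable_pulse.
rewrite (eq_integral (fun x : measurableTypeR R => (\1_(`]a, b]%classic) x)%:E)); last first.
  by move=> x _; rewrite /= pulseE indicE; case: (_ \in _); rewrite ?normr0 ?normr1.
by rewrite integral_indic// setIT [X in (X < _)%E]lebesgue_measure_ocitv ltry.
Qed.

Lemma Rintegral_pulse (a b : R) : \int[la]_t pulse a b t = Num.max (b - a) 0.
Proof.
rewrite /Rintegral; under eq_integral do rewrite pulseE.
rewrite integral_indic// setIT; transitivity (fine (Num.max (b - a) 0)%:E) => //.
congr fine; exact: lebesgue_measure_ocitv.
Qed.

(** Averaging v s - v r = int_r^s v' over r in [c, d] gives, for v absolutely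
    continuous on [c, d], v s = (d - c)^-1 int_c^d v + int_c^d v' t * kern c d
    s t dt. *)
Definition kern (c d s t : R) : R := (t < s)%R%:R - (d - t) / (d - c).

Lemma pulse_kern (a b c d s t : R) : pulse a b s * kern c d s t =
  pulse (Num.max a t) b s + - ((d - t) / (d - c)) * pulse a b s.
Proof.
rewrite /kern /pulse gt_max mulrBr; congr (_ + _); last by rewrite mulrC mulNr.
by case: (a < s); case: (t < s); case: (s <= b); rewrite ?mul0r ?mulr0 ?mulr1.
Qed.

(** Seen from t, the kernel integrated over s in ]a, b] is minus the tent that
    [weak_box] admits as test function. *)
Lemma Rintegral_pulse_kern (a b c d t : R) : a <= b -> c < t -> t <= d ->
  \int[la]_s (pulse a b s * kern c d s t) = - tent a b c d t.
Proof.
move=> ab ct td; under eq_Rintegral do rewrite pulse_kern.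
rewrite RintegralD//; last 2 first.
- exact: integrable_pulse.
- exact: (integrableZl measurableT (- ((d - t) / (d - c))) (integrable_pulse a b)).
rewrite RintegralZl//; last exact: integrable_pulse.
rewrite !Rintegral_pulse /tent.
have -> : Num.max (b - a) 0 = b - a by rewrite max_l// subr_ge0.
have -> : Num.max (t - c) 0 = t - c by rewrite max_l// subr_ge0 ltW.
have -> : Num.max (t - d) 0 = 0 by rewrite max_r// subr_le0.
have dc : d - c != 0 by rewrite gt_eqF// subr_gt0 (lt_le_trans ct).
have -> : Num.max (b - Num.max a t) 0 = b - a - (Num.max (t - a) 0 - Num.max (t - b) 0).
  by have [h|h] := leP a t; rewrite /Num.max; do ![case: ifPn; rewrite -?leNgt => ?]; lra.
by field.
Qed.

Lemma integrable_pulse_kern (a b c d t : R) :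
  la.-integrable setT (EFin \o (fun s => pulse a b s * kern c d s t)).
Proof.
have i2 := integrableZl measurableT (- ((d - t) / (d - c))) (integrable_pulse a b).
apply: eq_integrable (integrableD measurableT (integrable_pulse (Num.max a t) b) i2) => // s _.
by rewrite /= pulse_kern EFinD EFinM.
Qed.

Lemma kern_le (c d s t : R) : c < t -> t <= d -> `|kern c d s t| <= 1.
Proof.
move=> ct td; have dc : 0 < d - c by rewrite subr_gt0 (lt_le_trans ct).
rewrite /kern; have h0 : 0 <= (d - t) / (d - c) by rewrite divr_ge0 ?subr_ge0// (ltW (lt_le_trans ct td)).
have h1 : (d - t) / (d - c) <= 1 by rewrite ler_pdivrMr// mul1r; lra.
by rewrite ler_norml; case: (t < s) => /=; apply/andP; split; lra.
Qed.

End pulse_integrals.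

Section tent_facts.
Context {R : realType}.

Lemma tent0 (a b c d t : R) : c <= a -> a <= b -> b <= d -> c < d ->
  ~~ (c < t <= d) -> tent a b c d t = 0.
Proof.
move=> ca ab bd cd; rewrite negb_and -leNgt -ltNge => td; rewrite /tent.
have dc : d - c != 0 by rewrite gt_eqF// subr_gt0.
case/orP : td => [tc|dt].
  by rewrite !max_r ?subr0 ?mulr0 ?subrr//; lra.
by rewrite !max_l; [field|lra..].
Qed.

Lemma tent_le (a b c d t : R) : c <= a -> a <= b -> b <= d -> c < d ->
  `|tent a b c d t| <= b - a.
Proof.
move=> ca ab bd cd; rewrite /tent.
have D x y : x <= y -> 0 <= Num.max (t - x) 0 - Num.max (t - y) 0 <= y - x.
  by move=> xy; rewrite /Num.max; case: ifPn; case: ifPn; rewrite -?leNgt => *; apply/andP; split; lra.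
have /andP[A0 A1] := D _ _ ab; have /andP[B0 B1] := D _ _ (ltW cd).
have dc : 0 < d - c by rewrite subr_gt0.
set K := (b - a) / (d - c); set B := Num.max (t - c) 0 - _ in B0 B1 *.
have K0 : 0 <= K by rewrite divr_ge0 ?subr_ge0// ltW.
have KB0 : 0 <= K * B by rewrite mulr_ge0.
have KB1 : K * B <= b - a.
  by rewrite (le_trans (ler_wpM2l K0 B1))// /K divfK// gt_eqF.
by rewrite ler_norml; apply/andP; split; lra.
Qed.

Lemma measurable_tent (a b c d : R) : measurable_fun setT (tent a b c d : measurableTypeR R -> R).
Proof.
have m x : measurable_fun setT (fun t : measurableTypeR R => Num.max (t - x) 0 : R).
  by apply: measurable_maxr => //; exact: measurable_funB.
apply: measurable_funB; first exact: measurable_funB.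
by apply: measurable_funM => //; exact: measurable_funB.
Qed.

End tent_facts.

Section window.
Context {R : realType} {n : nat}.
Local Notation la := (@lebesgue_measure R).
Local Notation nu := (@rV_lebesgue R n).
Local Notation mu := (@rV_lebesgue R n.+1).
Variables (p : R) (u : 'rV[R]_n.+1 -> R) (g : 'rV[R]_n.+1 -> 'rV[R]_n.+1) (M : R).
Hypotheses (p1 : 1 <= p) (up : Lp p u) (gp : Lp_gradient p u g) (M0 : 0 < M).

(** The representation by [kern] lives on a bounded interval, hence u is
    studied on cubes first. *)
Definition window m : set 'rV[R]_m := box (fun=> - M) (fun=> M).

Definition cut (v : 'rV[R]_n.+1 -> R) (z : measurableTypeR R * 'rV[R]_n) : R :=
  v (rV_cons z) * \1_(@window n.+1) (rV_cons z).

Lemma measurable_window m : measurable (@window m).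
Proof. exact: measurable_rV_box. Qed.

Lemma window_lty m : (@rV_lebesgue R m (@window m) < +oo)%E.
Proof. by rewrite rV_lebesgue_box ?ltry// => i; have := M0; lra. Qed.

Lemma cut_integrable v : Lp p v -> (la \x nu)%E.-integrable setT (EFin \o cut v).
Proof.
move=> vp; have := Lp_integrable_on p1 vp (measurable_window (m := n.+1)) (window_lty n.+1).
move=> /(integrable_mkcond _ (measurable_window (m := n.+1))).1 iv.
have /(integrable_rV_cons (measurable_int _ iv)).1 := iv.
apply: eq_integrable => // z _ /=; rewrite patchE /cut indicE.
by case: ifPn => /= _; rewrite ?mulr1 ?mulr0.
Qed.

(** The integrand in t of the representation of [kern], for v = u (., y). *)
Definition slice_rep (s t : R) (y : 'rV[R]_n) : R :=
  cut u (t, y) / (M - - M) + cut (fun x => g x ord0 ord0) (t, y) * kern (- M) M s t.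

Let Phi (z : measurableTypeR R * 'rV[R]_n.+1) : R :=
  pulse (- M) M (z.2 ord0 ord0) * slice_rep (z.2 ord0 ord0) z.1 (rV_tail z.2).

Lemma cut_out v t y : ~ (- M < t <= M) -> cut v (t, y) = 0.
Proof.
move=> tM; rewrite /cut indicE memNset ?mulr0// => /(_ ord0).
by rewrite rV_cons_ord0.
Qed.

Lemma slice_rep_le s t y : `|slice_rep s t y| <=
  `|cut u (t, y)| / (M - - M) + `|cut (fun x => g x ord0 ord0) (t, y)|.
Proof.
rewrite /slice_rep (le_trans (ler_normD _ _))// lerD//.
  by rewrite normrM [`|_^-1|]gtr0_norm// invr_gt0; have := M0; lra.
have [/andP[tM Mt]|tM] := pselect (- M < t <= M); last by rewrite cut_out// mul0r.
by rewrite normrM ler_piMr// kern_le.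
Qed.

Let Phi_integrable : (la \x mu)%E.-integrable setT (EFin \o Phi).
Proof.
have iu := cut_integrable up; have ig := cut_integrable (gp.1 ord0).
have muc : measurable_fun setT (cut u) by apply/measurable_EFinP; exact: measurable_int iu.
have mgc : measurable_fun setT (cut (fun x => g x ord0 ord0)).
  by apply/measurable_EFinP; exact: measurable_int ig.
pose H z := `|cut u z| / (M - - M) + `|cut (fun x => g x ord0 ord0) z|.
have iH : (la \x nu)%E.-integrable setT (EFin \o H).
  have i1 := integrableZl measurableT (M - - M)^-1 (integrable_abse iu).
  have i2 := integrable_abse ig.
  apply: eq_integrable (integrableD measurableT i1 i2) => // z _.
  by rewrite /H /= mulrC EFinD.
have := integrable_shear (integrable_pulse (- M) M) iH.
apply: le_integrable => //.
  have m0 : measurable_fun setT (fun z : measurableTypeR R * 'rV[R]_n.+1 => z.2 ord0 ord0 : measurableTypeR R).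
    exact: (measurableT_comp (measurable_rV_coord ord0)).
  have mt : measurable_fun setT (fun z : measurableTypeR R * 'rV[R]_n.+1 => (z.1, rV_tail z.2)).
    apply/measurable_fun_pair => //; exact: (measurableT_comp measurable_rV_tail).
  apply/measurable_EFinP; apply: measurable_funM.
    exact: (measurableT_comp (measurable_pulse _ _) m0).
  apply: measurable_funD.
    by apply: measurable_funM => //; exact: (measurableT_comp muc mt).
  apply: measurable_funM; first exact: (measurableT_comp mgc mt).
  apply: measurable_funB.
    have mb : measurable_fun setT (fun z : measurableTypeR R * 'rV[R]_n.+1 => z.1 < z.2 ord0 ord0).
      by apply: measurable_fun_ltr.
    rewrite (_ : (fun _ => _) = \1_[set z : measurableTypeR R * 'rV[R]_n.+1 | z.1 < z.2 ord0 ord0]).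
      by apply: measurable_indic; have := mb measurableT [set true] I; rewrite setTI.
    by apply/funext => z; rewrite indicE; congr (nat_of_bool _)%:R; apply/idP/idP; rewrite inE.
  by apply: measurable_funM => //; exact: measurable_funB.
move=> z _ /=; rewrite lee_fin !normrM ler_wpM2l//.
by rewrite (le_trans (slice_rep_le _ _ _))// ler_norm.
Qed.

Definition window_rep (x : 'rV[R]_n.+1) : R :=
  \int[la]_t slice_rep (x ord0 ord0) t (rV_tail x).

Let rep (x : 'rV[R]_n.+1) : R := \int[la]_t Phi (t, x).

Let repE x : window x -> rep x = window_rep x.
Proof.
move=> /(_ ord0) xM; apply: eq_Rintegral => t _.
by rewrite /Phi /= /pulse xM mul1r.
Qed.

Lemma boxE (a b : 'I_n.+1 -> R) (x : 'rV[R]_n.+1) : \1_(box a b) x =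
  pulse (a ord0) (b ord0) (x ord0 ord0) *
  tail_pulse (fun j => a (lift ord0 j)) (fun j => b (lift ord0 j)) x.
Proof.
rewrite indicE /tail_pulse; have [xab|xab] := boolP (x \in box a b).
  move: xab; rewrite inE => xab; rewrite /pulse xab mul1r big1// => j _.
  by rewrite xab.
have [x0|/negbTE x0] := boolP (a ord0 < x ord0 ord0 <= b ord0); last by rewrite /pulse x0 mul0r.
have [j xj] : exists j, ~~ (a (lift ord0 j) < x ord0 (lift ord0 j) <= b (lift ord0 j)).
  apply/existsP; rewrite -negb_forall; apply: contra xab => /forallP H.
  by rewrite inE => i; have [j ->|->] := unliftP ord0 i.
by rewrite (bigD1 j)//= /pulse (negbTE xj) mul0r mulr0.
Qed.

(** By Fubini, integrating the representation over a box amounts to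
    integrating u against a multiple of a pulse and g against the kernel
    integrated over the box, that is, minus a tent; by [weak_box] the sum is
    the integral of u over the box. *)
Lemma window_box (a b : 'I_n.+1 -> R) : (forall i, - M <= a i) -> (forall i, a i <= b i) ->
  (forall i, b i <= M) -> \int[mu]_(x in box a b) rep x = \int[mu]_(x in box a b) u x.
Proof.
move=> Ma ab bM.
have mB : measurable (box a b) by exact: measurable_rV_box.
have BW : box a b `<=` @window n.+1.
  by move=> x xab i; have /andP[? ?] := xab i; rewrite (le_lt_trans (Ma i))//= (le_trans _ (bM i)).
pose a' (j : 'I_n) := a (lift ord0 j); pose b' (j : 'I_n) := b (lift ord0 j).
(* Fubini in (t, x), then in x = (s, y) *)
pose PB (z : measurableTypeR R * 'rV[R]_n.+1) := Phi z * \1_(box a b) z.2.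
have iPB : (la \x mu)%E.-integrable setT (EFin \o PB).
  apply: le_integrable Phi_integrable => //.
    apply/measurable_EFinP; apply: measurable_funM.
      by apply/measurable_EFinP; exact: measurable_int Phi_integrable.
    have mI : measurable_fun setT (\1_(box a b) : 'rV[R]_n.+1 -> R) by exact: measurable_indic.
    exact: (measurableT_comp mI measurable_snd).
  move=> z _ /=; rewrite lee_fin normrM ler_piMr// indicE.
  by case: (_ \in _); rewrite ?normr1 ?normr0.
have lm0 : measurable_fun setT (fun x : 'rV[R]_n.+1 => x ord0 ord0 : measurableTypeR R).
  exact: measurable_rV_coord.
have MM : - M < M by have := M0; lra.
have mtp : measurable_fun setT (tail_pulse a' b').
  apply: measurable_prod => j _; apply: (measurableT_comp (measurable_pulse _ _)).
  exact: measurable_rV_coord.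
have tpE s y : tail_pulse a' b' (rV_cons (s, y)) = \prod_j pulse (a' j) (b' j) (y ord0 j).
  by apply: eq_bigr => j _; rewrite rV_cons_lift.
have pulse01 (x y t : R) : 0 <= pulse x y t <= 1 by rewrite /pulse ler0n lern1 leq_b1.
have tpW (t : R) (x : 'rV[R]_n.+1) : `|t| <= 1 -> `|t * pulse (- M) M (x ord0 ord0) * tail_pulse a' b' x| <= \1_(@window n.+1) x.
  move=> t1; rewrite /window boxE -mulrA normrM.
  have H1 : 0 <= tail_pulse a' b' x <= tail_pulse (fun=> - M) (fun=> M) x.
    rewrite prodr_ge0 => [/=|j _]; last by have /andP[] := pulse01 (a' j) (b' j) (x ord0 (lift ord0 j)).
    apply: ler_prod => j _; have /andP[-> _] /= := pulse01 (a' j) (b' j) (x ord0 (lift ord0 j)).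
    rewrite /pulse ler_nat; case: (boolP (a' j < _ <= b' j)) => // /andP[ax xb].
    by rewrite (le_lt_trans (Ma _) ax) (le_trans xb (bM _)).
  have /andP[p0 _] := pulse01 (- M) M (x ord0 ord0); case/andP: H1 => H1 H2.
  rewrite [X in _ * X]ger0_norm ?mulr_ge0//.
  by rewrite (le_trans (ler_piMl (mulr_ge0 p0 H1) t1))// ler_wpM2l.
have bnd_int (v chi : 'rV[R]_n.+1 -> R) (C : R) : Lp p v -> measurable_fun setT chi -> 0 <= C ->
    (forall x, `|chi x| <= C * \1_(@window n.+1) x) ->
    mu.-integrable setT (EFin \o (fun x => v x * chi x)).
  by move=> vp mchi C0 Hchi; exact: (Lp_mul_integrable p1 vp (measurable_window (m := n.+1)) (window_lty n.+1) mchi Hchi).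
set k := (b ord0 - a ord0) / (M - - M).
pose X1 x := u x * (pulse (a ord0) (b ord0) (x ord0 ord0) * tail_pulse a' b' x).
pose X2 x := u x * (k * pulse (- M) M (x ord0 ord0) * tail_pulse a' b' x).
pose X3 x := g x ord0 ord0 * (tent (a ord0) (b ord0) (- M) M (x ord0 ord0) * tail_pulse a' b' x).
have abM : b ord0 - a ord0 <= M - - M by have := Ma ord0; have := bM ord0; lra.
have k01 : `|k| <= 1.
  have h : 0 < M - - M by have := M0; lra.
  have hk : 0 <= k by apply: divr_ge0; [rewrite subr_ge0|exact: ltW].
  by rewrite ger0_norm// /k ler_pdivrMr// mul1r.
have pabE (t : R) : pulse (a ord0) (b ord0) t * pulse (- M) M t = pulse (a ord0) (b ord0) t.
  rewrite /pulse; case: (boolP (a ord0 < t <= b ord0)) => [/andP[at_ tb]|_]; last by rewrite mul0r.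
  by rewrite (le_lt_trans (Ma _) at_) (le_trans tb (bM _)) mulr1.
have mchi (f : measurableTypeR R -> R) : measurable_fun setT f ->
    measurable_fun setT (fun x : 'rV[R]_n.+1 => f (x ord0 ord0) * tail_pulse a' b' x).
  by move=> mf; apply: measurable_funM => //; exact: (measurableT_comp mf lm0).
have iX1 : mu.-integrable setT (EFin \o X1).
  apply: (bnd_int _ _ 1 up (mchi _ (measurable_pulse _ _))) => // x.
  by rewrite mul1r -pabE; apply: tpW; have /andP[? ?] := pulse01 (a ord0) (b ord0) (x ord0 ord0); rewrite ger0_norm.
have iX2 : mu.-integrable setT (EFin \o X2).
  apply: (bnd_int _ _ 1 up) => [|//|x]; last by rewrite mul1r; exact: tpW.
  by apply: (mchi (fun t => k * pulse (- M) M t)); apply: measurable_funM => //; exact: measurable_pulse.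
have iX3 : mu.-integrable setT (EFin \o X3).
  apply: (bnd_int _ _ (b ord0 - a ord0) (gp.1 ord0) (mchi _ (measurable_tent _ _ _ _))) => [|x].
    by rewrite subr_ge0.
  have -> : tent (a ord0) (b ord0) (- M) M (x ord0 ord0) =
      tent (a ord0) (b ord0) (- M) M (x ord0 ord0) * pulse (- M) M (x ord0 ord0).
    rewrite /pulse; case: (boolP (- M < _ <= M)) => [_|h]; rewrite ?mulr1//.
    by rewrite mulr0 tent0.
  rewrite -mulrA normrM ler_pM//; first exact: tent_le.
  by have := tpW 1 x; rewrite mul1r; apply; rewrite normr1.
have weak : \int[mu]_x X1 x = \int[mu]_x (X2 x - X3 x).
  rewrite RintegralB// -[RHS]/(_ - _).
  have := weak_box p1 up gp (Ma ord0) (ab ord0) (bM ord0) MM (fun j => ab (lift ord0 j)).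
  rewrite -/a' -/b' -/k -[X in _ = - X]/(\int[mu]_x X3 x) => <-.
  rewrite -RintegralD//; last first.
    apply: eq_integrable (integrableB measurableT iX1 iX2) => // x _.
    by rewrite /X1 /X2 /= -EFinB; congr EFin; ring.
  by apply: eq_Rintegral => x _; rewrite /X1 /X2; ring.
pose D z := X2 (rV_cons z) - X3 (rV_cons z).
have iX23 : mu.-integrable setT (EFin \o (fun x => X2 x - X3 x)).
  by apply: eq_integrable (integrableB measurableT iX2 iX3).
have iD : (la \x nu)%E.-integrable setT (EFin \o D).
  exact: ((integrable_rV_cons (measurable_int _ iX23)).1 iX23).
have DE : \int[(la \x nu)%E]_z D z = \int[mu]_x (X2 x - X3 x).
  by rewrite /Rintegral; congr fine; rewrite (integral_rV_cons iX23).
transitivity (\int[mu]_x X1 x); last first.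
  rewrite [RHS]Rintegral_mkcond; apply: eq_Rintegral => x _.
  by rewrite patchE /X1 -boxE indicE; case: ifP => _; rewrite ?mulr1 ?mulr0.
rewrite weak -DE -(Rfubini1 iD).2 [LHS]Rintegral_mkcond.
transitivity (\int[mu]_x \int[la]_t PB (t, x)).
  apply: eq_Rintegral => x _; rewrite patchE /PB /= indicE; case: ifP => _.
    by under eq_Rintegral do rewrite mulr1.
  by under eq_Rintegral do rewrite mulr0; rewrite Rintegral_cst// mul0r.
rewrite (Rfubini2 iPB).2 -(Rfubini1 iPB).2.
rewrite /Rintegral; congr fine.
apply: ae_eq_integral => //.
- exact: measurable_int (Rfubini1 iPB).1.
- exact: measurable_int (Rfubini1 iD).1.
have := ae_integrable1 iPB; apply: filterS => t it _; congr EFin.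
transitivity (\int[(la \x nu)%E]_z PB (t, rV_cons z)).
  by rewrite /Rintegral; congr fine; rewrite (integral_rV_cons it).
have it' := (integrable_rV_cons (measurable_int _ it)).1 it.
rewrite -(Rfubini2 (F := fun z => PB (t, rV_cons z)) it').2.
apply: eq_Rintegral => y _.
set tp := \prod_j pulse (a' j) (b' j) (y ord0 j).
have absorb v : cut v (t, y) * tp = v (rV_cons (t, y)) * (pulse (- M) M t * tp).
  rewrite /cut /window boxE rV_cons_ord0 -!mulrA; congr (_ * (_ * _)).
  rewrite /tail_pulse -big_split; apply: eq_bigr => j _ /=.
  rewrite rV_cons_lift /pulse.
  case: (boolP (a' j < _ <= b' j)) => [/andP[ax xb]|_]; last by rewrite mulr0.
  by rewrite (le_lt_trans (Ma _) ax) (le_trans xb (bM _)) mulr1.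
transitivity (\int[la]_s (tp * cut u (t, y) / (M - - M) * pulse (a ord0) (b ord0) s +
    tp * cut (fun x => g x ord0 ord0) (t, y) * (pulse (a ord0) (b ord0) s * kern (- M) M s t))).
  apply: eq_Rintegral => s _.
  rewrite /PB /Phi /slice_rep /= boxE tpE -/tp rV_cons_ord0 rV_tail_cons /=.
  rewrite -[in RHS]pabE; ring.
have i1 := integrableZl measurableT (tp * cut u (t, y) / (M - - M)) (integrable_pulse (a ord0) (b ord0)).
have i2 := integrableZl measurableT (tp * cut (fun x => g x ord0 ord0) (t, y)) (integrable_pulse_kern (a ord0) (b ord0) (- M) M t).
rewrite RintegralD// !RintegralZl//; [|exact: integrable_pulse_kern|exact: integrable_pulse].
rewrite Rintegral_pulse max_l ?subr_ge0// /D /X2 /X3 tpE -/tp rV_cons_ord0 /=.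
have [tM|tM] := boolP (- M < t <= M); last first.
  rewrite cut_out; last exact/negP.
  rewrite cut_out; last exact/negP.
  have -> : pulse (- M) M t = 0 by rewrite /pulse (negbTE tM).
  by rewrite tent0//; ring.
have /andP[Mt tM'] := tM.
rewrite Rintegral_pulse_kern//.
rewrite [tp * _]mulrC [tp * cut _ _]mulrC !absorb /k.
have -> : pulse (- M) M t = 1 by rewrite /pulse tM.
by ring.
Qed.


(** Both sides have the same integral over every box in the window. *)
Lemma window_repP : {ae mu, forall x, window x -> u x = window_rep x}.
Proof.
have irep : mu.-integrable setT (EFin \o rep) by exact: (Rfubini2 Phi_integrable).1.
have mW := measurable_window (m := n.+1).
have iu : mu.-integrable (@window n.+1) (EFin \o u).
  exact: Lp_integrable_on p1 up mW (window_lty n.+1).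
have irepW (B : set 'rV[R]_n.+1) : measurable B -> mu.-integrable B (EFin \o rep).
  by move=> mB; exact: integrableS irep.
have := @ae_eq0_boxes R n.+1 (fun=> - M) (fun=> M) (fun x => u x - rep x).
move=> H; have : {ae mu, forall x, window x -> u x - rep x = 0}.
  apply: H => [|a b Ma ab bM].
    exact: eq_integrable (integrableB mW iu (irepW _ mW)).
  have mB : measurable (box a b) by exact: measurable_rV_box.
  have BW : box a b `<=` @window n.+1.
    by move=> x xab i; have /andP[? ?] := xab i; rewrite (le_lt_trans (Ma i))//= (le_trans _ (bM i)).
  rewrite RintegralB//; [|exact: integrableS iu|exact: irepW].
  by rewrite window_box// subrr.
apply: filterS => x Hx xW; rewrite -repE//; apply/eqP; rewrite -subr_eq0; apply/eqP.
exact: Hx.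
Qed.

End window.

(** * Absolute continuity on lines *)

Section ae_facts.
Context {R : realType}.
Local Notation la := (@lebesgue_measure R).

Lemma ae_itv_exists (P : R -> Prop) (a b : R) : {ae la, forall t, P t} -> a < b ->
  exists2 t, a < t < b & P t.
Proof.
move=> [Z [mZ Z0 HZ]] ab; apply: contrapT => noP.
have sub : `]a, b[%classic `<=` Z.
  move=> t /=; rewrite in_itv/= => tab; apply: HZ => /= Pt; apply: noP.
  by exists t.
have : (la `]a, b[%classic <= la Z)%E by apply: le_measure => //; rewrite inE.
by rewrite Z0 (@lebesgue_measure_itv R `]a, b[) /= lte_fin ab -EFinD lee_fin subr_le0 leNgt ab.
Qed.

End ae_facts.

Section kern_measurable.
Context {R : realType}.

Lemma measurable_kern (c d s : R) : measurable_fun setT (kern c d s : measurableTypeR R -> R).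
Proof.
apply: measurable_funB; last by apply: measurable_funM => //; exact: measurable_funB.
rewrite (_ : (fun _ => _) = \1_(`]-oo, s[%classic)); first exact: measurable_indic.
by apply/funext => t; rewrite indicE mem_setE in_itv.
Qed.

End kern_measurable.

Section absolutely_continuous_slices.
Context {R : realType} {n : nat}.
Local Notation la := (@lebesgue_measure R).
Local Notation nu := (@rV_lebesgue R n).
Local Notation mu := (@rV_lebesgue R n.+1).
Variables (p : R) (u : 'rV[R]_n.+1 -> R) (g : 'rV[R]_n.+1 -> 'rV[R]_n.+1).
Hypotheses (p1 : 1 <= p) (up : Lp p u) (gp : Lp_gradient p u g).

Definition slice_primitive (h V : R -> R) := forall s s', s <= s' ->
  la.-integrable (`[s, s'[%classic : set (measurableTypeR R)) (EFin \o h) /\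
  V s' - V s = \int[la]_(t in `[s, s'[) h t.

(** On almost every line and for every k, u agrees a.e. in ]-k-1, k+1] with
    its kernel representation V k. The latter is a primitive of g there,
    because kern c d s' t - kern c d s t is the indicator of s <= t < s'. All
    the V k take at some point s0 the value of u, so they agree and glue to
    one primitive. *)
Lemma ac_slices : {ae nu, forall y, exists2 V : R -> R,
  slice_primitive (fun t => g (rV_cons (t, y)) ord0 ord0) V &
  {ae la, forall t, u (rV_cons (t, y)) = V t}}.
Proof.
have M0 k : (0 : R) < k.+1%:R by rewrite ltr0n.
have W : {ae mu, forall x, forall k, window k.+1%:R x -> u x = window_rep u g k.+1%:R x}.
  apply: ae_foralln => k; exact: window_repP p1 up gp (M0 k).
have Iu : {ae nu, forall y, forall k, la.-integrable setT (fun t => (cut k.+1%:R u (t, y))%:E)}.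
  apply: ae_foralln => k; exact: ae_integrable2 (cut_integrable p1 _ up).
have Ig : {ae nu, forall y, forall k, la.-integrable setT (fun t => (cut k.+1%:R (fun x => g x ord0 ord0) (t, y))%:E)}.
  apply: ae_foralln => k; exact: ae_integrable2 (cut_integrable p1 _ (gp.1 ord0)).
move: (ae_rV_cons W) Iu Ig; apply: filterS3 => y Wy Iuy Igy.
pose h (t : measurableTypeR R) : R := g (rV_cons (t, y)) ord0 ord0.
pose K0 := Num.truncn (\sum_j `|y ord0 j|).
have yK k j : (K0 <= k)%N -> - k.+1%:R < y ord0 j <= k.+1%:R.
  move=> Kk; have yS : `|y ord0 j| <= \sum_j `|y ord0 j| by rewrite (bigD1 j)//= lerDl sumr_ge0.
  have := le_lt_trans yS (truncnS_gt _) => yk.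
  have : `|y ord0 j| < k.+1%:R by rewrite (lt_le_trans yk)// ler_nat ltnS.
  by rewrite ltr_norml => /andP[-> /ltW].
have cutE k v t : (K0 <= k)%N -> cut k.+1%:R v (t, y) = v (rV_cons (t, y)) * pulse (- k.+1%:R) k.+1%:R t.
  move=> Kk; rewrite /cut /window boxE rV_cons_ord0 [tail_pulse _ _ _]big1 ?mulr1// => j _.
  by rewrite rV_cons_lift /pulse yK.
pose V k s := window_rep u g k.+1%:R (rV_cons (s, y)).
have VE k (s s' : R) : (K0 <= k)%N -> - k.+1%:R < s -> s <= s' -> s' <= k.+1%:R ->
  la.-integrable (`[s, s'[%classic : set (measurableTypeR R)) (EFin \o h) /\
  V k s' - V k s = \int[la]_(t in `[s, s'[) h t.
  move=> Kk ks ss' s'k.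
  set M : R := k.+1%:R in ks s'k *.
  have MM : 0 < M - - M by rewrite opprK addr_gt0.
  have in_win t : s <= t -> t < s' -> pulse (- M) M t = 1.
    by move=> st ts; rewrite /pulse (lt_le_trans ks st) (le_trans (ltW ts) s'k).
  have isl s1 : la.-integrable setT (fun t => (slice_rep u g M s1 t y)%:E).
    have i1 := integrableZl measurableT (M - - M)^-1 (Iuy k).
    have i2 : la.-integrable setT (fun t => (cut M (fun x => g x ord0 ord0) (t, y) * kern (- M) M s1 t)%:E).
      apply: le_integrable (Igy k) => //.
        apply/measurable_EFinP; apply: measurable_funM; last exact: measurable_kern.
        by apply/measurable_EFinP; exact: measurable_int (Igy k).
      move=> t _ /=; rewrite lee_fin normrM.
      have [/andP[tM Mt]|tM] := pselect (- M < t <= M); last first.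
        by rewrite cut_out// normr0 mul0r.
      by rewrite ler_piMr// kern_le.
    apply: eq_integrable (integrableD measurableT i1 i2) => // t _.
    by rewrite /slice_rep /= -EFinM mulrC EFinD.
  split.
    have mI : measurable (`[s, s'[%classic : set (measurableTypeR R)) by exact: measurable_itv.
    have := integrableS measurableT mI (@subsetT _ _) (Igy k).
    apply: eq_integrable => // t; rewrite inE/= in_itv/= => /andP[st ts].
    by rewrite cutE// in_win// mulr1.
  rewrite /V /window_rep !rV_cons_ord0 !rV_tail_cons/= -RintegralB//; [|exact: isl..].
  rewrite [RHS]Rintegral_mkcond; apply: eq_Rintegral => t _; rewrite patchE.
  rewrite /slice_rep /kern cutE// (cutE k (fun x => g x ord0 ord0))// -/M -/(h t).
  case: ifPn; rewrite mem_setE in_itv/=.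
    move=> /andP[st ts]; rewrite in_win// ts [t < s]ltNge st/=; ring.
  rewrite negb_and -ltNge -leNgt -[RHS]/(0 : R) => /orP[ts|st].
    rewrite ts (lt_le_trans ts ss'); ring.
  rewrite [t < s']ltNge st [t < s]ltNge (le_trans ss' st)/=; ring.
(* a point of ]-1, 0[, hence of all the windows, where u agrees with every V k *)
have [s0 /andP[s0l s0r] Vs0] := ae_itv_exists Wy (ltrN10 _ : (-1 : R) < 0).
have s0w k : - k.+1%:R < s0 < k.+1%:R.
  have k1 : (1 : R) <= k.+1%:R by rewrite ler1n.
  move: (k.+1%:R) k1 => z k1.
  by apply/andP; split; lra.
have Vk0 k : (K0 <= k)%N -> u (rV_cons (s0, y)) = V k s0.
  move=> Kk; apply: Vs0 => i; have [j ->|->] := unliftP ord0 i.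
    by rewrite rV_cons_lift; exact: yK.
  by rewrite rV_cons_ord0; have /andP[-> /ltW ->] := s0w k.
have agree k k' (s : R) : (K0 <= k)%N -> (K0 <= k')%N -> - k.+1%:R < s < k.+1%:R ->
    - k'.+1%:R < s < k'.+1%:R -> V k s = V k' s.
  move=> Kk Kk' /andP[sl sr] /andP[sl' sr'].
  have /andP[tl tr] := s0w k; have /andP[tl' tr'] := s0w k'.
  have E : V k s0 = V k' s0 by rewrite -!Vk0.
  have [ss0|/ltW s0s] := leP s s0.
    have := (VE k _ _ Kk sl ss0 (ltW tr)).2; have := (VE k' _ _ Kk' sl' ss0 (ltW tr')).2.
    by rewrite E => <- /addrI /oppr_inj.
  have := (VE k _ _ Kk tl s0s (ltW sr)).2; have := (VE k' _ _ Kk' tl' s0s (ltW sr')).2.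
  by rewrite E => <- /addIr.
pose k_ (s : R) := maxn K0 (Num.truncn `|s|).
have kK s : (K0 <= k_ s)%N by rewrite leq_maxl.
have inw s k : (k_ s <= k)%N -> - k.+1%:R < s < k.+1%:R.
  move=> sk; rewrite -ltr_norml (lt_le_trans (truncnS_gt _))// ler_nat ltnS.
  by rewrite (leq_trans _ sk)// leq_maxr.
exists (fun s => V (k_ s) s).
  move=> s s' ss'; pose k := maxn (k_ s) (k_ s').
  have sk : (k_ s <= k)%N by rewrite leq_maxl.
  have s'k : (k_ s' <= k)%N by rewrite leq_maxr.
  have Kk : (K0 <= k)%N by rewrite (leq_trans (kK s)).
  rewrite (agree (k_ s) k)//; [|exact: inw|exact: inw].
  rewrite (agree (k_ s') k)//; [|exact: inw|exact: inw].
  have /andP[? _] := inw s k sk; have /andP[_ /ltW ?] := inw s' k s'k.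
  exact: VE.
apply: filterS Wy => t Wt; apply: Wt => i; have [j ->|->] := unliftP ord0 i.
  by rewrite rV_cons_lift; exact: yK.
by rewrite rV_cons_ord0; have /andP[-> /ltW ->] := inw t _ (leqnn (k_ t)).
Qed.

End absolutely_continuous_slices.

(** * Lipschitz images of null sets *)

Section lipschitz_null.
Context {R : realType}.
Local Notation la := (@lebesgue_measure R).

(** Cover B by intervals of total length less than e / 2. A 1-Lipschitz map
    sends an interval of length l into one of length 2 l around the image of
    the midpoint. *)
Lemma null_lipschitz_image (phi : R -> R) (B : set R) (e : R) :
  (forall x y, `|phi x - phi y| <= `|x - y|) -> la.-negligible B -> 0 < e ->
  exists G : set R, [/\ measurable (G : set (measurableTypeR R)), phi @` B `<=` G & (la G <= e%:E)%E].
Proof.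
move=> lip [Z [mZ Z0 BZ]] e0.
have [z [/= M' [mM' ZM'] Mz ze]] : exists2 z,
    [set (\sum_(k <oo) wlength idfun (A k))%E | A in measurable_cover (Z : set (ocitv_type R))] z &
    (z < (e / 2)%:E)%E.
  have : (la Z < (e / 2)%:E)%E by rewrite Z0 lte_fin divr_gt0.
  by move=> /ereal_inf_lt[z ? ?]; exists z.
have /choice[G HG] : forall k, exists G : set R, [/\ measurable (G : set (measurableTypeR R)),
    phi @` (M' k) `<=` G & (la G <= 2%:E * wlength idfun (M' k))%E].
  move=> k; have /ocitvP[->|[[a b] /= ab ->]] := mM' k.
    by exists set0; split => //; [rewrite image_set0|rewrite measure0 wlength0 mule0].
  pose m := (a + b) / 2.
  exists `[phi m - (b - a), phi m + (b - a)]%classic; split => //.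
    move=> _ [t /=] + <-; rewrite !in_itv/= => /andP[at_ tb].
    have tm : `|t - m| <= b - a by rewrite ler_norml /m; apply/andP; split; lra.
    by have := le_trans (lip t m) tm; rewrite ler_norml => /andP[? ?]; apply/andP; split; lra.
  rewrite (@lebesgue_measure_itv R `[_, _]) /= lte_fin ifT; last by lra.
  by rewrite wlength_itv_bnd ?(ltW ab)//= -EFinD -EFinM lee_fin; lra.
exists (\bigcup_k G k); split.
- by apply: bigcup_measurable => k _; have [] := HG k.
- move=> _ [t Bt <-]; have [k _ Mt] := ZM' t (BZ t Bt); exists k => //.
  by have [_ + _] := HG k; apply; exists t.
- have mG k : measurable (G k : set (measurableTypeR R)) by have [] := HG k.
  have S := @measure_sigma_subadditive _ _ _ la (\bigcup_k G k) G mG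
    (bigcupT_measurable _ mG) (@subset_refl _ _).
  apply: (le_trans S).
  apply: (@le_trans _ _ (\sum_(k <oo) (2%:E * wlength idfun (M' k)))%E).
    by apply: lee_nneseries => // k _; have [] := HG k.
  rewrite nneseriesZl//.
  by rewrite Mz (le_trans (lee_wpmul2l _ (ltW ze)))// -EFinM lee_fin; lra.
Qed.

(** Each image has outer measure at most a third of b - a. *)
Lemma null_lipschitz_cover (phi phi' : R -> R) (B B' : set R) (a b : R) :
  (forall x y, `|phi x - phi y| <= `|x - y|) ->
  (forall x y, `|phi' x - phi' y| <= `|x - y|) ->
  la.-negligible B -> la.-negligible B' -> a < b ->
  ~ (`]a, b[%classic `<=` phi @` B `|` phi' @` B').
Proof.
move=> lip lip' nB nB' ab sub.
have e0 : 0 < (b - a) / 3 by rewrite divr_gt0 ?subr_gt0.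
have [G [mG BG lG]] := null_lipschitz_image lip nB e0.
have [G' [mG' BG' lG']] := null_lipschitz_image lip' nB' e0.
have : (la `]a, b[%classic <= la (G `|` G'))%E.
  apply: le_measure; rewrite ?inE//; first exact: measurableU.
  by move=> t /sub[/BG|/BG']; [left|right].
have : (la (G `|` G') <= la G + la G')%E by apply: measureU2.
rewrite (@lebesgue_measure_itv R `]_, _[) /= lte_fin ab -EFinD.
move=> /[swap] /le_trans /[apply] /le_trans /(_ (leeD lG lG')).
by rewrite -EFinD lee_fin; lra.
Qed.

(** V and V' represent the same U through phi and phi'. If they differed at
    r0, then V (psi r) and V' (psi' r) would differ for all r near r0, so each
    such r would be the image under phi or phi' of a point where the
    representation fails; but an interval is not covered by Lipschitz images
    of two null sets. *)
Lemma continuous_rep_unique (U V V' phi phi' psi psi' : R -> R) (r0 e : R) :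
  (forall x y, `|phi x - phi y| <= `|x - y|) ->
  (forall x y, `|phi' x - phi' y| <= `|x - y|) ->
  {ae la, forall t, V t = U (phi t)} -> {ae la, forall t, V' t = U (phi' t)} ->
  continuous V -> continuous V' -> 0 < e ->
  (forall r, `|r - r0| < e -> phi (psi r) = r /\ phi' (psi' r) = r) ->
  {for r0, continuous psi} -> {for r0, continuous psi'} ->
  V (psi r0) = V' (psi' r0).
Proof.
move=> lip lip' UV UV' cV cV' e0 psiK cpsi cpsi'.
apply/eqP; apply: contrapT => /negP ne.
pose f r := V (psi r) - V' (psi' r).
have cf : f x @[x --> r0] --> f r0.
  apply: cvgB.
    by apply: (@continuous_comp _ _ _ psi V) => //; exact: cV.
  by apply: (@continuous_comp _ _ _ psi' V') => //; exact: cV'.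
have fr0 : 0 < `|f r0| by rewrite normr_gt0 subr_eq0.
have : \forall r \near r0, f r != 0.
  move/cvgrPdist_lt : (cf) => /(_ _ fr0); apply: filterS => r; rewrite /=.
  by apply: contraTneq => ->; rewrite subr0 ltxx.
move=> /nbhs_ballP[d /= d0 Hd].
pose m := Num.min d e; have m0 : 0 < m by rewrite lt_min d0.
apply: (@null_lipschitz_cover phi phi' _ _ (r0 - m) (r0 + m) lip lip' UV UV'); first lra.
move=> r /=; rewrite in_itv/= => /andP[r1 r2].
have : `|r - r0| < m by rewrite ltr_norml; apply/andP; split; lra.
rewrite lt_min => /andP[rd re].
have [K K'] := psiK r re.
have fr : f r != 0 by apply: Hd; rewrite /ball/= distrC.
have [E|E] := pselect (V (psi r) = U (phi (psi r))); last by left; exists (psi r).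
right; exists (psi' r) => //= E'; move/eqP: fr; apply.
by rewrite /f E E' K K' subrr.
Qed.

End lipschitz_null.

Section slice_primitive_facts.
Context {R : realType}.
Local Notation la := (@lebesgue_measure R).

Lemma slice_primitive_continuous (h V : R -> R) : slice_primitive h V -> continuous V.
Proof.
move=> HV x.
pose a := x - 1; pose b := x + 1.
have ab : a <= b by rewrite /a /b; lra.
have ih : la.-integrable `[a, b] (EFin \o h).
  have [i _] : la.-integrable (`[a, (b + 1)[%classic : set (measurableTypeR R)) (EFin \o h) /\
      V (b + 1) - V a = \int[la]_(t in `[a, (b + 1)[) h t by apply: HV; lra.
  apply: integrableS i => //; apply: subset_itvl; rewrite bnd_simp; lra.
have := parameterized_integral_continuous ab ih.
move=> /continuous_within_itvP [].
  by rewrite /a /b; lra.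
move=> H _ _.
have xI : x \in `]a, b[ by rewrite in_itv/= /a /b; apply/andP; split; lra.
have := H x xI.
rewrite /continuous_at => Hx.
have : V a + parameterized_integral la a y h @[y --> x] --> V a + parameterized_integral la a x h.
  by apply: cvgD => //; exact: cvg_cst.
have VE y : a <= y -> V a + parameterized_integral la a y h = V y.
  move=> ay; have [i E] := HV a y ay.
  by rewrite /parameterized_integral -Rintegral_itv_bndo_bndc// -E addrC subrK.
rewrite VE; last by rewrite /a; lra.
apply: cvg_trans; apply: near_eq_cvg; near=> y; rewrite VE//.
near: y; apply: lt_le_nbhsr; rewrite /a; lra.
Unshelve. all: by end_near. Qed.
End slice_primitive_facts.

Section sqrt_facts.
Context {R : realType}.

Lemma lipschitz_hypot (c : R) : 0 <= c -> forall x y,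
  `|Num.sqrt (x ^+ 2 + c) - Num.sqrt (y ^+ 2 + c)| <= `|x - y|.
Proof.
move=> c0 x y; set A := Num.sqrt _; set B := Num.sqrt _.
have A0 : 0 <= A by exact: sqrtr_ge0.
have B0 : 0 <= B by exact: sqrtr_ge0.
have AE : A ^+ 2 = x ^+ 2 + c by rewrite sqr_sqrtr// addr_ge0// sqr_ge0.
have BE : B ^+ 2 = y ^+ 2 + c by rewrite sqr_sqrtr// addr_ge0// sqr_ge0.
have xA : `|x| <= A by rewrite -sqrtr_sqr ler_wsqrtr// lerDl.
have yB : `|y| <= B by rewrite -sqrtr_sqr ler_wsqrtr// lerDl.
have [AB0|AB] := eqVneq (A + B) 0.
  have -> : A = 0 by apply/eqP; move/eqP: AB0; rewrite paddr_eq0// => /andP[].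
  have -> : B = 0 by apply/eqP; move/eqP: AB0; rewrite paddr_eq0// => /andP[].
  by rewrite subrr normr0.
have AB' : 0 < A + B by rewrite lt_neqAle eq_sym AB addr_ge0.
rewrite -(ler_pM2r AB') -{1}(gtr0_norm AB') -normrM -subr_sqr AE BE.
rewrite (_ : _ - _ = (x - y) * (x + y)); last by ring.
by rewrite normrM ler_wpM2l// (le_trans (ler_normD _ _))// lerD.
Qed.

Lemma hypot_subK (c r : R) : 0 <= c -> 0 <= r -> c <= r ^+ 2 ->
  Num.sqrt (Num.sqrt (r ^+ 2 - c) ^+ 2 + c) = r.
Proof.
move=> c0 r0 cr; rewrite sqr_sqrtr ?subr_ge0// subrK sqrtr_sqr ger0_norm//.
Qed.

Lemma continuous_hypot_sub (c : R) : continuous (fun r : R => Num.sqrt (r ^+ 2 - c)).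
Proof.
move=> r; apply: (@continuous_comp _ _ _ (fun r : R => r ^+ 2 - c) Num.sqrt).
  by apply: cvgB; [exact: exprn_continuous|exact: cvg_cst].
exact: sqrt_continuous.
Qed.

End sqrt_facts.

(** * The radial profile *)

Section Rintegral_norm.
Context d (T : measurableType d) (R : realType) (mu : {measure set T -> \bar R}).

Lemma normr_Rintegral_le (A : set T) (f : T -> R) : measurable A ->
  mu.-integrable A (EFin \o f) ->
  (`|\int[mu]_(x in A) f x|%:E <= \int[mu]_(x in A) `|f x|%:E)%E.
Proof.
move=> mA iF; rewrite /Rintegral -[X in (X <= _)%E]/(`|(fine _)%:E|)%E fineK.
  by apply: le_abse_integral => //; exact: measurable_int iF.
exact: integrable_fin_num.
Qed.

End Rintegral_norm.

Section radial_profile.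
Context {R : realType} {n : nat}.
Local Notation la := (@lebesgue_measure R).
Local Notation nu := (@rV_lebesgue R n).
Local Notation mu := (@rV_lebesgue R n.+1).
Variables (p : R) (u : 'rV[R]_n.+1 -> R) (g : 'rV[R]_n.+1 -> 'rV[R]_n.+1) (U : R -> R).
Hypotheses (p1 : 1 < p) (up : Lp p u) (gp : Lp_gradient p u g).
Hypothesis uU : {ae mu, forall x, u x = U (enorm x)}.

Definition sqn (y : 'rV[R]_n) : R := \sum_j y ord0 j ^+ 2.

Lemma sqn_ge0 y : 0 <= sqn y.
Proof. by rewrite sumr_ge0// => j _; exact: sqr_ge0. Qed.

Lemma enorm_cons t y : enorm (rV_cons (t, y)) = Num.sqrt (t ^+ 2 + sqn y).
Proof.
rewrite /enorm big_ord_recl rV_cons_ord0; congr (Num.sqrt (_ + _)).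
by apply: eq_bigr => j _; rewrite rV_cons_lift.
Qed.

Definition good_slice (y : 'rV[R]_n) (V : R -> R) :=
  slice_primitive (fun t => g (rV_cons (t, y)) ord0 ord0) V /\
  {ae la, forall t, u (rV_cons (t, y)) = V t /\ V t = U (enorm (rV_cons (t, y)))}.

Lemma good_slice_ae : {ae nu, forall y, exists V, good_slice y V}.
Proof.
move: (ac_slices (ltW p1) up gp) (ae_rV_cons uU); apply: filterS2 => y [V HV uV] uUy.
exists V; split => //; move: uV uUy; apply: filterS2 => t Vt Ut.
by rewrite -Vt.
Qed.

(** The value, at distance r from the origin, of the representative on a good
    line that meets the sphere of radius r; [profileP] shows that the choice
    of the line is immaterial. *)
Definition profile (r : R) : R := xget 0 [set v | exists y V,
  [/\ good_slice y V, sqn y < r ^+ 2 & v = V (Num.sqrt (r ^+ 2 - sqn y))]].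

(** On the good line through y, u is represented by V and equals U composed
    with t |-> sqrt (t ^ 2 + |y| ^ 2). This map is 1-Lipschitz and, away from
    t = 0, locally invertible, so [continuous_rep_unique] compares V with the
    representative on any other good line. *)
Lemma profileP y V t : good_slice y V -> t != 0 ->
  V t = profile (Num.sqrt (t ^+ 2 + sqn y)).
Proof.
move=> yV t0; set r := Num.sqrt _.
have tt : 0 < t ^+ 2 by rewrite lt_neqAle eq_sym sqrf_eq0 t0 sqr_ge0.
have r2 : r ^+ 2 = t ^+ 2 + sqn y by rewrite sqr_sqrtr// addr_ge0 ?sqn_ge0// ltW.
have r0 : 0 < r by rewrite sqrtr_gt0 ltr_wpDr// sqn_ge0.
have yr : sqn y < r ^+ 2 by rewrite r2 ltrDr.
have : [set v | exists y V, [/\ good_slice y V, sqn y < r ^+ 2 &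
    v = V (Num.sqrt (r ^+ 2 - sqn y))]] (profile r).
  apply: xgetPex; exists (V (Num.sqrt (r ^+ 2 - sqn y))).
  by exists y, V.
move=> [y' [V' [y'V' y'r ->]]].
pose psi (r : R) := Num.sg t * Num.sqrt (r ^+ 2 - sqn y).
have -> : t = psi r.
  by rewrite /psi r2 addrK sqrtr_sqr -numEsg.
pose phi c (t : R) := Num.sqrt (t ^+ 2 + c).
have rlt z : sqn z < r ^+ 2 -> Num.sqrt (sqn z) < r.
  move=> zr; rewrite -(ger0_norm (ltW r0)) -sqrtr_sqr ltr_sqrt//.
  by rewrite (le_lt_trans (sqn_ge0 z)).
pose e := r - Num.max (Num.sqrt (sqn y)) (Num.sqrt (sqn y')).
have e0 : 0 < e by rewrite subr_gt0 gt_max !rlt.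
have ge (z r' : R) : 0 <= z -> Num.sqrt z < r' -> 0 <= r' /\ z <= r' ^+ 2.
  move=> z0 zr; have r'0 : 0 <= r' by rewrite (le_trans (sqrtr_ge0 z))// ltW.
  by split => //; rewrite -(sqr_sqrtr z0) ler_sqr ?nnegrE ?sqrtr_ge0// ltW.
have sg2 : Num.sg t ^+ 2 = 1 by rewrite sqr_sg t0.
apply: (@continuous_rep_unique R U V V' (phi (sqn y)) (phi (sqn y')) psi
  (fun r => Num.sqrt (r ^+ 2 - sqn y')) r e).
- exact: lipschitz_hypot (sqn_ge0 y).
- exact: lipschitz_hypot (sqn_ge0 y').
- by have [_] := yV; apply: filterS => t' [_ ->]; rewrite enorm_cons.
- by have [_] := y'V'; apply: filterS => t' [_ ->]; rewrite enorm_cons.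
- exact: slice_primitive_continuous yV.1.
- exact: slice_primitive_continuous y'V'.1.
- exact: e0.
- move=> r' r're; have : Num.max (Num.sqrt (sqn y)) (Num.sqrt (sqn y')) < r'.
    by move: r're; rewrite ltr_norml /e => /andP[]; lra.
  rewrite gt_max => /andP[/(ge _ _ (sqn_ge0 y))[r'0 yr'] /(ge _ _ (sqn_ge0 y'))[_ y'r']].
  rewrite /phi /psi exprMn sg2 mul1r.
  by rewrite !hypot_subK// sqn_ge0.
- by apply: cvgMl_tmp; exact: continuous_hypot_sub.
- exact: continuous_hypot_sub.
Qed.

Lemma measurable_enorm : measurable_fun setT (@enorm R n.+1).
Proof.
apply: (measurableT_comp (continuous_measurable_fun (@sqrt_continuous R))).
apply: measurable_sum => i; apply: measurable_funX; exact: measurable_rV_coord.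
Qed.

(** The part with t > 0 of s <= |x| < r above a cube of side e in the
    hyperplane t = 0. If the cube lies in the ball of radius s, then a line
    through it crosses the shell along one interval, from |x| = s to |x| = r. *)
Definition shell (s r e : R) : set 'rV[R]_n.+1 :=
  [set x : 'rV[R]_n.+1 | [/\ 0 < x ord0 ord0, s <= enorm x < r & box (fun=> 0) (fun=> e) (rV_tail x)]].

Lemma measurable_shell s r e : measurable (shell s r e).
Proof.
rewrite (_ : shell s r e = (rV_coord ord0 @^-1` `]0, +oo[%classic) `&`
   ((@enorm R n.+1 @^-1` `[s, r[%classic) `&` (rV_tail @^-1` box (fun=> 0) (fun=> e)))).
  apply: measurableI.
    by rewrite -[X in measurable X]setTI; apply: measurable_rV_coord.
  apply: measurableI.
    by rewrite -[X in measurable X]setTI; apply: measurable_enorm.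
  rewrite -[X in measurable X]setTI; apply: measurable_rV_tail => //.
  exact: measurable_rV_box.
by apply/seteqP; split => x; rewrite /shell /= !in_itv/= ?andbT; [move=> [? ? ?]|move=> [? [? ?]]].
Qed.

Lemma shell_cons s r e t y : 0 < s -> s <= r -> sqn y < s ^+ 2 -> box (fun=> 0) (fun=> e) y ->
  shell s r e (rV_cons (t, y)) <->
  Num.sqrt (s ^+ 2 - sqn y) <= t < Num.sqrt (r ^+ 2 - sqn y).
Proof.
move=> s0 sr ys yb; have r0 : 0 < r by rewrite (lt_le_trans s0).
have yr : sqn y < r ^+ 2 by rewrite (lt_le_trans ys)// ler_sqr ?nnegrE ?(ltW s0) ?(ltW r0).
rewrite /shell /= rV_cons_ord0 enorm_cons rV_tail_cons.
have key z : 0 < z -> sqn y < z ^+ 2 -> 0 < t ->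
    (z <= Num.sqrt (t ^+ 2 + sqn y)) = (Num.sqrt (z ^+ 2 - sqn y) <= t).
  move=> z0 yz t0.
  rewrite -{1}(ger0_norm (ltW z0)) -sqrtr_sqr -{2}(ger0_norm (ltW t0)) -[in RHS]sqrtr_sqr.
  by rewrite !ler_sqrt ?sqr_ge0// ?addr_ge0 ?sqr_ge0 ?sqn_ge0// lerBlDr.
split=> [[t0 /andP[st tr] _]|/andP[st tr]].
  by rewrite -key// st ltNge -key// -ltNge.
have t0 : 0 < t by rewrite (lt_le_trans _ st)// sqrtr_gt0 subr_gt0.
by split=> //; rewrite key// st ltNge key// -ltNge.
Qed.


(** On almost every line through the cube, the increment of the profile is the
    integral of the first component of g along the crossing of the shell;
    integrate over the cube, of measure e ^ n. *)
Lemma profile_diff_le s r e : 0 < s -> s <= r -> 0 < e ->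
  (forall y, box (fun=> 0) (fun=> e) y -> sqn y < s ^+ 2) ->
  ((`|profile r - profile s| * e ^+ n)%:E <=
    \int[mu]_x (`|g x ord0 ord0| * \1_(shell s r e) x)%:E)%E.
Proof.
move=> s0 sr e0 Qs; have r0 : 0 < r by rewrite (lt_le_trans s0).
set Q := box (fun=> 0) (fun=> e) in Qs *.
have mQ : measurable Q by exact: measurable_rV_box.
have nuQ : (nu Q = (e ^+ n)%:E)%E.
  rewrite rV_lebesgue_box => [|i]; last exact: ltW.
  by under eq_bigr do rewrite subr0; rewrite prodr_const card_ord.
have mg : measurable_fun setT (fun x => g x ord0 ord0).
  by move/sub_Lfun_mfun : (gp.1 ord0); rewrite inE.
pose F (x : 'rV[R]_n.+1) := (`|g x ord0 ord0| * \1_(shell s r e) x)%:E.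
have mF : measurable_fun setT F.
  apply/measurable_EFinP; apply: measurable_funM; first exact: measurableT_comp.
  by apply: measurable_indic; exact: measurable_shell.
have F0 x : (0 <= F x)%E by rewrite lee_fin mulr_ge0.
have mFc : measurable_fun setT (fun z => F (rV_cons z)) by exact: measurableT_comp measurable_rV_cons.
rewrite ge0_integral_rV_cons// fubini_tonelli2//.
apply: (@le_trans _ _ (\int[nu]_y (`|profile r - profile s| * \1_Q y)%:E)%E).
  under eq_integral do rewrite EFinM.
  rewrite ge0_integralZl//.
  - by rewrite integral_indic// setIT [X in (_ * X)%E]nuQ.
  - by apply/measurable_EFinP; exact: measurable_indic.
apply: ae_ge0_le_integral => //.
- by apply/measurable_EFinP; apply: measurable_funM => //; exact: measurable_indic.
- by move=> y _; apply: integral_ge0 => t _; exact: F0.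
- exact: (measurable_fun_fubini_tonelli_G (m1 := la) _ mFc).
apply: filterS good_slice_ae => y [V yV] _.
have [yQ|yQ] := pselect (Q y); last first.
  by rewrite indicE memNset// mulr0; apply: integral_ge0.
rewrite indicE mem_set// mulr1.
have ys := Qs y yQ.
have yr : sqn y < r ^+ 2 by rewrite (lt_le_trans ys)// ler_sqr ?nnegrE ?(ltW s0) ?(ltW r0).
set ts := Num.sqrt (s ^+ 2 - sqn y); set tr := Num.sqrt (r ^+ 2 - sqn y).
have ts0 : 0 < ts by rewrite sqrtr_gt0 subr_gt0.
have tr0 : 0 < tr by rewrite sqrtr_gt0 subr_gt0.
have tsr : ts <= tr by rewrite ler_wsqrtr// lerB// ler_sqr ?nnegrE ?(ltW s0) ?(ltW r0).
have pE z : 0 < z -> sqn y < z ^+ 2 -> profile z = V (Num.sqrt (z ^+ 2 - sqn y)).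
  move=> z0 yz; rewrite (profileP yV); last by rewrite gt_eqF// sqrtr_gt0 subr_gt0.
  by rewrite hypot_subK ?sqn_ge0// ltW.
rewrite !pE// -/ts -/tr; have [iV ->] := yV.1 _ _ tsr.
have mI : measurable (`[ts, tr[%classic : set (measurableTypeR R)) by exact: measurable_itv.
apply: (le_trans (normr_Rintegral_le mI iV)).
rewrite integral_mkcond; apply: ge0_le_integral => //.
- by move=> t _; rewrite patchE; case: ifP.
- apply: (iffLR (measurable_restrictT _ mI)).
  have mh : measurable_fun (`[ts, tr[%classic : set (measurableTypeR R))
      (fun t : measurableTypeR R => g (rV_cons (t, y)) ord0 ord0).
    by apply/measurable_EFinP; exact: measurable_int iV.
  by apply/measurable_EFinP; exact: measurableT_comp mh.
- exact: (measurable_fun_pair1 y mFc).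
move=> t _; rewrite patchE; case: ifPn => [tt|_]; last exact: F0.
rewrite /F indicE mem_set ?mulr1//.
by apply/shell_cons => //; move: tt; rewrite inE/= in_itv.
Qed.

(** The line through y crosses the shell along the length sqrt (r ^ 2 - |y| ^
    2) - sqrt (s ^ 2 - |y| ^ 2), which is (r - s) (r + s) divided by the sum
    of the roots. As r + s <= 3 s and each root is at least s / 2, it is at
    most 3 (r - s). *)
Lemma measure_shell_le s r e : 0 < s -> s <= r -> r <= 2 * s -> 0 < e ->
  (forall y, box (fun=> 0) (fun=> e) y -> sqn y <= s ^+ 2 / 4) ->
  (mu (shell s r e) <= (3 * (r - s) * e ^+ n)%:E)%E.
Proof.
move=> s0 sr r2s e0 Qs; have r0 : 0 < r by rewrite (lt_le_trans s0).
set Q := box (fun=> 0) (fun=> e) in Qs *.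
have mQ : measurable Q by exact: measurable_rV_box.
have nuQ : (nu Q = (e ^+ n)%:E)%E.
  rewrite rV_lebesgue_box => [|i]; last exact: ltW.
  by under eq_bigr do rewrite subr0; rewrite prodr_const card_ord.
have mS := measurable_shell s r e.
rewrite -[X in mu X]setIT -integral_indic//.
have mF : measurable_fun setT (fun x : 'rV[R]_n.+1 => (\1_(shell s r e) x : R)%:E).
  by apply/measurable_EFinP; exact: measurable_indic.
have mFc : measurable_fun setT (fun z : measurableTypeR R * 'rV[R]_n => (\1_(shell s r e) (rV_cons z) : R)%:E).
  exact: (measurableT_comp mF measurable_rV_cons).
rewrite ge0_integral_rV_cons// fubini_tonelli2//.
apply: (@le_trans _ _ (\int[nu]_y (3 * (r - s) * \1_Q y)%:E)%E); last first.
  under eq_integral do rewrite EFinM.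
  rewrite ge0_integralZl//.
  - by rewrite integral_indic// setIT [X in (_ * X)%E]nuQ.
  - by apply/measurable_EFinP; exact: measurable_indic.
  - by rewrite lee_fin mulr_ge0// subr_ge0.
apply: ge0_le_integral => //.
- by move=> y _; apply: integral_ge0.
- exact: (measurable_fun_fubini_tonelli_G (m1 := la) _ mFc).
- by apply/measurable_EFinP; apply: measurable_funM => //; exact: measurable_indic.
move=> y _; rewrite /fubini_G.
have [yQ|yQ] := pselect (Q y); last first.
  rewrite integral0_eq ?lee_fin ?mulr_ge0 ?subr_ge0// => t _.
  by rewrite indicE memNset// => -[_ _]; rewrite rV_tail_cons.
rewrite [X in (_ <= X%:E)%E]mulrC indicE mem_set// mul1r.
have ys4 := Qs y yQ.
have s2 : 0 < s ^+ 2 by rewrite exprn_gt0.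
have ys : sqn y < s ^+ 2 by move: ys4 s2; move: (s ^+ 2) => z *; lra.
set ts := Num.sqrt (s ^+ 2 - sqn y); set tr := Num.sqrt (r ^+ 2 - sqn y).
have yr : sqn y < r ^+ 2 by rewrite (lt_le_trans ys)// ler_sqr ?nnegrE ?(ltW s0) ?(ltW r0).
have tsr : ts <= tr by rewrite ler_wsqrtr// lerB// ler_sqr ?nnegrE ?(ltW s0) ?(ltW r0).
rewrite (eq_integral (fun t : measurableTypeR R => (\1_(`[ts, tr[%classic) t)%:E)); last first.
  move=> t _; rewrite !indicE; congr ((nat_of_bool _)%:R%:E).
  by apply/idP/idP; rewrite !inE /= in_itv /= => /shell_cons; apply.
rewrite integral_indic// setIT.
rewrite [X in (X <= _)%E](@lebesgue_measure_itv R `[ts, tr[) /= lte_fin.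
have rs0 : 0 <= 3 * (r - s) by rewrite mulr_ge0// subr_ge0.
case: ifP => [_|_]; last by rewrite lee_fin.
rewrite -EFinD lee_fin -(ler_pM2r s0).
have tsE : ts ^+ 2 = s ^+ 2 - sqn y by rewrite sqr_sqrtr// subr_ge0 ltW.
have trE : tr ^+ 2 = r ^+ 2 - sqn y by rewrite sqr_sqrtr// subr_ge0 ltW.
have s_ts : s / 2 <= ts.
  rewrite -(@ger0_norm _ (s / 2)) ?divr_ge0 ?(ltW s0)// -sqrtr_sqr ler_wsqrtr//.
  by rewrite expr_div_n; move: ys4 s2; move: (s ^+ 2) => z *; lra.
apply: (@le_trans _ _ ((tr - ts) * (tr + ts))).
  by rewrite ler_wpM2l ?subr_ge0//; lra.
rewrite -subr_sqr trE tsE (_ : _ - _ = (r - s) * (r + s)); last by ring.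
rewrite mulrAC mulrC ler_wpM2r ?subr_ge0//; lra.
Qed.

(** Hoelder's inequality on the shell, from [profile_diff_le] and
    [measure_shell_le]. *)
Lemma profile_holder (G s r e : R) : 0 < s -> s <= r -> r <= 2 * s -> 0 < e ->
  (forall y, box (fun=> 0) (fun=> e) y -> sqn y <= s ^+ 2 / 4) ->
  ('N[mu]_p%:E[EFin \o (fun x => g x ord0 ord0)] <= G%:E)%E ->
  `|profile r - profile s| <= G * (3 * (r - s)) `^ (1 - p^-1) * (e ^+ n) `^ (- p^-1).
Proof.
move=> s0 sr r2s e0 Qs GN.
have p0 : 0 < p by rewrite (lt_trans ltr01).
set q' := (1 - p^-1)^-1.
have pV : p^-1 < 1 by rewrite invf_lt1.
have q'0 : 0 < q' by rewrite invr_gt0 subr_gt0.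
have pq : p^-1 + q'^-1 = 1 by rewrite invrK addrC subrK.
have s2 : 0 < s ^+ 2 by rewrite exprn_gt0.
have Qs' y : box (fun=> 0) (fun=> e) y -> sqn y < s ^+ 2.
  by move=> /Qs; move: s2; move: (s ^+ 2) => z *; lra.
have mS := measurable_shell s r e.
have mg : measurable_fun setT (fun x => g x ord0 ord0).
  by move/sub_Lfun_mfun : (gp.1 ord0); rewrite inE.
have G0 : 0 <= G by rewrite -lee_fin (le_trans _ GN)// Lnorm_ge0.
have mI : measurable_fun setT (\1_(shell s r e) : 'rV[R]_n.+1 -> R) by exact: measurable_indic.
have E0 : 0 < e ^+ n by rewrite exprn_gt0.
have rs0 : 0 <= 3 * (r - s) by rewrite mulr_ge0// subr_ge0.
have H : ((`|profile r - profile s| * e ^+ n)%:E <=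
    G%:E * ((3 * (r - s) * e ^+ n) `^ (1 - p^-1))%:E)%E.
  apply: (le_trans (profile_diff_le s0 sr e0 Qs')).
  have := hoelder mu (f := fun x => g x ord0 ord0) (g := \1_(shell s r e)) mg mI p0 q'0 pq.
  rewrite Lnorm1 (eq_integral (fun x => (`|g x ord0 ord0| * \1_(shell s r e) x)%:E)); last first.
    by move=> x _; rewrite /= normrM [`|\1_ _ _|]ger0_norm.
  move=> /le_trans; apply.
  rewrite lee_pmul ?Lnorm_ge0//.
  rewrite unlock /= /q' invrK.
  rewrite (eq_integral (fun x => (\1_(shell s r e) x)%:E)); last first.
    move=> x _; rewrite /= indicE; case: (_ \in _); rewrite ?normr1 ?normr0 /=.
      by rewrite powR1.
    by rewrite powR0// gt_eqF.
  rewrite integral_indic// setIT.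
  have := measure_shell_le s0 sr r2s e0 Qs.
  move=> H; rewrite -poweR_EFin; apply: gt0_ler_poweR => //.
  - by rewrite subr_ge0 ltW.
  - by rewrite in_itv/= measure_ge0 leey.
  - by rewrite in_itv/= leey lee_fin mulr_ge0 ?(ltW E0).
move: H; rewrite -EFinM lee_fin powRM ?(ltW E0)//.
rewrite -ler_pdivlMr// => /le_trans; apply.
rewrite -!mulrA !ler_wpM2l ?powR_ge0//.
rewrite powRB ?gt_eqF ?implybT// powRr1 ?(ltW E0)//.
by rewrite mulrAC mulfV ?gt_eqF// mul1r powRN.
Qed.

End radial_profile.

(** * Decay from dyadic increments *)

Section cvg_powR.
Context {R : realType}.

Lemma cvg_normr_powR0 {T : Type} (F : set_system T) {FF : Filter F} (f : T -> R) (b : R) :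
  0 < b -> f x @[x --> F] --> 0 -> `|f x| `^ b @[x --> F] --> 0.
Proof.
move=> b0 /cvgrPdist_lt f0; apply/cvgrPdist_lt => e e0.
have d0 : 0 < e `^ b^-1 by rewrite powR_gt0.
move: (f0 _ d0); apply: filterS => t; rewrite !sub0r !normrN => td.
rewrite [ltLHS]ger0_norm ?powR_ge0//.
have -> : e = (e `^ b^-1) `^ b by rewrite -powRrM mulVf ?powRr1 ?(ltW e0)// gt_eqF.
by rewrite gt0_ltr_powR// nnegrE ?powR_ge0.
Qed.

Lemma cvg_normr_powR {T : Type} (F : set_system T) {FF : Filter F} (f : T -> R) (b a : R) :
  0 < b -> f x @[x --> F] --> a -> `|f x| `^ b @[x --> F] --> `|a| `^ b.
Proof.
move=> b0 fa; have [a0|a0] := eqVneq a 0.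
  by rewrite a0 normr0 powR0 ?gt_eqF//; apply: cvg_normr_powR0; rewrite // -a0.
have na : `|a| \in `]0, +oo[ by rewrite in_itv/= andbT normr_gt0.
apply: (@cvg_comp _ _ _ (fun x => `|f x|) (@powR R ^~ b) F (nbhs `|a|)); first exact: cvg_norm.
have /derivable1_diffP/differentiable_continuous : derivable (@powR R ^~ b) `|a| 1 by exact: derivable_powR.
exact.
Qed.

End cvg_powR.

Section decay.
Context {R : realType}.
Variables (n : nat) (p G : R) (W : R -> R).
Hypotheses (p1 : 1 < p) (pn : p < n.+1%:R) (G0 : 0 <= G).

(** This is (N - p) / p for N = n + 1. *)
Definition decay_exp : R := n.+1%:R / p - 1.

(** The bound of [profile_holder] for e = s / (2 N), a choice that keeps the
    cube inside the ball of radius s / 2. *)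
Definition increment_bound (r s : R) : R :=
  G * (3 * (r - s)) `^ (1 - p^-1) * ((s / (2 * n.+1%:R)) ^+ n) `^ (- p^-1).

Hypothesis WH : forall s r, 0 < s -> s <= r -> r <= 2 * s ->
  `|W r - W s| <= increment_bound r s.

Definition dyadic_cst : R := 3 `^ (1 - p^-1) * ((2 * n.+1%:R) ^+ n) `^ p^-1.

Definition decay_cst : R := dyadic_cst / (1 - 2 `^ (- decay_exp)).

Let p0 : 0 < p. Proof. by rewrite (lt_trans ltr01). Qed.

Lemma decay_exp_gt0 : 0 < decay_exp.
Proof. by rewrite /decay_exp subr_gt0 ltr_pdivlMr// mul1r. Qed.

Lemma dyadic_cst_ge0 : 0 <= dyadic_cst.
Proof. by rewrite mulr_ge0 ?powR_ge0. Qed.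

Lemma powR2_lt1 : 2 `^ (- decay_exp) < 1 :> R.
Proof.
rewrite powRN invf_lt1 ?powR_gt0//.
have : 1 `^ decay_exp < 2 `^ decay_exp :> R.
  by rewrite gt0_ltr_powR ?nnegrE ?decay_exp_gt0//; lra.
by rewrite powR1.
Qed.

Lemma decay_cst_ge0 : 0 <= decay_cst.
Proof. by rewrite divr_ge0 ?dyadic_cst_ge0// subr_ge0 ltW// powR2_lt1. Qed.

Lemma increment_dyadic s r : 0 < s -> s <= r -> r <= 2 * s ->
  `|W r - W s| <= dyadic_cst * G * s `^ (- decay_exp).
Proof.
move=> s0 sr r2s; apply: (le_trans (WH s0 sr r2s)).
have pV : p^-1 < 1 by rewrite invf_lt1.
have c0 : 0 < 2 * n.+1%:R :> R by rewrite mulr_gt0// ltr0n.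
have E : ((s / (2 * n.+1%:R)) ^+ n) `^ (- p^-1) = ((2 * n.+1%:R) ^+ n) `^ p^-1 * s `^ (- (n%:R / p)).
  rewrite expr_div_n powRM ?exprn_ge0 ?(ltW s0) ?invr_ge0 ?exprn_ge0 ?(ltW c0)//.
  rewrite mulrC; congr (_ * _).
    have X0 : 0 < (2 * n.+1%:R : R) ^+ n by rewrite exprn_gt0.
    by rewrite -[_ ^- n](powR_inv1 (ltW X0)) -powRrM mulN1r opprK.
  by rewrite -powR_mulrn ?(ltW s0)// -powRrM mulrN.
rewrite /increment_bound E /dyadic_cst.
apply: (@le_trans _ _ (G * (3 * s) `^ (1 - p^-1) * (((2 * n.+1%:R) ^+ n) `^ p^-1 * s `^ (- (n%:R / p))))).
  rewrite ler_wpM2r ?mulr_ge0 ?powR_ge0// ler_wpM2l//.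
  rewrite ge0_ler_powR ?nnegrE ?subr_ge0 ?(ltW pV)//; lra.
rewrite powRM ?(ltW s0)//.
rewrite (_ : - decay_exp = (1 - p^-1) + - (n%:R / p)); last first.
  by rewrite /decay_exp -natr1 mulrDl mul1r; lra.
rewrite [s `^ (_ + - (n%:R / p))]powRD ?(gt_eqF s0) ?implybT//.
by rewrite le_eqVlt; apply/orP; left; apply/eqP; ring.
Qed.

(** Sum the bounds for the increments from s to 2 s, from 2 s to 4 s, and so
    on: they form a geometric series of ratio 2 ^ (- decay_exp) < 1. *)
Lemma increment_decay s r : 0 < s -> s <= r ->
  `|W r - W s| <= decay_cst * G * s `^ (- decay_exp).
Proof.
pose th : R := 2 `^ (- decay_exp).
have th1 : 0 < 1 - th by rewrite subr_gt0 powR2_lt1.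
have K0 := dyadic_cst_ge0.
have step k : forall s r, 0 < s -> s <= r -> r <= 2 ^+ k * s ->
    `|W r - W s| <= decay_cst * G * s `^ (- decay_exp).
  elim: k => [|k IH] {}s {}r s0 sr.
    rewrite expr0 mul1r => rs; have -> : r = s by apply/eqP; rewrite eq_le rs.
    have C0 := decay_cst_ge0; by rewrite subrr normr0 mulr_ge0 ?powR_ge0// mulr_ge0.
  rewrite exprS -mulrA mulrCA => r2.
  have [rs|rs] := leP r (2 * s).
    apply: (le_trans (increment_dyadic s0 sr rs)).
    rewrite ler_wpM2r ?powR_ge0// ler_wpM2r// /decay_cst ler_pdivlMr//.
    by rewrite ler_piMr// gerBl powR_ge0.
  have s20 : 0 < 2 * s by rewrite mulr_gt0.
  have := IH _ _ s20 (ltW rs) r2.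
  have ss : s <= 2 * s by lra.
  have := increment_dyadic s0 ss (lexx _).
  rewrite powRM ?(ltW s0)// -/th.
  rewrite (_ : decay_cst * G * (th * _) = decay_cst * G * s `^ (- decay_exp) - dyadic_cst * G * s `^ (- decay_exp)).
    move=> H1 H2; rewrite (_ : W r - W s = (W r - W (2 * s)) + (W (2 * s) - W s)); last by ring.
    by rewrite (le_trans (ler_normD _ _))//; lra.
  rewrite /decay_cst -/th; by field; apply/eqP => E; move: th1; rewrite E ltxx.
move=> s0 sr.
apply: (step (Num.truncn (r / s)).+1) => //.
rewrite -ler_pdivrMr//; apply: (le_trans (ltW (truncnS_gt _))).
by rewrite -natrX ler_nat ltnW// ltn_expl.
Qed.

End decay.

(** * Strauss's radial lemma *)

Section Lp_tools.
Context d (T : measurableType d) (R : realType) (mu : {measure set T -> \bar R}).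

Lemma poweR_inv_le (x : \bar R) (G r : R) : 0 < r -> 0 <= G -> (0 <= x)%E ->
  (x `^ r^-1 <= G%:E)%E = (x <= (G `^ r)%:E)%E.
Proof.
move=> r0 G0 x0; have rV : 0 < r^-1 by rewrite invr_gt0.
have mem (y : \bar R) : (0 <= y)%E -> y \in `[0, +oo%E] by move=> y0; rewrite in_itv/= y0 leey.
apply/idP/idP => H.
  have := gt0_ler_poweR (ltW r0) (mem _ (poweR_ge0 x r^-1)) (mem _ (_ : (0 <= G%:E)%E)) H.
  by rewrite -poweRrM mulVf ?gt_eqF// poweRe1// poweR_EFin; apply; rewrite lee_fin.
have := gt0_ler_poweR (ltW rV) (mem _ x0) (mem _ (_ : (0 <= (G `^ r)%:E)%E)) H.
rewrite poweR_EFin -powRrM mulfV ?gt_eqF// powRr1//; apply; by rewrite lee_fin powR_ge0.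
Qed.

Lemma LnormE (p : R) (f : T -> R) :
  ('N[mu]_p%:E[EFin \o f] = (\int[mu]_x (`|f x| `^ p)%:E) `^ p^-1)%E.
Proof. by rewrite unlock /=; congr poweR; apply: eq_integral => x _; rewrite poweR_EFin. Qed.

Lemma fatou_le (f_ : nat -> T -> \bar R) (f : T -> \bar R) (B : \bar R) :
  (forall k, measurable_fun setT (f_ k)) -> (forall k x, (0 <= f_ k x)%E) ->
  (forall x, f_ k x @[k --> \oo] --> f x) -> (forall k, \int[mu]_x f_ k x <= B)%E ->
  (\int[mu]_x f x <= B)%E.
Proof.
move=> mf f0 ff fB.
have E x : f x = limn_einf (f_ ^~ x) by rewrite (cvg_limn_einf_sup (ff x)).1.
under eq_integral do rewrite E.
apply: (le_trans (fatou mu measurableT mf (fun k x _ => f0 k x))).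
rewrite limn_einf_lim; apply: lime_le; first exact: is_cvg_einfs.
apply: nearW => k; apply: le_trans (fB k); apply: ereal_inf_lbound.
by exists k => //=.
Qed.

Lemma LfunP_integral (p : R) (f : T -> R) : 0 < p -> measurable_fun setT f ->
  (\int[mu]_x (`|f x| `^ p)%:E < +oo)%E -> f \in Lfun mu p%:E.
Proof.
move=> p0 mf fp; apply/andP; split; first by rewrite inE.
by rewrite inE /= /finite_norm LnormE poweR_lty.
Qed.

Lemma Lfun_integral_lty (p : R) (f : T -> R) : 0 < p -> f \in Lfun mu p%:E ->
  (\int[mu]_x (`|f x| `^ p)%:E < +oo)%E.
Proof.
move=> p0 /sub_Lfun_finLfun; rewrite inE /= /finite_norm LnormE.
by apply: lty_poweRy; rewrite gt_eqF ?invr_gt0.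
Qed.

End Lp_tools.

Section ae_cons_converse.
Context {R : realType} {n : nat}.
Local Notation la := (@lebesgue_measure R).
Local Notation nu := (@rV_lebesgue R n).
Local Notation mu := (@rV_lebesgue R n.+1).

Lemma null_rV_cons (A : set 'rV[R]_n.+1) : measurable A ->
  {ae nu, forall y, {ae la, forall t, ~ A (rV_cons (t, y))}} -> mu A = 0%E.
Proof.
move=> mA H.
have mF : measurable_fun setT (fun x : 'rV[R]_n.+1 => (\1_A x : R)%:E).
  by apply/measurable_EFinP; exact: measurable_indic.
have mFc : measurable_fun setT (fun z : measurableTypeR R * 'rV[R]_n => (\1_A (rV_cons z) : R)%:E).
  exact: (measurableT_comp mF measurable_rV_cons).
rewrite -[A]setIT -integral_indic// ge0_integral_rV_cons// fubini_tonelli2//.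
have F0 (z : measurableTypeR R * 'rV[R]_n) : (0 <= (\1_A (rV_cons z) : R)%:E)%E by rewrite lee_fin.
have mG := measurable_fun_fubini_tonelli_G (m1 := la) _ mFc F0.
rewrite (ae_eq_integral (cst 0%E)) ?integral0//.
move: H; apply: filterS => y Hy _; rewrite /fubini_G.
have mFy := measurable_fun_pair1 y mFc.
rewrite (ae_eq_integral (cst 0%E)) ?integral0//.
by move: Hy; apply: filterS => t nA _; rewrite indicE memNset.
Qed.

End ae_cons_converse.

Section profile_facts.
Context {R : realType} {n : nat}.
Local Notation la := (@lebesgue_measure R).
Local Notation nu := (@rV_lebesgue R n).
Local Notation mu := (@rV_lebesgue R n.+1).

Lemma small_cube (s : R) (y : 'rV[R]_n) : 0 < s ->
  box (fun=> 0) (fun=> s / (2 * n.+1%:R)) y -> sqn y <= s ^+ 2 / 4.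
Proof.
move=> s0 yQ; have n1 : (0 : R) < n.+1%:R by rewrite ltr0n.
set e := s / _ in yQ.
have e0 : 0 < e by rewrite divr_gt0// mulr_gt0.
apply: (@le_trans _ _ (\sum_(j < n) e ^+ 2)).
  apply: ler_sum => j _; have /andP[y0 ye] := yQ j.
  by rewrite ler_sqr ?nnegrE ?(ltW y0) ?(ltW e0).
rewrite sumr_const card_ord -[_ *+ n]mulr_natl.
have -> : s ^+ 2 / 4 = n.+1%:R ^+ 2 * e ^+ 2.
  by rewrite /e; field; apply/eqP => E; have := ler0n R n; lra.
rewrite ler_wpM2r ?sqr_ge0// -natrX ler_nat.
by rewrite (leq_trans (leqnSn n))// -mulnn leq_pmulr.
Qed.

(** The set contains cubes of any side. *)
Lemma measure_outside_ball (s : R) : 0 < s ->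
  mu [set x : 'rV[R]_n.+1 | s <= enorm x] = +oo%E.
Proof.
move=> s0; apply/eqyP => A A0.
pose k := (Num.truncn A).+1.
have k0 : (1 : R) <= k%:R by rewrite ler1n.
have mB : measurable [set x : 'rV[R]_n.+1 | s <= enorm x].
  rewrite (_ : [set _ | _] = @enorm R n.+1 @^-1` `[s, +oo[%classic); last first.
    by apply/seteqP; split => x /=; rewrite in_itv/= andbT.
  by rewrite -[X in measurable X]setTI; apply: measurable_enorm.
apply: (@le_trans _ _ (mu (box (fun=> s) (fun=> s + k%:R)))); last first.
  apply: le_measure; rewrite ?inE//; first exact: measurable_rV_box.
  move=> x xb /=; have /andP[sx _] := xb ord0.
  apply: (le_trans (ltW sx)); rewrite (le_trans (ler_norm _))// -sqrtr_sqr ler_wsqrtr//.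
  by rewrite (bigD1 ord0)//= lerDl sumr_ge0// => j _; exact: sqr_ge0.
rewrite rV_lebesgue_box => [|i]; last by rewrite lerDl.
rewrite lee_fin; under eq_bigr do rewrite addrAC subrr add0r.
rewrite prodr_const card_ord (le_trans (ltW (truncnS_gt A)))//.
by rewrite -[leLHS]expr1 ler_weXn2l.
Qed.

Variables (p : R).
Hypotheses (p1 : 1 < p) (pn : p < n.+1%:R).

Lemma increment_continuous (G : R) (W : R -> R) : 0 <= G ->
  (forall s r, 0 < s -> s <= r -> r <= 2 * s -> `|W r - W s| <= increment_bound n p G r s) ->
  {in `]0, +oo[%classic, continuous W}.
Proof.
move=> G0 WH r; rewrite inE/= in_itv/= andbT => r0.
pose a := r / 2.
have a0 : 0 < a by rewrite divr_gt0.
have pV : p^-1 < 1 by rewrite invf_lt1// (lt_trans ltr01).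
have n1 : (0 : R) < n.+1%:R by rewrite ltr0n.
(* for s >= a the last factor of the increment bound is at most its value at a *)
pose B := G * 3 `^ (1 - p^-1) * ((a / (2 * n.+1%:R)) ^+ n) `^ (- p^-1).
have B0 : 0 <= B by rewrite !mulr_ge0 ?powR_ge0.
have bound s t : a <= s -> s <= t -> t <= 2 * s -> `|W t - W s| <= B * (t - s) `^ (1 - p^-1).
  move=> as_ st t2; have s0 : 0 < s by rewrite (lt_le_trans a0).
  apply: (le_trans (WH _ _ s0 st t2)); rewrite /increment_bound /B.
  rewrite powRM ?subr_ge0//.
  rewrite -[leRHS]mulrA [X in _ <= _ * X]mulrC !mulrA.
  rewrite ler_wpM2l ?mulr_ge0 ?powR_ge0//.
  have D (z : R) : 0 < z -> 0 < (z / (2 * n.+1%:R)) ^+ n by move=> z0; rewrite exprn_gt0// divr_gt0// mulr_gt0.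
  rewrite !powRN lef_pV2 ?posrE ?powR_gt0 ?D//.
  have p0 : 0 <= p^-1 by rewrite invr_ge0 ltW// (lt_trans ltr01).
  apply: ge0_ler_powR; rewrite ?nnegrE ?(ltW (D _ _))//.
  have c0 : 0 <= 2 * n.+1%:R :> R by rewrite mulr_ge0// ltW.
  rewrite lerXn2r ?nnegrE ?(divr_ge0 _ c0) ?(ltW a0) ?(ltW s0)//.
  by rewrite ler_wpM2r// invr_ge0 mulr_ge0// ltW.
have bound2 t : `|t - r| < a -> `|W r - W t| <= B * `|r - t| `^ (1 - p^-1).
  rewrite ltr_norml => /andP[t1 t2].
  have [tr|rt] := leP t r.
    by rewrite [X in _ * X `^ _]ger0_norm ?subr_ge0//; apply: bound => //; move: t1 t2; rewrite /a; lra.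
  rewrite distrC [X in _ * X `^ _]distrC [X in _ * X `^ _]ger0_norm ?subr_ge0 ?(ltW rt)//.
  by apply: bound; rewrite ?(ltW rt)//; move: t1 t2; rewrite /a; lra.
have pw : B * `|r - t| `^ (1 - p^-1) @[t --> r] --> B * 0.
  apply: cvgMl_tmp; apply: cvg_normr_powR0; first by rewrite subr_gt0.
  rewrite -[X in _ --> X](subrr r); apply: cvgB => //; exact: cvg_cst.
apply/cvgrPdist_lt => e e0.
rewrite mulr0 in pw.
move/cvgrPdist_lt : pw => /(_ e e0) pw.
near=> t; apply: le_lt_trans (bound2 _ _) _.
  by near: t; apply/nbhs_ballP; exists a => //= t; rewrite /ball/= distrC.
by near: t; move: pw; apply: filterS => t; rewrite sub0r normrN ger0_norm// mulr_ge0 ?powR_ge0.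
Unshelve. all: by end_near. Qed.

Lemma measurable_radial (W : R -> R) : {in `]0, +oo[%classic, continuous W} ->
  (forall r, r <= 0 -> W r = 0) ->
  measurable_fun setT (fun x : 'rV[R]_n.+1 => W (enorm x)).
Proof.
move=> cW W0; have mW : measurable_fun (setT : set (measurableTypeR R)) W.
  rewrite (_ : setT = `]-oo, 0%R] `|` `]0%R, +oo[); last first.
    apply/seteqP; split => // t _ /=; rewrite !in_itv/= andbT.
    by have [|] := leP t 0; [left|right].
  apply/measurable_funU => //; split.
    apply: (eq_measurable_fun (cst 0 : measurableTypeR R -> R)) => // t; rewrite inE/= in_itv/= => t0.
    by rewrite W0.
  exact: open_continuous_measurable_fun.
exact: (measurableT_comp mW measurable_enorm).
Qed.

(** If |W s| exceeded the bound by d > 0, then |W| would be at least d on [s,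
    +oo[ by [increment_decay], and |u| at least d almost everywhere outside a
    ball; that set has infinite measure, so u would not be in L^p. *)
Lemma radial_profile_exists (u : 'rV[R]_n.+1 -> R) (g : 'rV[R]_n.+1 -> 'rV[R]_n.+1) (G : R) :
  Lp p u -> Lp_gradient p u g -> radial u ->
  ('N[mu]_p%:E[EFin \o (fun x => g x ord0 ord0)] <= G%:E)%E ->
  exists W : R -> R, [/\ forall r, r <= 0 -> W r = 0,
    forall s r, 0 < s -> s <= r -> r <= 2 * s -> `|W r - W s| <= increment_bound n p G r s,
    forall s, 0 < s -> `|W s| <= decay_cst n p * G * s `^ (- decay_exp n p) &
    {ae mu, forall x, u x = W (enorm x)}].
Proof.
move=> up gp [U uU] gG.
have G0 : 0 <= G by rewrite -lee_fin (le_trans _ gG)// Lnorm_ge0.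
pose W r := if r <= 0 then 0 else profile u g U r.
have W0 r : r <= 0 -> W r = 0 by rewrite /W => ->.
have WE r : 0 < r -> W r = profile u g U r by rewrite /W ltNge => /negbTE ->.
have n1 : (0 : R) < n.+1%:R by rewrite ltr0n.
have WH s r : 0 < s -> s <= r -> r <= 2 * s -> `|W r - W s| <= increment_bound n p G r s.
  move=> s0 sr r2; rewrite !WE ?(lt_le_trans s0)//.
  apply: (profile_holder p1 up gp uU) => //.
    by rewrite divr_gt0// mulr_gt0.
  by move=> y; exact: small_cube.
have cW := increment_continuous G0 WH.
have mWe := measurable_radial cW W0.
have mu_ : measurable_fun setT u by move/sub_Lfun_mfun : (up); rewrite inE.
have uW : {ae mu, forall x, u x = W (enorm x)}.
  pose A := [set x | u x != W (enorm x)].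
  have mA : measurable A.
    rewrite (_ : A = (fun x => u x - W (enorm x)) @^-1` (~` [set 0])); last first.
      apply/seteqP; split => x; rewrite /A /=.
        by move=> /eqP ne /eqP; rewrite subr_eq0 => /eqP.
      by move=> ne; apply/eqP => E; apply: ne; rewrite E subrr.
    rewrite -[X in measurable X]setTI; apply: measurable_funB => //.
    by apply: measurableC; exact: measurable_set1.
  exists A; split => //; last by move=> x /= /eqP.
  apply: null_rV_cons => //.
  move: (good_slice_ae p1 up gp uU); apply: filterS => y [V yV].
  have nz : {ae la, forall t, (t : R) != 0}.
    exists [set 0]; split; [exact: measurable_set1|exact: lebesgue_measure_set1|].
    by move=> t /= /negP; rewrite negbK => /eqP.
  apply: negligibleS (negligibleU nz yV.2) => t /= nA.
  apply: contrapT => /not_orP[/contrapT t0 /contrapT[ut _]]; apply: nA; rewrite /A /=.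
  rewrite ut (profileP yV t0) enorm_cons WE ?eqxx//.
  by rewrite sqrtr_gt0 ltr_wpDr ?sqn_ge0// lt_neqAle eq_sym sqrf_eq0 t0 sqr_ge0.
exists W; split => // s s0.
have ID r : s <= r -> `|W r - W s| <= decay_cst n p * G * s `^ (- decay_exp n p).
  exact: (increment_decay p1 pn G0 WH).
rewrite leNgt; apply/negP => lt.
pose d := `|W s| - decay_cst n p * G * s `^ (- decay_exp n p).
have d0 : 0 < d by rewrite subr_gt0.
have Wd r : s <= r -> d <= `|W r|.
  move=> /ID; rewrite distrC => H; rewrite /d lerBlDr -lerBlDl.
  by apply: le_trans H; exact: lerB_dist.
have p0 : 0 < p by rewrite (lt_trans ltr01).
have := Lfun_integral_lty p0 (up : u \in Lfun mu p%:E).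
apply/negP; rewrite -leNgt.
have mB : measurable [set x : 'rV[R]_n.+1 | s <= enorm x].
  rewrite (_ : [set _ | _] = @enorm R n.+1 @^-1` `[s, +oo[%classic); last first.
    by apply/seteqP; split => x /=; rewrite in_itv/= andbT.
  by rewrite -[X in measurable X]setTI; apply: measurable_enorm.
have -> : +oo%E = (\int[mu]_x ((d `^ p) * \1_[set x | s <= enorm x] x)%:E)%E.
  under eq_integral do rewrite EFinM.
  rewrite ge0_integralZl//.
  - by rewrite integral_indic// setIT [X in (_ * X)%E](measure_outside_ball s0) gt0_muley// lte_fin powR_gt0.
  - by apply/measurable_EFinP; exact: measurable_indic.
  - by rewrite lee_fin powR_ge0.
apply: ae_ge0_le_integral => //.
- by move=> x _; rewrite lee_fin mulr_ge0// powR_ge0.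
- by apply/measurable_EFinP; apply: measurable_funM => //; exact: measurable_indic.
- apply/measurable_EFinP; apply: (measurableT_comp (measurable_powR _)).
  exact: measurableT_comp.
move: uW; apply: filterS => x -> _; rewrite lee_fin indicE.
have [sx|sx] := boolP (s <= enorm x); last first.
  by rewrite memNset ?mulr0 ?powR_ge0//=; apply/negP.
by rewrite mem_set// mulr1 ge0_ler_powR ?nnegrE ?(ltW p0) ?(ltW d0)// Wd.
Qed.

End profile_facts.

(** * Powers of the norm near the origin *)

Section ball_integral.
Context {R : realType} {n : nat}.
Local Notation mu := (@rV_lebesgue R n.+1).

Definition ball0 (e : R) : set 'rV[R]_n.+1 := [set x | enorm x <= e].

Lemma measurable_ball0 e : measurable (ball0 e).
Proof.
rewrite (_ : ball0 e = @enorm R n.+1 @^-1` `]-oo, e]%classic); last first.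
  by apply/seteqP; split => x /=; rewrite in_itv.
by rewrite -[X in measurable X]setTI; apply: measurable_enorm.
Qed.

Lemma normr_coord_le_enorm (x : 'rV[R]_n.+1) i : `|x ord0 i| <= enorm x.
Proof.
rewrite -sqrtr_sqr ler_wsqrtr// (bigD1 i)//= lerDl sumr_ge0// => j _; exact: sqr_ge0.
Qed.

Lemma measure_ball0_le e : 0 < e -> (mu (ball0 e) <= ((4 * e) ^+ n.+1)%:E)%E.
Proof.
move=> e0; apply: (@le_trans _ _ (mu (box (fun=> - (2 * e)) (fun=> 2 * e)))).
  apply: le_measure; rewrite ?inE; [exact: measurable_ball0|exact: measurable_rV_box|].
  move=> x xe i; have := le_trans (normr_coord_le_enorm x i) xe.
  by rewrite ler_norml => /andP[? ?]; apply/andP; split; lra.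
rewrite rV_lebesgue_box => [|i]; last by lra.
by rewrite prodr_const card_ord lee_fin (_ : 2 * e - _ = 4 * e)//; lra.
Qed.

(** On the dyadic shell rho / 2^(k+1) < |x| <= rho / 2^k, replace |x| by the
    inner radius, and bound the measure of the shell by that of a cube
    containing the ball: the contributions are those of a geometric series of
    ratio 2^(gam - N) < 1. *)
Lemma powR_ball_integrable (gam rho : R) : 0 < gam -> gam < n.+1%:R -> 0 < rho ->
  (\int[mu]_x (enorm x `^ (- gam) * \1_(ball0 rho) x)%:E < +oo)%E.
Proof.
move=> g0 gn rho0.
pose th : R := 2 `^ (gam - n.+1%:R).
have th1 : th < 1.
  have : 1 `^ (n.+1%:R - gam) < 2 `^ (n.+1%:R - gam) :> R.
    by rewrite gt0_ltr_powR ?nnegrE ?subr_gt0//; lra.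
  rewrite powR1 => H; have -> : th = (2 `^ (n.+1%:R - gam))^-1 by rewrite /th -powRN opprB.
  by rewrite invf_lt1// (lt_trans ltr01).
have th0 : 0 <= th by rewrite powR_ge0.
pose rk k : R := rho / 2 ^+ k.
have rk0 k : 0 < rk k by rewrite divr_gt0// exprn_gt0.
pose F k (x : 'rV[R]_n.+1) : \bar R := (rk k.+1 `^ (- gam) * \1_(ball0 (rk k)) x)%:E.
have F0 k x : (0 <= F k x)%E by rewrite lee_fin mulr_ge0// powR_ge0.
have mI k : measurable_fun setT (\1_(ball0 (rk k)) : 'rV[R]_n.+1 -> R).
  by apply: measurable_indic; exact: measurable_ball0.
have mF k : measurable_fun setT (F k).
  by apply/measurable_EFinP; exact: measurable_funM.
pose C : R := (2 / rho) `^ gam * (4 * rho) ^+ n.+1.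
have C0 : 0 <= C by rewrite mulr_ge0 ?powR_ge0// exprn_ge0// mulr_ge0// ltW.
have IF k : (\int[mu]_x F k x <= (C * th ^+ k)%:E)%E.
  under eq_integral do rewrite /F EFinM.
  rewrite ge0_integralZl//; last 2 first.
  - exact/measurable_EFinP.
  - by rewrite lee_fin powR_ge0.
  rewrite integral_indic//; last exact: measurable_ball0.
  rewrite setIT (le_trans (lee_wpmul2l _ (measure_ball0_le (rk0 k))))//.
    by rewrite lee_fin powR_ge0.
  rewrite -EFinM lee_fin le_eqVlt; apply/orP; left; apply/eqP.
  have -> : th ^+ k = (2 ^+ k) `^ gam / (2 ^+ k) ^+ n.+1.
    rewrite /th -powR_mulrn ?powR_ge0// -powRrM mulrC powRrM powR_mulrn//.
    have k0 : 0 < 2 ^+ k :> R by rewrite exprn_gt0.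
    rewrite powRB; last by rewrite (gt_eqF k0) implybT.
    by rewrite powR_mulrn// ltW.
  have -> : rk k.+1 `^ (- gam) = (2 / rho) `^ gam * (2 ^+ k) `^ gam.
    rewrite -powRM ?exprn_ge0 ?divr_ge0 ?(ltW rho0)//.
    rewrite powRN -powR_inv1 ?powR_ge0// -powRrM mulrN1 -mulN1r powRrM powR_inv1 ?(ltW (rk0 _))//.
    by congr (_ `^ _); rewrite /rk invfM invrK exprS; ring.
  rewrite (_ : 4 * rk k = 4 * rho / 2 ^+ k); last by rewrite /rk mulrA.
  by rewrite expr_div_n /C; ring.
apply: (@le_lt_trans _ _ (\int[mu]_x \sum_(k <oo) F k x)%E).
  apply: ge0_le_integral => //.
  - by move=> x _; rewrite lee_fin mulr_ge0// powR_ge0.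
  - apply/measurable_EFinP; apply: measurable_funM; last first.
      by apply: measurable_indic; exact: measurable_ball0.
    apply: (measurableT_comp (measurable_powR _)); exact: measurable_enorm.
  - by apply: ge0_emeasurable_sum.
  move=> x _; have S0 : (0 <= \sum_(k <oo) F k x)%E by apply: nneseries_ge0.
  have [x0|x0] := leP (enorm x) 0.
    have -> : enorm x = 0 by apply/eqP; rewrite eq_le x0 sqrtr_ge0.
    by rewrite powR0 ?mul0r// oppr_eq0 gt_eqF.
  have [xr|xr] := leP (enorm x) rho; last first.
    by rewrite indicE memNset ?mulr0// /ball0 /=; apply/negP; rewrite -ltNge.
  have Ex : exists k, rk k.+1 < enorm x.
    exists (Num.truncn (rho / enorm x)).
    rewrite /rk ltr_pdivrMr ?exprn_gt0// mulrC -ltr_pdivrMr//.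
    by apply: (lt_le_trans (truncnS_gt _)); rewrite -natrX ler_nat ltnW// ltn_expl.
  have [k kx kmin] := ex_minnP Ex.
  have xk : enorm x <= rk k.
    case: k {kx} kmin => [|k] kmin; first by rewrite /rk expr0 divr1.
    by rewrite leNgt; apply/negP => /kmin; rewrite ltnn.
  apply: (@le_trans _ _ (F k x)); last first.
    rewrite (nneseries_split _ k.+1)// big_nat_recr//= -addeA [X in (_ <= X)%E]addeCA.
    by apply: leeDl; rewrite adde_ge0 ?sume_ge0 ?nneseries_ge0.
  rewrite /F lee_fin !indicE !mem_set// !mulr1.
  by rewrite !powRN lef_pV2 ?posrE ?powR_gt0// ge0_ler_powR ?nnegrE ?(ltW g0) ?(ltW x0) ?(ltW kx) ?(ltW (rk0 _)).
rewrite integral_nneseries//.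
apply: (@le_lt_trans _ _ (C / (1 - th))%:E); last exact: ltry.
apply: lime_le; first by apply: is_cvg_nneseries => k _ _; exact: integral_ge0.
near=> m; apply: (@le_trans _ _ (\sum_(0 <= k < m) (C * th ^+ k)%:E)%E).
  by apply: lee_sum => k _; exact: IF.
rewrite sumEFin lee_fin.
have th1' : 0 < 1 - th by rewrite subr_gt0.
rewrite ler_pdivlMr//.
have -> : (\sum_(0 <= k < m) C * th ^+ k) * (1 - th) = C * (1 - th ^+ m).
  elim: (m) => [|j IH]; first by rewrite big_nil mul0r expr0 subrr mulr0.
  by rewrite big_nat_recr//= mulrDl IH exprS; ring.
by rewrite ler_piMr// gerBl exprn_ge0.
Unshelve. all: by end_near. Qed.

End ball_integral.

(** * Pointwise convergence of a subsequence of profiles *)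

Section bolzano_diagonal.
Context {R : realType}.

(** Cantor's diagonal argument. H j.+1 refines H j by Bolzano-Weierstrass so
    that f _ j converges along it, and the terms of k |-> H k k from rank j on
    are terms of H j. *)
Lemma diagonal_subsequence (f : nat -> nat -> R) :
  (forall j, exists B, forall n, `|f n j| <= B) ->
  exists s : nat -> nat, {homo s : m n / (m < n)%N} /\
    forall j, cvgn (fun k => f (s k) j).
Proof.
move=> fB.
have sub (hj : (nat -> nat) * nat) : exists g : nat -> nat, {homo g : m n / (m < n)%N} /\
    cvgn (fun k => f (hj.1 (g k)) hj.2).
  have [B HB] := fB hj.2.
  have [|g gI cg] := @bolzano_weierstrass R (fun n => f (hj.1 n) hj.2).
    by exists B; split; [exact: num_real|move=> M BM n _; exact: le_trans (HB _) (ltW BM)].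
  by exists g; split => // m n; rewrite (leqW_mono gI).
have [G HG] := choice sub.
pose H := fix H j := if j is j'.+1 then H j' \o G (H j', j') else id.
have GI hj : {homo G hj : m n / (m < n)%N} by have [] := HG hj.
have Gge hj k : (k <= G hj k)%N.
  elim: k => // k IH; exact: leq_ltn_trans IH (GI _ _ _ (ltnSn k)).
have HI j : {homo H j : m n / (m < n)%N}.
  by elim: j => [//|j IH] m n mn /=; apply: IH; exact: GI.
have Hm j : {homo H j : m n / (m <= n)%N} by exact/ltnW_homo/HI.
pose s k := H k k.
have sI : {homo s : m n / (m < n)%N}.
  apply: homo_ltn; first exact: ltn_trans.
  move=> k; rewrite /s /=; apply: HI; exact: leq_ltn_trans (leqnn _) (Gge _ k.+1).
have tail j i : forall k, exists m, (k <= m)%N /\ H (j + i)%N k = H j m.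
  elim: i => [|i IH] k; first by exists k; rewrite addn0.
  have [m [km E]] := IH (G (H (j + i)%N, (j + i)%N) k).
  by exists m; rewrite addnS /= E; split => //; exact: leq_trans (Gge _ _) km.
exists s; split => // j.
have [_ cj] := HG (H j, j).
apply/cvg_ex; exists (lim ((fun k => f (H j (G (H j, j) k)) j) @ \oo)).
apply/cvgrPdist_lt => e e0; move/cvgrPdist_lt : cj => /(_ e e0) [N _ HN].
exists (j.+1 + N)%N => // k /= jNk.
have [m [km E]] := tail j.+1 (k - j.+1)%N k.
rewrite /s; move: E; rewrite subnKC ?(leq_trans (leq_addr _ _) jNk)// => ->.
apply: HN => /=; exact: leq_trans (leq_trans (leq_addl _ _) jNk) km.
Qed.

End bolzano_diagonal.

Section profile_compactness.
Context {R : realType}.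
Variables (n : nat) (p : R).
Hypotheses (p1 : 1 < p) (pn : p < n.+1%:R).

Lemma increment_bound_small (G r e : R) : 0 <= G -> 0 < r -> 0 < e ->
  exists d, [/\ 0 < d, d <= r & forall t, r <= t -> t <= r + d -> increment_bound n p G t r < e].
Proof.
move=> G0 r0 e0.
have b0 : 0 < 1 - p^-1 by rewrite subr_gt0 invf_lt1// (lt_trans ltr01).
set b := 1 - _ in b0.
pose A := G * ((r / (2 * n.+1%:R)) ^+ n) `^ (- p^-1).
have A0 : 0 <= A by rewrite mulr_ge0 ?powR_ge0.
have A1 : 0 < A + 1 by rewrite ltr_pwDr.
have eA : 0 < e / (A + 1) by rewrite divr_gt0.
pose z := (e / (A + 1)) `^ b^-1.
have z0 : 0 < z by rewrite powR_gt0.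
exists (Num.min r (z / 3)); split.
- by rewrite lt_min r0 divr_gt0.
- by rewrite ge_min lexx.
move=> t rt td; have tz : 3 * (t - r) <= z.
  have : t - r <= Num.min r (z / 3) by lra.
  by rewrite le_min => /andP[_]; lra.
apply: (@le_lt_trans _ _ (A * (e / (A + 1)))).
  rewrite /increment_bound /A mulrAC ler_wpM2l//.
  have -> : e / (A + 1) = z `^ b.
    by rewrite /z -powRrM mulVf ?powRr1 ?(ltW eA)// gt_eqF.
  by rewrite ge0_ler_powR ?nnegrE ?(ltW b0) ?(ltW z0)// mulr_ge0// subr_ge0.
by rewrite mulrA ltr_pdivrMr// mulrC ltr_pM2l// ltrDl.
Qed.

(** As in the theorem of Arzela and Ascoli: choose a subsequence that
    converges at every rational radius; since the increment bound is common to
    all the profiles, it is Cauchy at every positive radius. *)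
Lemma radial_profiles_subsequence (G K : R) (W : nat -> R -> R) : 0 <= G ->
  (forall k r, r <= 0 -> W k r = 0) ->
  (forall k s r, 0 < s -> s <= r -> r <= 2 * s -> `|W k r - W k s| <= increment_bound n p G r s) ->
  (forall k s, 0 < s -> `|W k s| <= K * s `^ (- decay_exp n p)) ->
  exists s : nat -> nat, {homo s : i j / (i < j)%N} /\ exists V : R -> R,
    [/\ forall r, W (s k) r @[k --> \oo] --> V r,
      forall r, r <= 0 -> V r = 0 &
      forall s r, 0 < s -> s <= r -> r <= 2 * s -> `|V r - V s| <= increment_bound n p G r s].
Proof.
move=> G0 W0 WH WK.
pose t j : R := ratr (odflt 0 (unpickle j) : rat).
have [|s [sI cs]] := diagonal_subsequence (f := fun k j => W k (t j)).
  move=> j; have [t0|t0] := leP (t j) 0; first by exists 0 => k; rewrite W0// normr0.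
  by exists (K * t j `^ (- decay_exp n p)) => k; exact: WK.
have cv r : cvgn (fun k => W (s k) r).
  have [r0|r0] := leP r 0.
    rewrite (_ : (fun _ => _) = cst 0); first exact: is_cvg_cst.
    by apply/funext => k; rewrite W0.
  apply/cauchy_cvgP; apply: cauchy_exP => e e0.
  have e2 : 0 < e / 2 by rewrite divr_gt0.
  have [d [d0 dr Hd]] := increment_bound_small G0 r0 e2.
  have rrd : r < r + d by rewrite ltrDl.
  have [q] := rat_in_itvoo rrd.
  rewrite in_itv/= => /andP[rq qd].
  have tq : t (pickle q) = ratr q by rewrite /t pickleK.
  exists (lim (W (s k) (t (pickle q)) @[k --> \oo])).
  move/cvgrPdist_lt : (cs (pickle q)) => /(_ _ e2) /=; apply: filterS => k.
  rewrite tq /ball/= => Hk.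
  have r2 : ratr q <= 2 * r by lra.
  have := le_lt_trans (WH (s k) _ _ r0 (ltW rq) r2) (Hd _ (ltW rq) (ltW qd)).
  set l := lim _ in Hk *; move: Hk; rewrite !ltr_norml => /andP[? ?] /andP[? ?].
  by apply/andP; split; lra.
exists s; split => //; exists (fun r => lim (W (s k) r @[k --> \oo])); split => //.
- move=> r r0; rewrite (_ : (fun _ => _) = cst 0) ?lim_cst//.
  by apply/funext => k; rewrite W0.
move=> a r a0 ar r2.
have c : `|W (s k) r - W (s k) a| @[k --> \oo] -->
    `|lim (W (s k) r @[k --> \oo]) - lim (W (s k) a @[k --> \oo])|.
  by apply: cvg_norm; apply: cvgB; exact: cv.
apply: (ler_cvg_to c (cvg_cst _)).
by apply: nearW => k; exact: WH.
Qed.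

End profile_compactness.

Section powR_split.
Context {R : realType}.

Lemma powR_split_le (a b q p : R) : 0 <= a -> a <= b -> 0 < p -> p < q ->
  a `^ q <= b `^ (q - p) * a `^ p.
Proof.
move=> a0 ab p0 pq.
have -> : a `^ q = a `^ (q - p) * a `^ p.
  by rewrite -powRD ?subrK// gt_eqF// (lt_trans p0).
rewrite ler_wpM2r ?powR_ge0// ge0_ler_powR ?nnegrE ?subr_ge0 ?(ltW pq)//.
exact: le_trans a0 ab.
Qed.

Lemma powR_add_le (a b p : R) : 0 <= a -> 0 <= b -> 0 < p ->
  (a + b) `^ p <= 2 `^ p * (a `^ p + b `^ p).
Proof.
move=> a0 b0 p0.
wlog ab : a b a0 b0 / a <= b => [H|].
  have [/H|/ltW/H] := leP a b; first exact.
  by rewrite addrC [b `^ _ + _]addrC; apply.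
apply: (@le_trans _ _ ((2 * b) `^ p)).
  by rewrite ge0_ler_powR ?nnegrE ?(ltW p0)// ?addr_ge0// ?mulr_ge0//; lra.
by rewrite powRM// ler_wpM2l ?powR_ge0// lerDr powR_ge0.
Qed.

End powR_split.

(** * From decay to convergence in L^q *)

Section radial_Lq.
Context {R : realType} {n : nat}.
Local Notation mu := (@rV_lebesgue R n.+1).
Variables (p q al K : R).
Hypotheses (p0 : 0 < p) (pq : p < q) (al0 : 0 < al) (alq : al * q < n.+1%:R) (K0 : 0 <= K).

Let q0 : 0 < q. Proof. exact: lt_trans pq. Qed.

(** The condition at 0 agrees with the bound, as 0 `^ (- al) = 0. *)
Definition decays (W : R -> R) :=
  [/\ W 0 = 0, forall s, 0 < s -> `|W s| <= K * s `^ (- al) &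
   measurable_fun setT (fun x : 'rV[R]_n.+1 => W (enorm x))].

Lemma measurable_powR_norm (W : R -> R) (r : R) : decays W ->
  measurable_fun setT (fun x : 'rV[R]_n.+1 => `|W (enorm x)| `^ r).
Proof.
move=> [_ _ mW]; apply: (measurableT_comp (measurable_powR _)); exact: measurableT_comp.
Qed.

(** The q-th power of the decay bound, cut off outside a ball. It is
    integrable because al * q is less than the dimension. *)
Definition ball_majorant (rho : R) (x : 'rV[R]_n.+1) : R :=
  K `^ q * (enorm x `^ (- (al * q)) * \1_(ball0 rho) x).

Lemma integrable_ball_majorant rho : 0 < rho ->
  mu.-integrable setT (EFin \o ball_majorant rho).
Proof.
move=> rho0.
have m : measurable_fun setT (fun x : 'rV[R]_n.+1 => enorm x `^ (- (al * q)) * \1_(ball0 rho) x).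
  apply: measurable_funM; last by apply: measurable_indic; exact: measurable_ball0.
  apply: (measurableT_comp (measurable_powR _)); exact: measurable_enorm.
apply: (@integrableZl _ _ _ mu _ measurableT (K `^ q) (fun x => (enorm x `^ (- (al * q)) * \1_(ball0 rho) x)%:E)).
apply/integrableP; split; first exact/measurable_EFinP.
apply: le_lt_trans (powR_ball_integrable (mulr_gt0 al0 q0) alq rho0).
apply: ge0_le_integral => //.
- by apply/measurable_EFinP; exact: measurableT_comp.
- exact/measurable_EFinP.
- by move=> x _; rewrite lee_fin ger0_norm// mulr_ge0 ?powR_ge0.
Qed.

Lemma decays_ball W rho (x : 'rV[R]_n.+1) : decays W -> 
  `|W (enorm x)| `^ q * \1_(ball0 rho) x <= ball_majorant rho x.
Proof.
move=> [W0 WK _]; rewrite /ball_majorant mulrA ler_wpM2r//.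
have [x0|x0] := leP (enorm x) 0.
  have -> : enorm x = 0 by apply/eqP; rewrite eq_le x0 sqrtr_ge0.
  by rewrite W0 normr0 [X in X <= _]powR0 ?mulr_ge0 ?powR_ge0// gt_eqF.
apply: (@le_trans _ _ ((K * enorm x `^ (- al)) `^ q)).
  by rewrite ge0_ler_powR ?nnegrE ?(ltW q0) ?mulr_ge0 ?powR_ge0 ?WK.
by rewrite powRM ?powR_ge0// -powRrM mulNr.
Qed.

(** Outside the ball, |W| <= K rho^(-al), so |W|^q = |W|^(q-p) |W|^p is small
    relative to |W|^p when rho is large. *)
Lemma decays_split W rho (x : 'rV[R]_n.+1) : decays W -> 0 < rho ->
  `|W (enorm x)| `^ q <= `|W (enorm x)| `^ q * \1_(ball0 rho) x +
     (K * rho `^ (- al)) `^ (q - p) * `|W (enorm x)| `^ p.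
Proof.
move=> [_ WK _] rho0; have [xr|xr] := leP (enorm x) rho.
  rewrite indicE mem_set//= mulr1 lerDl mulr_ge0 ?powR_ge0//.
rewrite indicE memNset ?mulr0 ?add0r; last by rewrite /ball0 /=; apply/negP; rewrite -ltNge.
apply: powR_split_le => //; apply: (le_trans (WK _ (lt_trans rho0 xr))).
rewrite ler_wpM2l// !powRN lef_pV2 ?posrE ?powR_gt0// ?(lt_trans rho0)//.
by rewrite ge0_ler_powR ?nnegrE ?(ltW al0) ?(ltW rho0) ?(ltW xr)// ltW// (lt_trans rho0).
Qed.

Lemma integral_decays_split W rho (B : R) : decays W -> 0 < rho ->
  (\int[mu]_x (`|W (enorm x)| `^ p)%:E <= B%:E)%E ->
  (\int[mu]_x (`|W (enorm x)| `^ q)%:E <=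
    \int[mu]_x (`|W (enorm x)| `^ q * \1_(ball0 rho) x)%:E +
     ((K * rho `^ (- al)) `^ (q - p) * B)%:E)%E.
Proof.
move=> dW rho0 WB.
have mb : measurable_fun setT (\1_(ball0 rho) : 'rV[R]_n.+1 -> R).
  by apply: measurable_indic; exact: measurable_ball0.
have mq := measurable_powR_norm q dW; have mp := measurable_powR_norm p dW.
rewrite EFinM.
apply: (@le_trans _ _ (\int[mu]_x ((`|W (enorm x)| `^ q * \1_(ball0 rho) x)%:E +
   ((K * rho `^ (- al)) `^ (q - p))%:E * (`|W (enorm x)| `^ p)%:E))%E).
  apply: ge0_le_integral => //.
  - exact/measurable_EFinP.
  - apply: emeasurable_funD; first by apply/measurable_EFinP; exact: measurable_funM.
    by apply: measurable_funeM; exact/measurable_EFinP.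
  - by move=> x _; rewrite -EFinM -EFinD lee_fin; exact: decays_split.
have h1 (x : 'rV[R]_n.+1) : setT x -> (0 <= (`|W (enorm x)| `^ q * \1_(ball0 rho) x)%:E)%E.
  by rewrite lee_fin mulr_ge0 ?powR_ge0.
have h2 (x : 'rV[R]_n.+1) : setT x ->
    (0 <= ((K * rho `^ (- al)) `^ (q - p))%:E * (`|W (enorm x)| `^ p)%:E)%E.
  by rewrite -EFinM lee_fin mulr_ge0 ?powR_ge0.
have m1 : measurable_fun setT (fun x : 'rV[R]_n.+1 => (`|W (enorm x)| `^ q * \1_(ball0 rho) x)%:E).
  by apply/measurable_EFinP; exact: measurable_funM.
have m2 : measurable_fun setT (fun x : 'rV[R]_n.+1 =>
    ((K * rho `^ (- al)) `^ (q - p))%:E * (`|W (enorm x)| `^ p)%:E)%E.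
  by apply: measurable_funeM; exact/measurable_EFinP.
rewrite (ge0_integralD mu measurableT h1 m1 h2 m2).
rewrite leeD2l// ge0_integralZl//.
- by rewrite lee_wpmul2l// lee_fin powR_ge0.
- exact/measurable_EFinP.
- by rewrite lee_fin powR_ge0.
Qed.

Lemma radial_Lq_bound W (B : R) : decays W ->
  (\int[mu]_x (`|W (enorm x)| `^ p)%:E <= B%:E)%E ->
  (\int[mu]_x (`|W (enorm x)| `^ q)%:E <=
    \int[mu]_x (ball_majorant 1 x)%:E + (K `^ (q - p) * B)%:E)%E.
Proof.
move=> dW WB; apply: (le_trans (integral_decays_split dW ltr01 WB)).
rewrite powR1 mulr1 leeD2r//; apply: ge0_le_integral => //.
- apply/measurable_EFinP; apply: measurable_funM; first exact: measurable_powR_norm.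
  by apply: measurable_indic; exact: measurable_ball0.
- exact: measurable_int (integrable_ball_majorant ltr01).
- by move=> x _; rewrite lee_fin; exact: decays_ball.
Qed.

(** The part outside a ball of large radius is small uniformly in k, by
    [integral_decays_split]; inside the ball, dominated convergence applies. *)
Lemma radial_Lq_cvg0 (D : nat -> R -> R) (B : R) : (forall k, decays (D k)) ->
  (forall k, \int[mu]_x (`|D k (enorm x)| `^ p)%:E <= B%:E)%E ->
  (forall r, D k r @[k --> \oo] --> 0) ->
  forall e, 0 < e -> \forall k \near \oo, (\int[mu]_x (`|D k (enorm x)| `^ q)%:E <= e%:E)%E.
Proof.
move=> dD DB D0 e e0.
have B0 : 0 <= B.
  rewrite -lee_fin (le_trans _ (DB 0%N))// integral_ge0//.
have e2 : 0 < e / 2 by rewrite divr_gt0.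
have qp : 0 < q - p by rewrite subr_gt0.
have B1 : 0 < B + 1 by rewrite ltr_pwDr.
have K1 : 0 < K + 1 by rewrite ltr_pwDr.
(* z is such that z^(q-p) * B <= e / 2, and rho such that K * rho^(-al) <= z *)
pose z := (e / 2 / (B + 1)) `^ (q - p)^-1.
have z0 : 0 < z by rewrite powR_gt0// divr_gt0.
pose rho := ((K + 1) / z) `^ al^-1.
have rho0 : 0 < rho by rewrite powR_gt0// divr_gt0.
have tl : (K * rho `^ (- al)) `^ (q - p) * B <= e / 2.
  have Kz : K * rho `^ (- al) <= z.
    rewrite powRN /rho -powRrM mulVf ?gt_eqF// powRr1 ?divr_ge0 ?(ltW K1) ?(ltW z0)//.
    by rewrite invf_div mulrCA ler_piMr ?(ltW z0)// ler_pdivrMr// mul1r lerDl.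
  apply: (@le_trans _ _ (z `^ (q - p) * B)).
    by rewrite ler_wpM2r// ge0_ler_powR ?nnegrE ?(ltW qp) ?(ltW z0)// mulr_ge0// powR_ge0.
  rewrite /z -powRrM mulVf ?gt_eqF// powRr1 ?divr_ge0 ?(ltW e2) ?(ltW e0) ?(ltW B1)//.
  by rewrite mulrAC -mulrA ler_piMr ?(ltW e2)// ler_pdivrMr// mul1r lerDl.
have mb : measurable_fun setT (\1_(ball0 rho) : 'rV[R]_n.+1 -> R).
  by apply: measurable_indic; exact: measurable_ball0.
pose f k (x : 'rV[R]_n.+1) : \bar R := (`|D k (enorm x)| `^ q * \1_(ball0 rho) x)%:E.
have f0 : (\int[mu]_x f k x @[k --> \oo] --> \int[mu]_x cst 0 x)%E.
  apply: (dominated_cvg measurableT _ _ _ (integrable_ball_majorant rho0)) => //.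
  - by move=> k; apply/measurable_EFinP; apply: measurable_funM => //; exact: measurable_powR_norm.
  - move=> x _; apply/cvg_EFin; first exact: nearW.
    rewrite /comp /f /=; rewrite -(mul0r (\1_(ball0 rho) x)); apply: cvgMr_tmp.
    exact: cvg_normr_powR0 q0 (D0 (enorm x)).
  - move=> k x _; rewrite /f /= lee_fin ger0_norm ?mulr_ge0 ?powR_ge0//.
    exact: decays_ball.
rewrite integral0 in f0.
have : \forall k \near \oo, (\int[mu]_x f k x <= (e / 2)%:E)%E.
  move/fine_cvgP : f0 => [ffin /cvgrPdist_lt/(_ _ e2)]; move: ffin; apply: filterS2 => k kfin.
  rewrite sub0r normrN => /(le_lt_trans (ler_norm _)) fk.
  by rewrite -(fineK kfin) lee_fin ltW.
apply: filterS => k fk; apply: (le_trans (integral_decays_split (dD k) rho0 (DB k))).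
by rewrite [e in (_ <= e%:E)%E](splitr e) EFinD leeD// lee_fin.
Qed.

End radial_Lq.

(** * The compact embedding *)

Section radial_sobolev.
Context {R : realType} {n : nat}.
Local Notation mu := (@rV_lebesgue R n.+1).
Variables (p q : R).
Hypotheses (p1 : 1 < p) (pn : p < n.+1%:R) (pq : p < q).
Hypothesis (qs : q < sobolev_exponent n.+1 p).

Let al : R := decay_exp n p.
Let c : R := decay_cst n p.
Let p0 : 0 < p. Proof. exact: lt_trans p1. Qed.
Let q0 : 0 < q. Proof. exact: lt_trans pq. Qed.
Let al0 : 0 < al. Proof. exact: decay_exp_gt0. Qed.
Let c0 : 0 <= c. Proof. exact: decay_cst_ge0. Qed.

(** The conditions q < N p / (N - p) and q (N - p) / p < N are equivalent. *)
Lemma decay_exp_subcritical : al * q < n.+1%:R.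
Proof.
have np : 0 < n.+1%:R - p by rewrite subr_gt0.
move: qs; rewrite /sobolev_exponent ltr_pdivlMr// => H.
rewrite /al /decay_exp -(ltr_pM2r p0).
by rewrite (_ : _ * p = q * (n.+1%:R - p)); last by field; rewrite gt_eqF.
Qed.
Let alq := decay_exp_subcritical.

Lemma gradP (u : 'rV[R]_n.+1 -> R) : W1p p u -> Lp_gradient p u (grad p u).
Proof. by move=> [_ [g gp]]; apply: xgetPex; exists g. Qed.

(** What [radial_profile_exists] provides when the first partial derivative of
    u has L^p norm at most G. The increment bound serves continuity and
    equicontinuity, the decay bound integrability. *)
Definition profile_of (G : R) (u : 'rV[R]_n.+1 -> R) (W : R -> R) :=
  [/\ forall r, r <= 0 -> W r = 0,
    forall s r, 0 < s -> s <= r -> r <= 2 * s -> `|W r - W s| <= increment_bound n p G r s,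
    forall s, 0 < s -> `|W s| <= c * G * s `^ (- al) &
    {ae mu, forall x, u x = W (enorm x)}].

Lemma profile_decays G u W : 0 <= G -> profile_of G u W -> decays (n := n) al (c * G) W.
Proof.
move=> G0 [W0 WH WK uW]; split => //; first exact: W0.
by apply: measurable_radial => //; exact: increment_continuous WH.
Qed.

Lemma integral_profile G u W r : profile_of G u W -> Lp p u -> 0 <= G ->
  (\int[mu]_x (`|u x| `^ r)%:E = \int[mu]_x (`|W (enorm x)| `^ r)%:E)%E.
Proof.
move=> uW up G0; have mu_ : measurable_fun setT u by move/sub_Lfun_mfun : (up); rewrite inE.
have dW := profile_decays G0 uW.
apply: ae_eq_integral => //.
- apply/measurable_EFinP; apply: (measurableT_comp (measurable_powR _)); exact: measurableT_comp.
- apply/measurable_EFinP; exact: measurable_powR_norm dW.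
by have [_ _ _] := uW; apply: filterS => x -> _.
Qed.

(** The profile is controlled by the first partial derivative alone, which the
    full gradient dominates. *)
Lemma W1p_norm_profile G u : W1p_rad p u -> 0 <= G -> (W1p_norm p u <= G%:E)%E ->
  exists2 W, profile_of G u W & (\int[mu]_x (`|W (enorm x)| `^ p)%:E <= (G `^ p)%:E)%E.
Proof.
move=> [uW1 urad] G0.
have [up _] := uW1; have gp := gradP uW1.
have mu_ : measurable_fun setT u by move/sub_Lfun_mfun : (up); rewrite inE.
have mg i : measurable_fun setT (fun x => grad p u x ord0 i).
  by move/sub_Lfun_mfun : (gp.1 i); rewrite inE.
have mpow (f : 'rV[R]_n.+1 -> R) : measurable_fun setT f -> measurable_fun setT (fun x => f x `^ p).
  by move=> mf; exact: (measurableT_comp (measurable_powR _) mf).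
have mge : measurable_fun setT (fun x => enorm (grad p u x)).
  apply: (measurableT_comp (continuous_measurable_fun (@sqrt_continuous R))).
  by apply: measurable_sum => i; apply: measurable_funX; exact: mg.
have mS : measurable_fun setT (fun x => enorm (grad p u x) `^ p + `|u x| `^ p).
  by apply: measurable_funD; apply: mpow => //; exact: measurableT_comp.
rewrite /W1p_norm poweR_inv_le//; last by apply: integral_ge0 => x _; rewrite lee_fin addr_ge0 ?powR_ge0.
move=> H.
have gG : ('N[mu]_p%:E[EFin \o (fun x => grad p u x ord0 ord0)] <= G%:E)%E.
  rewrite LnormE poweR_inv_le//; last by apply: integral_ge0 => x _; rewrite lee_fin powR_ge0.
  apply: le_trans H; apply: ge0_le_integral => //.
  - by apply/measurable_EFinP; apply: mpow; exact: measurableT_comp.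
  - exact/measurable_EFinP.
  - move=> x _; rewrite lee_fin; apply: ler_wpDr; first exact: powR_ge0.
    by rewrite ge0_ler_powR ?nnegrE ?sqrtr_ge0 ?(ltW p0)// normr_coord_le_enorm.
have [W [W0 WH WK uW]] := radial_profile_exists p1 pn up gp urad gG.
exists W => //; rewrite -(@integral_profile G u W) //.
apply: le_trans H; apply: ge0_le_integral => //.
- by apply/measurable_EFinP; apply: mpow; exact: measurableT_comp.
- exact/measurable_EFinP.
- by move=> x _; rewrite lee_fin lerDr powR_ge0.
Qed.

Definition unit_ball_cst : R := fine (\int[mu]_x (ball_majorant q al 1 1 x)%:E).

Lemma integral_ball_majorant K : 0 <= K ->
  (\int[mu]_x (ball_majorant q al K 1 x)%:E = (K `^ q * unit_ball_cst)%:E)%E.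
Proof.
move=> K0; have i1 := integrable_ball_majorant 1 p0 pq al0 alq ltr01.
rewrite EFinM fineK; last exact: integrable_fin_num.
rewrite -integralZl//; apply: eq_integral => x _.
by rewrite /ball_majorant powR1 mul1r EFinM.
Qed.

Lemma unit_ball_cst_ge0 : 0 <= unit_ball_cst.
Proof.
apply: fine_ge0; apply: integral_ge0 => x _.
by rewrite lee_fin !mulr_ge0 ?powR_ge0.
Qed.

Lemma profile_Lq_bound G u W (B : R) : 0 <= G -> profile_of G u W ->
  (\int[mu]_x (`|W (enorm x)| `^ p)%:E <= B%:E)%E ->
  (\int[mu]_x (`|W (enorm x)| `^ q)%:E <= ((c * G) `^ q * unit_ball_cst + (c * G) `^ (q - p) * B)%:E)%E.
Proof.
move=> G0 uW WB; have cG : 0 <= c * G by rewrite mulr_ge0.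
have := radial_Lq_bound p0 pq al0 alq cG (profile_decays G0 uW) WB.
by rewrite integral_ball_majorant.
Qed.

Definition embedding_cst : R := (c `^ q * unit_ball_cst + c `^ (q - p)) `^ q^-1.

Lemma profile_Lq_norm G u W : 0 <= G -> profile_of G u W -> Lp p u ->
  (\int[mu]_x (`|W (enorm x)| `^ p)%:E <= (G `^ p)%:E)%E ->
  (Lp_norm q u <= (embedding_cst * G)%:E)%E.
Proof.
move=> G0 uW up WB; have I0 := unit_ball_cst_ge0.
have S0 : 0 <= c `^ q * unit_ball_cst + c `^ (q - p) by rewrite addr_ge0 ?mulr_ge0 ?powR_ge0.
rewrite /Lp_norm LnormE poweR_inv_le//; last 2 first.
- by rewrite mulr_ge0 ?powR_ge0.
- by apply: integral_ge0 => x _; rewrite lee_fin powR_ge0.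
rewrite (integral_profile q uW up G0); apply: (le_trans (profile_Lq_bound G0 uW WB)).
rewrite lee_fin [(embedding_cst * G) `^ q]powRM ?powR_ge0// /embedding_cst -powRrM mulVf ?gt_eqF// powRr1//.
have GE : G `^ (q - p) * G `^ p = G `^ q by rewrite -powRD ?subrK// gt_eqF.
rewrite le_eqVlt; apply/orP; left; apply/eqP.
by rewrite [(c * G) `^ q]powRM// [(c * G) `^ (q - p)]powRM// -GE; ring.
Qed.

Lemma W1p_rad_Lq (u : 'rV[R]_n.+1 -> R) : W1p_rad p u -> Lp q u.
Proof.
move=> [uW1 urad]; have [up _] := uW1; have gp := gradP uW1.
have mu_ : measurable_fun setT u by move/sub_Lfun_mfun : (up); rewrite inE.
have fg : ('N[mu]_p%:E[EFin \o (fun x => grad p u x ord0 ord0)])%E \is a fin_num.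
  rewrite ge0_fin_numE ?Lnorm_ge0//.
  by have := sub_Lfun_finLfun (gp.1 ord0 : _ \in Lfun mu p%:E); rewrite inE.
set g1 := ('N[mu]_p%:E[_])%E in fg.
have G0 : 0 <= fine g1 by apply: fine_ge0; exact: Lnorm_ge0.
have gG : (g1 <= (fine g1)%:E)%E by rewrite fineK.
have [W [W0 WH WK uW]] := radial_profile_exists p1 pn up gp urad gG.
have uW' : profile_of (fine g1) u W by [].
have If : (\int[mu]_x (`|u x| `^ p)%:E)%E \is a fin_num.
  by rewrite ge0_fin_numE ?(Lfun_integral_lty p0 up)// integral_ge0.
have IW : (\int[mu]_x (`|W (enorm x)| `^ p)%:E <= (fine (\int[mu]_x (`|u x| `^ p)%:E))%:E)%E.
  by rewrite -(integral_profile p uW' up G0) fineK.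
apply: LfunP_integral => //; rewrite (integral_profile q uW' up G0).
by apply: le_lt_trans (profile_Lq_bound G0 uW' IW) _; exact: ltry.
Qed.

Lemma W1p_rad_Lq_bound (u : 'rV[R]_n.+1 -> R) : W1p_rad p u ->
  (Lp_norm q u <= (embedding_cst + 1)%:E * W1p_norm p u)%E.
Proof.
move=> uX; have C0 : 0 < embedding_cst + 1 by rewrite ltr_wpDl ?powR_ge0.
have : (0 <= W1p_norm p u)%E by exact: poweR_ge0.
case E : (W1p_norm p u) => [G| |]//; last by rewrite gt0_muley ?leey// lte_fin.
rewrite lee_fin => G0.
have [W uW IW] : exists2 W, profile_of G u W &
    (\int[mu]_x (`|W (enorm x)| `^ p)%:E <= (G `^ p)%:E)%E.
  by apply: W1p_norm_profile => //; rewrite E.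
apply: (le_trans (profile_Lq_norm G0 uW uX.1.1 IW)).
by rewrite -EFinM lee_fin ler_wpM2r// lerDl.
Qed.

(** A subsequence of the profiles converges pointwise to some V, which
    inherits the increment and decay bounds, and the bound in L^p by Fatou's
    lemma. The differences with V decay like twice the common bound and tend
    to 0 pointwise, so that [radial_Lq_cvg0] applies to them. *)
Lemma W1p_rad_compact (u_ : nat -> 'rV[R]_n.+1 -> R) (M : R) :
  (forall k, W1p_rad p (u_ k)) -> (forall k, W1p_norm p (u_ k) <= M%:E)%E ->
  exists s : nat -> nat, {homo s : m n / (m < n)%N} /\
    exists2 v, Lp q v & (fun k => Lp_norm q (u_ (s k) - v)) @ \oo --> 0%E.
Proof.
move=> uX uM; have M0 : 0 <= M by rewrite -lee_fin (le_trans _ (uM 0%N))// poweR_ge0.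
have cM : 0 <= c * M by rewrite mulr_ge0.
have /choice[W HW] : forall k, exists W, profile_of M (u_ k) W /\
    (\int[mu]_x (`|W (enorm x)| `^ p)%:E <= (M `^ p)%:E)%E.
  by move=> k; have [W] := W1p_norm_profile (uX k) M0 (uM k); exists W.
have PW k : profile_of M (u_ k) (W k) by have [] := HW k.
have IW k : (\int[mu]_x (`|W k (enorm x)| `^ p)%:E <= (M `^ p)%:E)%E by have [] := HW k.
have dW k := profile_decays M0 (PW k).
have [|||s [sI [V [WV V0 VH]]]] := @radial_profiles_subsequence R n p p1 M (c * M) W M0.
- by move=> k; have [] := PW k.
- by move=> k; have [] := PW k.
- by move=> k; have [] := PW k.
have VK r : 0 < r -> `|V r| <= c * M * r `^ (- al).
  move=> r0; have cv : `|W (s k) r| @[k --> \oo] --> `|V r| by apply: cvg_norm; exact: WV.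
  apply: (ler_cvg_to cv (cvg_cst _)); apply: nearW => k.
  by have [_ _ + _] := PW (s k); apply.
have dV : decays (n := n) al (c * M) V.
  by split => //; [exact: V0|apply: measurable_radial => //; exact: increment_continuous VH].
have IV : (\int[mu]_x (`|V (enorm x)| `^ p)%:E <= (M `^ p)%:E)%E.
  have mf k : measurable_fun setT (fun x : 'rV[R]_n.+1 => (`|W (s k) (enorm x)| `^ p)%:E).
    by apply/measurable_EFinP; exact: measurable_powR_norm (dW _).
  have f0 k (x : 'rV[R]_n.+1) : (0 <= (`|W (s k) (enorm x)| `^ p)%:E)%E by rewrite lee_fin powR_ge0.
  have ff (x : 'rV[R]_n.+1) : (`|W (s k) (enorm x)| `^ p)%:E @[k --> \oo] --> (`|V (enorm x)| `^ p)%:E.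
    by apply/cvg_EFin; [exact: nearW|apply: cvg_normr_powR => //; exact: WV].
  exact: fatou_le mf f0 ff (fun k => IW (s k)).
exists s; split => //; exists (fun x => V (enorm x)).
  apply: LfunP_integral => //; first by have [] := dV.
  apply: le_lt_trans (radial_Lq_bound p0 pq al0 alq cM dV IV) _.
  by rewrite integral_ball_majorant// -EFinD ltry.
pose D k r := W (s k) r - V r.
have cM2 : 0 <= 2 * (c * M) by rewrite mulr_ge0.
have dD k : decays (n := n) al (2 * (c * M)) (D k).
  have [W0 WK mW] := dW (s k); have [V0' _ mV] := dV; split.
  - by rewrite /D W0 V0' subrr.
  - move=> r r0; apply: (le_trans (ler_normB _ _)).
    by rewrite -mulrA mulr_natl mulr2n lerD// ?WK ?VK.
  - exact: measurable_funB.
pose B : R := 2 `^ p * (M `^ p + M `^ p).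
have ID k : (\int[mu]_x (`|D k (enorm x)| `^ p)%:E <= B%:E)%E.
  have mWp := measurable_powR_norm p (dW (s k)); have mVp := measurable_powR_norm p dV.
  apply: (@le_trans _ _ (\int[mu]_x ((2 `^ p)%:E * ((`|W (s k) (enorm x)| `^ p)%:E + (`|V (enorm x)| `^ p)%:E)))%E).
    apply: ge0_le_integral => //.
    - by apply/measurable_EFinP; exact: measurable_powR_norm (dD k).
    - by apply: measurable_funeM; apply: emeasurable_funD; exact/measurable_EFinP.
    - move=> x _; rewrite -EFinD -EFinM lee_fin; apply: le_trans (powR_add_le _ _ p0) => //.
      by rewrite ge0_ler_powR ?nnegrE ?(ltW p0)// ?addr_ge0// ler_normB.
  rewrite ge0_integralZl//; last 2 first.
  - by apply: emeasurable_funD; exact/measurable_EFinP.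
  - by move=> x _; rewrite -EFinD lee_fin addr_ge0 ?powR_ge0.
  have h0 (W' : R -> R) (x : 'rV[R]_n.+1) : setT x -> (0 <= (`|W' (enorm x)| `^ p)%:E)%E.
    by rewrite lee_fin powR_ge0.
  have mWE : measurable_fun setT (fun x : 'rV[R]_n.+1 => (`|W (s k) (enorm x)| `^ p)%:E).
    exact/measurable_EFinP.
  have mVE : measurable_fun setT (fun x : 'rV[R]_n.+1 => (`|V (enorm x)| `^ p)%:E).
    exact/measurable_EFinP.
  rewrite (ge0_integralD mu measurableT (h0 _) mWE (h0 _) mVE).
  rewrite /B EFinM EFinD; apply: lee_wpmul2l; first by rewrite lee_fin powR_ge0.
  exact: leeD (IW _) IV.
have cD r : D k r @[k --> \oo] --> 0.
  rewrite -(subrr (V r)); apply: cvgB; [exact: WV|exact: cvg_cst].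
have H := radial_Lq_cvg0 p0 pq al0 alq cM2 dD ID cD.
have E k : (Lp_norm q (u_ (s k) - (fun x => V (enorm x)))%R =
    (\int[mu]_x (`|D k (enorm x)| `^ q)%:E) `^ q^-1)%E.
  have mu_ : measurable_fun setT (fun x : 'rV[R]_n.+1 => (`|u_ (s k) x - V (enorm x)| `^ q)%:E).
    apply/measurable_EFinP; apply: (measurableT_comp (measurable_powR _)).
    apply: measurableT_comp => //; apply: measurable_funB; last by have [] := dV.
    by move/sub_Lfun_mfun : ((uX (s k)).1.1); rewrite inE.
  have mD : measurable_fun setT (fun x : 'rV[R]_n.+1 => (`|D k (enorm x)| `^ q)%:E).
    by apply/measurable_EFinP; exact: measurable_powR_norm (dD k).
  have I : (\int[mu]_x (`|u_ (s k) x - V (enorm x)| `^ q)%:E =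
      \int[mu]_x (`|D k (enorm x)| `^ q)%:E)%E.
    apply: ae_eq_integral => //.
    by have [_ _ _] := PW (s k); apply: filterS => x ux _; rewrite /D -ux.
  by rewrite /Lp_norm LnormE -I; congr poweR; apply: eq_integral.
apply/fine_cvgP; split.
  move: (H 1 ltr01); apply: filterS => k Hk.
  by rewrite E ge0_fin_numE ?poweR_ge0// poweR_lty// (le_lt_trans Hk)// ltry.
apply/cvgrPdist_le => e e0.
have eq0 : 0 < e `^ q by rewrite powR_gt0.
move: (H _ eq0); apply: filterS => k Hk.
rewrite sub0r normrN /= E ger0_norm ?fine_ge0 ?poweR_ge0//.
have I0 : (0 <= \int[mu]_x (`|D k (enorm x)| `^ q)%:E)%E by exact: integral_ge0.
move: Hk; rewrite -poweR_inv_le ?(ltW e0)// => Hk.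
rewrite -lee_fin fineK// ge0_fin_numE ?poweR_ge0//.
exact: le_lt_trans Hk (ltry _).
Qed.

End radial_sobolev.

Theorem lemma1 (R : realType) (N : nat) (p q : R)
    (N_ge3 : (3 <= N)%N) (p_gt1 : 1 < p) (p_ltN : p < N%:R)
    (p_lt_q : p < q) (q_lt_pstar : q < sobolev_exponent N p) :
  compact_embedding (@W1p_rad R N p) (@W1p_norm R N p)
                    (@Lp R N q) (@Lp_norm R N q).
Proof.
case: N N_ge3 p_ltN q_lt_pstar => [//|n] _ pn qs; split.
- by move=> u; exact: W1p_rad_Lq.
- by eexists => u; exact: W1p_rad_Lq_bound.
- by move=> u_ uX [M uM]; exact: W1p_rad_compact uX uM.
Qed.
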